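(* Let $d\ge 1$, let $\mathbb{F}=(\mathcal{F}_n)_{n\ge 0}$ be a filtration, and let $(\varepsilon_n)$ be a real martingale difference sequence adapted to $\mathbb{F}$ with $\mathbb{E}[\varepsilon_{n+1}^2\mid\mathcal{F}_n]=\sigma^2$ a.s. for all $n\ge 0$ (with $\sigma^2$ a deterministic constant). Suppose that for some integer $p\ge 1$ and some real number $a>2p$, $\sup_{n\ge 0}\mathbb{E}[|\varepsilon_{n+1}|^{a}\mid\mathcal{F}_n]<\infty$ a.s. Let $\theta=(\theta_1,\dots,\theta_d)^t\in\mathbb{R}^d$ and let $(X_n)$ be the linear autoregressive process $$X_{n+1}=\sum_{k=1}^d\theta_kX_{n-k+1}+\varepsilon_{n+1},\qquad n\ge 0,$$ whose companion matrix $C$ (see context) has spectral radius $\rho(C)<1$. In addition, suppose that for some integer $1\le q\le p$ there is a constant $\sigma(2q)$ with $\mathbb{E}[\varepsilon_{n+1}^{2q}\mid\mathcal{F}_n]=\sigma(2q)$ a.s. for all $n\ge 0$. Let $\widehat\theta_n$ be the least squares estimator of $\theta$, and let $$\Gamma_n(2q)=\frac1n\sum_{k=0}^{n-1}\bigl(X_{k+1}-\widehat\theta_k^t\Phi_k\bigr)^{2q},\qquad \Delta_n(2q)=\frac1n\sum_{k=1}^{n}\varepsilon_k^{2q}.$$ Then $\Gamma_n(2q)$ is a strongly consistent estimator of $\sigma(2q)$, i.e. $\Gamma_n(2q)\to\sigma(2q)$ a.s., with $$\bigl(\Gamma_n(2q)-\Delta_n(2q)\bigr)^2=O\Bigl(\frac{\log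 n}{n}\Bigr)\quad\text{a.s.}$$ Moreover, $$\lim_{n\to\infty}\frac{1}{\log n}\sum_{k=1}^nk^{p-1}\Bigl((\widehat\theta_k-\theta)^tL(\widehat\theta_k-\theta)\Bigr)^p=\ell(p)\quad\text{a.s.},$$ where $\ell(p)=d\,\sigma^{2p}\prod_{j=1}^{p-1}(d+2j)$ and $L=\sum_{k=0}^\infty C^k\Gamma(C^t)^k$, with $\Gamma$ the $d\times d$ matrix whose $(1,1)$ entry is $\sigma^2$ and whose other entries are $0$.
   Context: The superscript $t$ denotes transpose. The initial values $X_0,X_{-1},\dots,X_{1-d}$ are $\mathcal{F}_0$-measurable, and the regression vector is $\Phi_n=(X_n,X_{n-1},\dots,X_{n-d+1})^t$, so that $X_{n+1}=\theta^t\Phi_n+\varepsilon_{n+1}$. The companion matrix $C$ is the $d\times d$ matrix with first row $(\theta_1,\dots,\theta_d)$, entries $C_{i+1,i}=1$ for $1\le i\le d-1$, and all other entries $0$. $S_n=\sum_{k=0}^n\Phi_k\Phi_k^t+S$, where $S$ is a fixed deterministic symmetric positive definite $d\times d$ matrix. The least squares estimator is $\widehat\theta_n=S_{n-1}^{-1}\sum_{k=1}^n\Phi_{k-1}X_k$ for $n\ge1$, and $\widehat\theta_0=0$. An empty product equals $1$. *)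

(* Defs.v *)
From HB Require Import structures.
From mathcomp Require Import all_boot all_order all_algebra.
From mathcomp Require Import complex.
From mathcomp Require Import all_classical all_reals all_analysis.
From mathcomp Require Import measurable_realfun.
Set Implicit Arguments.
Unset Strict Implicit.
Unset Printing Implicit Defensive.
Import Order.TTheory GRing.Theory Num.Theory.
Import numFieldNormedType.Exports.
Local Open Scope classical_set_scope.
Local Open Scope ring_scope.

Section probability.
Context {disp : measure_display} {T : measurableType disp} {R : realType}.

Definition filtration (F : nat -> set (set T)) : Prop :=
  [/\ forall n, sigma_algebra setT (F n),
      forall n, F n `<=` measurable &
      forall m n, (m <= n)%N -> F m `<=` F n].

(* On [g_sigma_algebraType G] the measurable sets are [<<s G >>], which is [G]
   itself whenever [G] is a sigma-algebra. *)
Definition measurable_wrt {disp' : measure_display} {U : measurableType disp'}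
    (G : set (set T)) (Y : T -> U) : Prop :=
  measurable_fun setT (Y : g_sigma_algebraType G -> U).

(* [Z] is a version of [E[Y | G]].  Besides integrable variables, nonnegative
   ones are allowed, with a conditional expectation that may take the value
   [+oo]; it is also characterized up to a [P]-negligible set.  Accordingly
   "E[Y | G] = c almost surely", for a constant [c], says that [cst c] is a
   version of [E[Y | G]]. *)
Definition is_cond_expectation (P : probability T R) (G : set (set T))
    (Y Z : T -> \bar R) : Prop :=
  [/\ measurable_fun setT Y,
      measurable_wrt G Z,
      (P.-integrable setT Y /\ P.-integrable setT Z) \/
      ((forall w, 0 <= Y w)%E /\ (forall w, 0 <= Z w)%E) &
      forall A, G A -> (\int[P]_(w in A) Z w = \int[P]_(w in A) Y w)%E].

(* The sequence is indexed from 1: [eps 0] is never used. *)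
Definition martingale_difference (P : probability T R)
    (F : nat -> set (set T)) (eps : nat -> T -> R) : Prop :=
  forall n, [/\ measurable_wrt (F n.+1) (eps n.+1),
    P.-integrable setT (EFin \o eps n.+1) &
    is_cond_expectation P (F n) (EFin \o eps n.+1) (cst 0%E)].

End probability.

Section matrices.
Context {R : realType} {d : nat}.
Implicit Types (A C : 'M[R]_d) (theta : 'cV[R]_d).

Definition quad_form A (v : 'cV[R]_d) : R := (v^T *m A *m v) 0 0.

Definition sym_posdef A : Prop :=
  A^T = A /\ forall v : 'cV[R]_d, v != 0 -> 0 < quad_form A v.

Definition spectral_radius A : R :=
  sup [set r : R | exists2 z : R[i],
         eigenvalue (map_mx (real_complex R) A) z & `|z| = (r%:C)%C].

Definition companion theta : 'M[R]_d :=
  \matrix_(i < d, j < d)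
    if i == 0%N :> nat then theta j 0 else (i == j.+1 :> nat)%:R.

Definition noise_cov (sigma : R) : 'M[R]_d :=
  \matrix_(i < d, j < d)
    if (i == 0%N :> nat) && (j == 0%N :> nat) then sigma ^+ 2 else 0.

(* The matrix series is taken entrywise. *)
Definition limit_cov C (sigma : R) : 'M[R]_d :=
  \matrix_(i < d, j < d)
    limn (fun n : nat =>
      \sum_(0 <= k < n) (C ^+ k *m noise_cov sigma *m C^T ^+ k) i j).

End matrices.

Section autoregression.
Context {disp : measure_display} {T : measurableType disp} {R : realType}.
Context {d : nat}.
(* Only the indices [1 - d, 2 - d, ...] of [X] are used. *)
Implicit Types (X : int -> T -> R) (eps : nat -> T -> R).
Implicit Types (theta : 'cV[R]_d) (S : 'M[R]_d) (w : T).

(* [theta k 0], with [k] counted from 0, is the coefficient usually written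
   with index [k + 1]. *)
Definition autoregressive (F : nat -> set (set T)) theta eps X : Prop :=
  (forall j : 'I_d, measurable_wrt (F 0%N) (X (- j%:Z))) /\
  (forall (n : nat) w,
     X n.+1%:Z w = \sum_(k < d) theta k 0 * X (n%:Z - k%:Z) w + eps n.+1 w).

Definition regressor X (n : nat) w : 'cV[R]_d :=
  \col_(j < d) X (n%:Z - j%:Z) w.

Definition gram S X (n : nat) w : 'M[R]_d :=
  \sum_(0 <= k < n.+1) regressor X k w *m (regressor X k w)^T + S.

Definition lse S X (n : nat) w : 'cV[R]_d :=
  if n is m.+1 then
    invmx (gram S X m w) *m
      \sum_(1 <= k < m.+2) X k%:Z w *: regressor X k.-1 w
  else 0.

Definition Gamma_est S X (r n : nat) w : R :=
  n%:R^-1 * \sum_(0 <= k < n)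
    (X k.+1%:Z w - ((lse S X k w)^T *m regressor X k w) 0 0) ^+ r.

Definition Delta_est eps (r n : nat) w : R :=
  n%:R^-1 * \sum_(1 <= k < n.+1) eps k w ^+ r.

End autoregression.

Definition ell {R : realType} (d : nat) (sigma : R) (p : nat) : R :=
  d%:R * sigma ^+ (2 * p) * \prod_(1 <= j < p) (d + 2 * j)%:R.

(* Main.v *)
(* Write e_k for the noise eps_{k+1}, Phi_k for the regressors, A_n for the
   regularized Gram matrix S + sum_{k<n} Phi_k Phi_k^t and N_n for the vector
   sum_{k<n} e_k Phi_k - S theta, so that the estimation error is A_n^-1 N_n.
   The energy V_n = N_n^t A_n^-1 N_n satisfies, with x_n = N_n^t A_{n+1}^-1 N_n,
   b_n = Phi_n^t A_{n+1}^-1 N_n and f_n = Phi_n^t A_{n+1}^-1 Phi_n,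
     V_{n+1} = x_n + 2 e_n b_n + e_n^2 f_n,    b_n^2 <= f_n x_n.
   Raising this to the power m gives an almost supermartingale, whence
   V^m = O(log^(1+g)), and then a martingale expansion relating
   sum (V_k^m - x_k^m) to sum f_k V_k^(m-1) and sum b_k^2 V_k^(m-2), up to
   o(log n).  The martingale terms are handled pathwise: a transform sum u_k z_k
   of the noise is almost surely bounded as soon as sum |u_k|^r < oo for some
   1 < r <= 2 allowed by the moments, which only requires the conditional
   moments to be almost surely finite.
   As A_n / n tends to the matrix L of the theorem at a polynomial rate (solve
   the Lyapunov equation L = C L C^t + Gamma), V_n can be compared with
   V'_n = N_n^t L^-1 N_n / (n+1), for which x'_n = V'_n (n+1)/(n+2): now
   sum (V'_k^m - x'_k^m) is m sum V'_k^m / (k+1), up to a bounded error.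
   Induction on m yields
   sum V'_k^m / (k+1) ~ l(m) log n with l(m) = sigma^2 (d + 2(m-1)) l(m-1);
   replacing f_k by d / (k+1) in sum f_k V_k^m is a summation by parts.
   For Gamma_n, the prediction error is e_k - pi_k where
   (1 - f_k) pi_k^2 = V_k - x_k, so that sum pi_k^2 = O(log n), and
   Cauchy-Schwarz bounds the cross terms.  If sigma = 0 then the noise vanishes
   and sum pi_k^2 is bounded. *)

Require Import Defs.
From HB Require Import structures.
From mathcomp Require Import all_boot all_order all_algebra.
From mathcomp Require Import all_classical all_reals all_analysis.
From mathcomp Require Import measurable_realfun.
From mathcomp Require Import complex zify ring lra.
Set Implicit Arguments.
Unset Strict Implicit.
Unset Printing Implicit Defensive.
Import Order.TTheory GRing.Theory Num.Theory.
Import numFieldNormedType.Exports.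
Local Open Scope classical_set_scope.
Local Open Scope ring_scope.

Section sequences.
Context {R : realType}.
Implicit Types (x y : nat -> R).

(** Two obstacles shape the argument. The conditional moments are only almost surely finite, so
    expectations of powers of the energy cannot be estimated directly; integrals are taken over
    events of [F n] on which the conditional moment, the initial value and the accumulated drift are
    below an integer [K], and almost every relevant path is captured by some [K]. This yields only
    boundedness of martingale transforms, which is enough: a bounded normalized sum gives a growth
    rate by Kronecker's lemma. Next, the leverage need not be pointwise of order 1/n, because the
    regressors may be unbounded. Errors are therefore measured against a weight [Q], equal to 1 plus
    the squared norm of the regressor, whose averages are bounded; a term of order [Q n] n^(-1-eta)
    is summable, and a term of order [Q n]/n times anything polynomially small falls in that class.
    The detour through the limiting form is made because its drop is an explicit fraction of itself,
    so that its powers satisfy a closed linear recursion, while the drop of the true energy involves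
    the unknown slopes. *)

Definition bounded_seq x := exists C, forall n, `|x n| <= C.
Definition abs_summable x := exists C, forall n, \sum_(k < n) `|x k| <= C.

End sequences.

(** * Almost supermartingales and martingale transforms *)

Section conditioning.
Context {disp : measure_display} {T : measurableType disp} {R : realType}.
Variable P : probability T R.
Variable G : set (set T).
Hypothesis sG : sigma_algebra setT G.
Hypothesis GT : G `<=` measurable.

Lemma g_sigma_measurableE (A : set T) :
  measurable (A : set (g_sigma_algebraType G)) = G A.
Proof. by rewrite /measurable /= sigma_algebra_id. Qed.

Lemma measurable_wrt_measurable d' (U : measurableType d') (Y : T -> U) :
  measurable_wrt G Y -> measurable_fun setT Y.
Proof.
move=> mY _ B mB; apply: GT; rewrite -g_sigma_measurableE.
exact: (mY measurableT B mB).
Qed.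

Lemma measurable_wrt_preimage d' (U : measurableType d') (Y : T -> U) B :
  measurable_wrt G Y -> measurable B -> G (Y @^-1` B).
Proof.
move=> mY mB; rewrite -g_sigma_measurableE -[X in measurable X]setTI.
exact: (mY measurableT B mB).
Qed.

Import HBNNSimple.

(** A nonnegative [u] measurable for [G] is an increasing limit of simple functions whose level sets
    lie in [G], so the comparison on sets of [G] passes to finite sums and then, by monotone
    convergence, to the limit. *)
Lemma le_integral_mulr (z c : T -> \bar R) (u : T -> R) :
  measurable_fun setT z -> measurable_fun setT c ->
  (forall w, 0 <= z w)%E -> (forall w, 0 <= c w)%E ->
  (forall A, G A -> (\int[P]_(w in A) z w <= \int[P]_(w in A) c w)%E) ->
  measurable_wrt G u -> (forall w, 0 <= u w) ->
  (\int[P]_w ((u w)%:E * z w) <= \int[P]_w ((u w)%:E * c w))%E.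
Proof.
move=> mz mc z0 c0 zc mu u0.
pose T' := g_sigma_algebraType G.
have mu' : measurable_fun (setT : set T') (EFin \o u : T' -> \bar R).
  exact/measurable_EFinP.
pose g := nnsfun_approx (@measurableT _ T') mu'.
have mg n : measurable_fun (setT : set T) (g n : T -> R).
  apply: (@measurable_wrt_measurable _ R (g n : T -> R)).
  exact: (@measurable_funPT _ _ _ _ (g n)).
have key n : (\int[P]_w ((g n w)%:E * z w) <= \int[P]_w ((g n w)%:E * c w))%E.
  have E (h : T -> \bar R) : measurable_fun setT h -> (forall w, 0 <= h w)%E ->
      (\int[P]_w ((g n w)%:E * h w) =
       \sum_(y \in range (g n)) y%:E * \int[P]_(w in g n @^-1` [set y]) h w)%E.
    move=> mh h0.
    have mpre (y : R) : measurable ((g n : T -> R) @^-1` [set y]).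
      by rewrite -[X in measurable X]setTI; exact: mg.
    transitivity (\int[P]_w (\sum_(y \in range (g n))
        (y%:E * (h \_ (g n @^-1` [set y])) w)))%E.
      apply: eq_integral => w _.
      rewrite (fsbigD1 (g n w)) //=; last by exists w.
      rewrite fsbig1 ?adde0; last first.
        move=> y [_ /= yw]; rewrite patchE; case: ifPn; rewrite ?mule0//.
        by rewrite inE /= => /esym.
      by rewrite patchE ifT// inE.
    rewrite ge0_integral_fsum//.
    - apply: eq_fsbigr => y /set_mem [w _ <-].
      rewrite ge0_integralZl ?lee_fin//; first by rewrite [in RHS]integral_mkcond.
      + by apply/(measurable_restrictT _ (mpre _)); exact: measurable_funTS.
      + by move=> w' _; rewrite patchE; case: ifP.
    - move=> y; apply: emeasurable_funM; first exact: measurable_cst.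
      by apply/(measurable_restrictT _ (mpre _)); exact: measurable_funTS.
    - move=> y w _; case: (boolP (w \in g n @^-1` [set y])) => hw.
        by rewrite patchE hw mule_ge0// lee_fin; move: hw; rewrite inE /= => <-.
      by rewrite patchE (negbTE hw) mule0.
  rewrite !E//; apply: lee_fsum => // y [w _ <-].
  rewrite lee_pmul ?lee_fin//; first by apply: integral_ge0.
  apply: zc; rewrite -g_sigma_measurableE -[X in measurable X]setTI.
  exact: (@measurable_funPT _ _ _ _ (g n)).
have cvgE (h : T -> \bar R) : measurable_fun setT h -> (forall w, 0 <= h w)%E ->
    (\int[P]_w ((g n w)%:E * h w) @[n --> \oo] --> \int[P]_w ((u w)%:E * h w))%E.
  move=> mh h0.
  have lim w : ((g n w)%:E * h w @[n --> \oo] --> (u w)%:E * h w)%E.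
    have gu : (EFin \o g ^~ w) @ \oo --> (u w)%:E.
      by apply: cvg_nnsfun_approx => // x _; rewrite /= lee_fin.
    have [->|hw] := eqVneq (h w) 0%E.
      by under eq_fun do rewrite mule0; rewrite mule0; exact: cvg_cst.
    case hE : (h w) hw => [r| |] hw.
    - by apply: cvgeM => //; exact: cvg_cst.
    (* Here [h w] is infinite, where the product is discontinuous at 0: when [u w] vanishes, the
       approximations from below vanish as well, and 0 times infinity is 0 on both sides. *)
    - have [u_eq0|u_neq0] := eqVneq (u w) 0.
        rewrite u_eq0 mul0e.
        have gw n : g n w = 0.
          apply/eqP; rewrite eq_le; apply/andP; split; last by [].
          have : ((g n w)%:E <= (u w)%:E)%E.
            have nd : nondecreasing_seq (EFin \o g ^~ w).
              move=> i j ij; rewrite lee_fin.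
              by have /lefP := nd_nnsfun_approx (@measurableT _ T') mu' ij; exact.
            rewrite -(cvg_lim _ gu)// (cvg_lim _ (ereal_nondecreasing_cvgn nd))//.
            by apply: ereal_sup_ubound; exists n.
          by rewrite u_eq0 lee_fin.
        by under eq_fun do rewrite gw mul0e; exact: cvg_cst.
      by apply: cvgeM => //; exact: cvg_cst.
    - by have := h0 w; rewrite hE.
  have Elim : (fun w => (u w)%:E * h w)%E =
      (fun w => limn (fun n => (g n w)%:E * h w))%E.
    by apply/funext => w; apply/esym/cvg_lim => //; exact: lim.
  rewrite [X in _ --> X](_ : _ = (\int[P]_w limn (fun n => (g n w)%:E * h w))%E);
    last by apply: eq_integral => w _; move/funeqP: Elim => ->.
  apply: cvg_monotone_convergence => //.
  - move=> n; apply: emeasurable_funM => //; exact/measurable_EFinP.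
  - by move=> n w _; rewrite mule_ge0 ?lee_fin.
  - move=> w _ m n mn; rewrite lee_wpmul2r// lee_fin.
    by have /lefP := nd_nnsfun_approx (@measurableT _ T') mu' mn; exact.
rewrite -(cvg_lim _ (cvgE z mz z0))// -(cvg_lim _ (cvgE c mc c0))//.
apply: lee_lim; [by apply/cvg_ex; eexists; exact: cvgE|
  by apply/cvg_ex; eexists; exact: cvgE|exact: nearW].
Qed.

End conditioning.

Ltac nonneg := repeat first [apply: adde_ge0 | apply: mule_ge0 |
  exact: funepos_ge0 | exact: funeneg_ge0 | by rewrite lee_fin].

(** * Conditional drift inequality for one time step *)

Section one_step.
Context {disp : measure_display} {T : measurableType disp} {R : realType}.
Variable P : probability T R.
Variable G : set (set T).
Hypothesis sG : sigma_algebra setT G.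
Hypothesis GT : G `<=` measurable.

Lemma sigma_algebraI (A B : set T) : G A -> G B -> G (A `&` B).
Proof. by rewrite -!(g_sigma_measurableE sG); exact: measurableI. Qed.

(** Multiplying both integrands by the indicator of [B] reduces this to the global version. The
    comparison is then only asked for inside [B], where the conditional moment is under control. *)
Lemma le_integral_mulr_in (B : set T) (z c : T -> \bar R) (u : T -> R) :
  G B -> measurable_fun setT z -> measurable_fun setT c ->
  (forall w, 0 <= z w)%E -> (forall w, 0 <= c w)%E ->
  (forall A, G A -> A `<=` B ->
    (\int[P]_(w in A) z w <= \int[P]_(w in A) c w)%E) ->
  measurable_wrt G u -> (forall w, 0 <= u w) ->
  (\int[P]_(w in B) ((u w)%:E * z w) <= \int[P]_(w in B) ((u w)%:E * c w))%E.
Proof.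
move=> GB mz mc z0 c0 zc mu u0.
have mB := GT GB.
have E h : (\int[P]_(w in B) ((u w)%:E * h w) =
    \int[P]_w ((u w)%:E * (h \_ B) w))%E.
  rewrite integral_mkcond; apply: eq_integral => w _.
  by rewrite !patchE; case: ifP; rewrite ?mule0.
rewrite !E; apply: (le_integral_mulr (G := G)) => //.
- by apply/(measurable_restrictT _ mB); exact: measurable_funTS.
- by apply/(measurable_restrictT _ mB); exact: measurable_funTS.
- by move=> w; rewrite patchE; case: ifP.
- by move=> w; rewrite patchE; case: ifP.
- move=> A GA; rewrite -!integral_mkcondr; apply: zc.
  + exact: sigma_algebraI.
  + exact: subIsetr.
Qed.

(** Zero conditional mean given [G], in integrated form: the proofs only handle integrals over
    events, so no conditional expectation operator is introduced. *)
Definition centred (zeta : T -> R) : Prop :=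
  P.-integrable setT (EFin \o zeta) /\
  forall A, G A -> (\int[P]_(w in A) (zeta w)%:E = 0)%E.

(** Zero mean over each event of [G] says that the two parts of [zeta] have equal integrals there;
    the comparison, applied in both directions, carries this over to the weight [u]. Both sides may
    be infinite, which is why the parts are kept separate. *)
Lemma centred_mulr (B : set T) (zeta u : T -> R) :
  centred zeta -> G B -> measurable_wrt G u -> (forall w, 0 <= u w) ->
  (\int[P]_(w in B) ((u w)%:E * (EFin \o zeta)^\+ w) =
   \int[P]_(w in B) ((u w)%:E * (EFin \o zeta)^\- w))%E.
Proof.
move=> [izeta zeta0] GB mu u0.
have mz := measurable_int _ izeta.
have E A : G A -> (\int[P]_(w in A) (EFin \o zeta)^\+ w =
    \int[P]_(w in A) (EFin \o zeta)^\- w)%E.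
  move=> GA; have mA := GT GA.
  have iA : P.-integrable A (EFin \o zeta).
    exact: (integrableS measurableT mA (@subsetT _ A) izeta).
  have := zeta0 _ GA; rewrite integralE => /eqP.
  rewrite sube_eq ?add0e; first by move/eqP.
  + exact: integrable_pos_fin_num.
  + by rewrite fin_num_adde_defr// integrable_neg_fin_num.
apply/eqP; rewrite eq_le; apply/andP; split; apply: le_integral_mulr_in => //.
- exact: measurable_funepos.
- exact: measurable_funeneg.
- by move=> A GA _; rewrite E.
- exact: measurable_funeneg.
- exact: measurable_funepos.
- by move=> A GA _; rewrite E.
Qed.

Variables (M : T -> \bar R) (z : T -> R) (K : R).
Hypothesis z0 : forall w, 0 <= z w.
Hypothesis mz : measurable_fun setT z.
Hypothesis zM : forall A, G A -> A `<=` [set w | (M w <= K%:E)%E] ->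
  (\int[P]_(w in A) (z w)%:E <= \int[P]_(w in A) K%:E)%E.
Hypothesis K0 : 0 <= K.

(** The term [u zeta] integrates to zero over [B], and [z] has conditional mean at most [K] there.
    The bound [C] on [u] makes the integrals of the signed parts finite, hence cancellable. *)
Lemma one_step_bounded (B : set T) (Y Y' u v zeta : T -> R) (C : R) :
  centred zeta -> G B -> B `<=` [set w | (M w <= K%:E)%E] ->
  measurable_wrt G u -> measurable_wrt G v -> measurable_wrt G Y ->
  measurable_fun setT Y' ->
  (forall w, 0 <= v w) -> (forall w, 0 <= Y w) -> (forall w, 0 <= Y' w) ->
  (forall w, Y' w <= Y w + u w * zeta w + v w * z w) ->
  B `<=` [set w | `|u w| <= C] ->
  (\int[P]_(w in B) (Y' w)%:E <=
   \int[P]_(w in B) (Y w)%:E + K%:E * \int[P]_(w in B) (v w)%:E)%E.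
Proof.
move=> czeta GB BM mu mv mY mY' v0 Y0 Y'0 ineq BC.
have mB := GT GB.
pose up w := Num.max (u w) 0; pose un w := Num.max (- u w) 0.
have mup : measurable_wrt G up by apply: measurable_maxr => //.
have mun : measurable_wrt G un.
  by apply: measurable_maxr => //; apply: measurable_funN.
have up0 w : 0 <= up w by rewrite le_max lexx orbT.
have un0 w : 0 <= un w by rewrite le_max lexx orbT.
have mT (f : T -> R) : measurable_wrt G f -> measurable_fun B (EFin \o f).
  move=> /(measurable_wrt_measurable sG GT) mf.
  by apply/measurable_EFinP; exact: measurable_funTS.
have [izeta _] := czeta.
have mzeta := measurable_int _ izeta.
have mzp : measurable_fun B (EFin \o zeta)^\+%E.
  by apply: measurable_funTS; exact: measurable_funepos.
have mzn : measurable_fun B (EFin \o zeta)^\-%E.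
  by apply: measurable_funTS; exact: measurable_funeneg.
have mprod (f : T -> R) h : measurable_wrt G f -> measurable_fun B h ->
    measurable_fun B (fun w => (f w)%:E * h w)%E.
  by move=> mf mh; apply: emeasurable_funM => //; exact: mT.
pose I1 := (\int[P]_(w in B) ((up w)%:E * (EFin \o zeta)^\+ w))%E.
pose I2 := (\int[P]_(w in B) ((un w)%:E * (EFin \o zeta)^\- w))%E.
have fin (f : T -> R) h : measurable_wrt G f -> (forall w, 0 <= f w) ->
    (forall w, B w -> f w <= C) -> measurable_fun setT h ->
    (forall w, 0 <= h w)%E -> (\int[P]_w h w \is a fin_num)%E ->
    (\int[P]_(w in B) ((f w)%:E * h w) \is a fin_num)%E.
  move=> mf f0 fC mh h0 hfin; have mhB : measurable_fun B h by exact: measurable_funTS.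
  rewrite ge0_fin_numE; last first.
    by apply: integral_ge0 => w _; rewrite mule_ge0 ?lee_fin.
  have [->|/set0P[w0 Bw0]] := eqVneq B set0; first by rewrite integral_set0 ltry.
  have C0 : 0 <= C by rewrite (le_trans (f0 w0))// fC.
  apply: (@le_lt_trans _ _ (\int[P]_(w in B) (C%:E * h w))%E).
    apply: ge0_le_integral => //.
    - by move=> w _; rewrite mule_ge0 ?lee_fin.
    - exact: mprod.
    - by apply: emeasurable_funM => //; exact: measurable_cst.
    - by move=> w Bw; rewrite lee_wpmul2r// lee_fin fC.
  rewrite ge0_integralZl ?lee_fin//.
  rewrite lte_mul_pinfty ?lee_fin//.
  apply: (@le_lt_trans _ _ (\int[P]_w h w)%E); last by rewrite -ge0_fin_numE ?integral_ge0.
  by apply: ge0_subset_integral.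
have ipos := integrable_pos_fin_num measurableT izeta.
have ineg := integrable_neg_fin_num measurableT izeta.
have uC w : B w -> (up w <= C) /\ (un w <= C).
  move=> /BC /= uC; have C0 : 0 <= C := le_trans (normr_ge0 _) uC.
  move: uC; rewrite ler_norml /up /un => /andP[? ?].
  by rewrite !ge_max; split; apply/andP; split => //; rewrite lerNl.
have fin1 : I1 \is a fin_num.
  apply: fin => //; [by move=> w /uC[]|exact: measurable_funepos].
have fin2 : I2 \is a fin_num.
  apply: fin => //; [by move=> w /uC[]|exact: measurable_funeneg].
have J1 : (\int[P]_(w in B) ((up w)%:E * (EFin \o zeta)^\- w))%E = I1.
  by rewrite /I1 centred_mulr.
have J2 : (\int[P]_(w in B) ((un w)%:E * (EFin \o zeta)^\+ w))%E = I2.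
  by rewrite /I2 centred_mulr.
have vzK : (\int[P]_(w in B) ((v w)%:E * (z w)%:E) <=
    K%:E * \int[P]_(w in B) (v w)%:E)%E.
  have mv' := mT _ mv.
  rewrite -(ge0_integralZl P mB mv') ?lee_fin//; last first.
    by move=> w _; rewrite lee_fin.
  under [leRHS]eq_integral do rewrite muleC.
  apply: le_integral_mulr_in => //.
  - exact/measurable_EFinP.
  - by move=> A GA AB; apply: zM => // w /AB; exact: BM.
have mvz : measurable_fun B (fun w => (v w)%:E * (z w)%:E)%E.
  by apply: mprod => //; apply/measurable_EFinP; exact: measurable_funTS.
have mY'B : measurable_fun B (EFin \o Y').
  by apply/measurable_EFinP; exact: measurable_funTS.
(* Splitting [u] and [zeta] into parts and moving the negative contributions of [u zeta] to the left
   leaves only nonnegative integrands. By centring, both sides have gained the same amount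
   [I1 + I2]. *)
have main : (\int[P]_(w in B) (Y' w)%:E + I1 + I2 <=
   \int[P]_(w in B) (Y w)%:E + I1 + I2 +
   \int[P]_(w in B) ((v w)%:E * (z w)%:E))%E.
  have h1 : measurable_fun B (fun w => (up w)%:E * (EFin \o zeta)^\- w)%E.
    exact: mprod.
  have h2 : measurable_fun B (fun w => (un w)%:E * (EFin \o zeta)^\+ w)%E.
    exact: mprod.
  have h3 : measurable_fun B (fun w => (up w)%:E * (EFin \o zeta)^\+ w)%E.
    exact: mprod.
  have h4 : measurable_fun B (fun w => (un w)%:E * (EFin \o zeta)^\- w)%E.
    exact: mprod.
  have h5 : measurable_fun B (EFin \o Y) by exact: mT.
  rewrite -{1}J1 -{1}J2 /I1 /I2 -!ge0_integralD//;
    try (by do ?apply: emeasurable_funD);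
    try (by move=> w _; nonneg).
  apply: ge0_le_integral => //;
    try (by do ?apply: emeasurable_funD);
    try (by move=> w _; nonneg).
  move=> w _.
  rewrite !(funeposE, funenegE) /= -!EFin_max -!EFinM -!EFinD lee_fin.
  have := ineq w; rewrite /up /un.
  move: (v w * z w) (Y' w) (Y w) (u w) (zeta w) => s y' y a b.
  rewrite /Num.max; case: ltP => ?; case: ltP => ?; case: ltP => ?; case: ltP => ?; nra.
have : (\int[P]_(w in B) (Y' w)%:E + (I1 + I2) <=
   \int[P]_(w in B) (Y w)%:E + K%:E * \int[P]_(w in B) (v w)%:E + (I1 + I2))%E.
  rewrite addeA (le_trans main)// -[X in (X + _ <= _)%E]addeA addeAC.
  by rewrite leeD2r// leeD2l.
by rewrite leeD2rE// fin_numD fin1.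
Qed.

End one_step.

(** * A maximal inequality for almost supermartingales *)

Section maximal.
Context {disp : measure_display} {T : measurableType disp} {R : realType}.
Variable P : probability T R.

(** The bound on [u] is removed by exhausting [B] with the events where |u| is at most [j], which
    stay in [G]. Only the left side needs a limit: on the right, integrals over the smaller events
    are bounded by those over [B]. *)
Lemma le_integral_one_step (G : set (set T)) (M : T -> \bar R) (z : T -> R)
    (K : R) (B : set T) (Y Y' u v zeta : T -> R) :
  sigma_algebra setT G -> G `<=` measurable ->
  (forall w, 0 <= z w) -> measurable_fun setT z ->
  (forall A, G A -> A `<=` [set w | (M w <= K%:E)%E] ->
    (\int[P]_(w in A) (z w)%:E <= \int[P]_(w in A) K%:E)%E) ->
  0 <= K ->
  centred P G zeta -> G B -> B `<=` [set w | (M w <= K%:E)%E] ->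
  measurable_wrt G u -> measurable_wrt G v -> measurable_wrt G Y ->
  measurable_fun setT Y' ->
  (forall w, 0 <= v w) -> (forall w, 0 <= Y w) -> (forall w, 0 <= Y' w) ->
  (forall w, Y' w <= Y w + u w * zeta w + v w * z w) ->
  (\int[P]_(w in B) (Y' w)%:E <=
   \int[P]_(w in B) (Y w)%:E + K%:E * \int[P]_(w in B) (v w)%:E)%E.
Proof.
move=> sG GT z0 mz zM K0 czeta GB BM mu mv mY mY' v0 Y0 Y'0 ineq.
pose Bn (j : nat) := B `&` [set w | `|u w| <= j%:R].
have GBn j : G (Bn j).
  apply: sigma_algebraI => //.
  have -> : [set w | `|u w| <= j%:R] = u @^-1` `[- j%:R, j%:R]%classic.
    by apply/seteqP; split => w /=; rewrite in_itv /= ler_norml.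
  by apply: measurable_wrt_preimage => //; exact: measurable_itv.
have UB : B = \bigcup_j Bn j.
  apply/seteqP; split => [w Bw|w [j _ []]//].
  exists (Num.truncn `|u w|).+1 => //; split => //=.
  by rewrite ltW// truncnS_gt.
have mT (f : T -> R) A : measurable_wrt G f -> measurable_fun A (EFin \o f).
  move=> /(measurable_wrt_measurable sG GT) mf.
  by apply/measurable_EFinP; exact: measurable_funTS.
have mY'A A : measurable_fun A (EFin \o Y').
  by apply/measurable_EFinP; exact: measurable_funTS.
have cv : (\int[P]_(w in Bn j) (Y' w)%:E @[j --> \oo] -->
    \int[P]_(w in \bigcup_j Bn j) (Y' w)%:E)%E.
  apply: ge0_nondecreasing_set_cvg_integral => //.
  - move=> i j ij; apply/subsetPset => w [Bw /= h]; split => //=.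
    by rewrite (le_trans h)// ler_nat.
  - by move=> j; exact: GT.
  - by move=> j w _; rewrite lee_fin.
rewrite -UB in cv; rewrite -(cvg_lim _ cv)//.
apply: lime_le; first by apply/cvg_ex; eexists; exact: cv.
apply: nearW => j.
apply: (@le_trans _ _ (\int[P]_(w in Bn j) (Y w)%:E +
    K%:E * \int[P]_(w in Bn j) (v w)%:E)%E).
  apply: (one_step_bounded sG GT z0 mz zM K0 (u := u) (C := j%:R) czeta) => //.
  - by move=> w [/BM].
  - by move=> w [].
have mB := GT _ GB; have mBn := GT _ (GBn j).
by apply: leeD; rewrite ?lee_wpmul2l ?lee_fin//; apply: ge0_subset_integral => //;
  do ?[exact: mT]; try (by move=> w _; rewrite lee_fin); move=> w [].
Qed.

Variable F : nat -> set (set T).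
Hypothesis F_filtration : filtration F.
Variables (M : nat -> T -> \bar R) (z : nat -> T -> R).
Hypothesis z0 : forall n w, 0 <= z n w.
Hypothesis mz : forall n, measurable_fun setT (z n).
Hypothesis mM : forall n, measurable_wrt (F n) (M n).
Hypothesis zM : forall n (K : R) A, 0 <= K -> F n A ->
  A `<=` [set w | (M n w <= K%:E)%E] ->
  (\int[P]_(w in A) (z n w)%:E <= \int[P]_(w in A) K%:E)%E.
Hypothesis M_bounded :
  {ae P, forall w, exists K : nat, forall n, (M n w <= K%:R%:E)%E}.

Lemma measurable_wrt_mono d' (U : measurableType d') m n (Y : T -> U) :
  (m <= n)%N -> measurable_wrt (F m) Y -> measurable_wrt (F n) Y.
Proof.
have [sF _ mono] := F_filtration; move=> mn mY _ B mB.
rewrite setTI g_sigma_measurableE//; apply: (mono _ _ mn).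
exact: measurable_wrt_preimage.
Qed.

Section almost_supermartingale.
Variables zeta Y u v : nat -> T -> R.
Hypothesis czeta : forall n, centred P (F n) (zeta n).
Hypothesis mY : forall n, measurable_wrt (F n) (Y n).
Hypothesis mu : forall n, measurable_wrt (F n) (u n).
Hypothesis mv : forall n, measurable_wrt (F n) (v n).
Hypothesis v0 : forall n w, 0 <= v n w.
Hypothesis Y0 : forall n w, 0 <= Y n w.
Hypothesis ineq : forall n w,
  Y n.+1 w <= Y n w + u n w * zeta n w + v n w * z n w.

Let sF n : sigma_algebra setT (F n). Proof. by case: F_filtration. Qed.
Let FT n : F n `<=` measurable. Proof. by case: F_filtration. Qed.

(** Localization up to time [n] with budget [K]. Everything here is known at time [n], including the
    drift [v n], hence the [n.+1] terms of the sum. [D] adds that the level [lam] has not been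
    passed, and [X] is the event of passing it for the first time at time [n.+1]. *)
Let H (K : R) n := [set w | Y 0 w <= K] `&`
  [set w | forall k, (k <= n)%N -> (M k w <= K%:E)%E] `&`
  [set w | \sum_(k < n.+1) v k w <= K].

Let D (K lam : R) n := H K n `&` [set w | forall k, (k <= n)%N -> Y k w <= lam].

Let X (K lam : R) n := D K lam n `&` [set w | lam < Y n.+1 w].

Let F_forall n (A : nat -> set T) : (forall k, (k <= n)%N -> F n (A k)) ->
  F n [set w | forall k, (k <= n)%N -> A k w].
Proof.
move=> FA; rewrite -g_sigma_measurableE//.
have -> : [set w | forall k, (k <= n)%N -> A k w] =
    \bigcap_(k in [set k | (k <= n)%N]) A k by [].
apply: bigcap_measurable; first by exists 0%N.
by move=> k kn; rewrite g_sigma_measurableE//; exact: FA.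
Qed.

Let F_le n (f : T -> R) (c : R) : measurable_wrt (F n) f ->
  F n [set w | f w <= c].
Proof.
move=> mf; have -> : [set w | f w <= c] = f @^-1` `]-oo, c]%classic.
  by apply/seteqP; split => w /=; rewrite in_itv.
by apply: measurable_wrt_preimage => //; exact: measurable_itv.
Qed.

Let F_D K lam n : F n (D K lam n).
Proof.
apply: sigma_algebraI => //; last first.
  apply: (F_forall (A := fun k => [set w | Y k w <= lam])) => k kn; apply: F_le.
  exact: measurable_wrt_mono kn (@mY k).
apply: sigma_algebraI => //; last first.
  apply: F_le; apply: measurable_sum => k.
  by apply: measurable_wrt_mono (@mv k); rewrite -ltnS.
apply: sigma_algebraI => //.
  by apply: F_le; exact: measurable_wrt_mono (leq0n _) (@mY 0).
apply: (F_forall (A := fun k => [set w | (M k w <= K%:E)%E])) => k kn.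
have -> : [set w | (M k w <= K%:E)%E] = M k @^-1` `]-oo, K%:E]%classic.
  by apply/seteqP; split => w /=; rewrite in_itv.
apply: measurable_wrt_preimage => //; last exact: emeasurable_itv.
exact: measurable_wrt_mono kn (@mM k).
Qed.

Let mD K lam n : measurable (D K lam n). Proof. exact: FT. Qed.

Let mYT n : measurable_fun setT (Y n).
Proof. exact: measurable_wrt_measurable (@mY n). Qed.

Let mX K lam n : measurable (X K lam n).
Proof.
apply: measurableI => //.
have -> : [set w | lam < Y n.+1 w] = Y n.+1 @^-1` `]lam, +oo[%classic.
  by apply/seteqP; split => w /=; rewrite in_itv/= andbT.
by rewrite -[X in measurable X]setTI; apply: mYT => //; exact: measurable_itv.
Qed.

Let I K lam n := (\int[P]_(w in D K lam n) (Y n w)%:E)%E.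
Let J K lam n := (\int[P]_(w in D K lam n) (v n w)%:E)%E.

(** The events [X K lam n], where [Y n.+1] exceeds [lam], and [D K lam n.+1] are disjoint and both
    lie in [D K lam n], on which the one-step inequality applies. *)
Let step K lam n : 0 <= K -> 0 <= lam ->
  (lam%:E * P (X K lam n) + I K lam n.+1 <= I K lam n + K%:E * J K lam n)%E.
Proof.
move=> K0 lam0.
have mYA A : measurable_fun A (EFin \o Y n.+1).
  by apply/measurable_EFinP; exact: measurable_funTS.
apply: (@le_trans _ _ (\int[P]_(w in D K lam n) (Y n.+1 w)%:E)%E); last first.
  apply: (@le_integral_one_step (F n) (M n) (z n) K _ _ _ (u n) (v n) (zeta n)) => //.
  - by move=> A; exact: zM.
  - by move=> w [[[_ h _]]] _; exact: h.
apply: (@le_trans _ _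
    (\int[P]_(w in X K lam n `|` D K lam n.+1) (Y n.+1 w)%:E)%E); last first.
  apply: ge0_subset_integral => //; first exact: measurableU.
    by move=> w _; rewrite lee_fin.
  move=> w [[]//|[[[h1 h2] h3] h4]]; split; last by move=> k kn; apply: h4; exact: leqW.
  split; first by split => // k kn; apply: h2; exact: leqW.
  by move: h3 => /=; rewrite big_ord_recr /=; apply: le_trans; rewrite lerDl.
rewrite ge0_integral_setU//; first last.
- apply/disj_setPS => w [[_ /= h1] [_ /= h2]].
  by have := h2 n.+1 (leqnn _); rewrite leNgt h1.
- by move=> w _; rewrite lee_fin.
rewrite leeD2r// -integral_cst//; apply: ge0_le_integral => //.
  by move=> w [_ /= /ltW].
Qed.

Let sumJ K lam N : 0 <= K -> (\sum_(n < N) J K lam n <= K%:E)%E.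
Proof.
move=> K0.
have mvA n A : measurable_fun A (EFin \o v n).
  apply/measurable_EFinP; apply: measurable_funTS.
  exact: measurable_wrt_measurable (@mv n).
rewrite /J; under eq_bigr do rewrite integral_mkcond.
rewrite -ge0_integral_sum//; first last.
- by move=> n w _; rewrite patchE; case: ifP; rewrite ?lee_fin.
- by move=> n; apply: (measurable_restrictT _ (@mD _ _ _)).1; exact: mvA.
rewrite -[leRHS]mule1 -(@probability_setT _ _ _ P) -integral_cst//.
apply: ge0_le_integral => //.
- move=> w _; apply: sume_ge0 => n _.
  by rewrite patchE; case: ifP; rewrite ?lee_fin.
- by apply: emeasurable_sum => n; apply: (measurable_restrictT _ (@mD _ _ _)).1; exact: mvA.
(* Pointwise, the terms after the last [n] with [w] in [D K lam n] vanish, and the whole sum of the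
   [v k w] up to that [n] is at most [K] by definition of [D]. *)
move=> w _; elim: N => [|N IH]; first by rewrite big_ord0 lee_fin.
have [DN|DN] := boolP (w \in D K lam N); last first.
  by rewrite big_ord_recr /= [X in (_ + X)%E]patchE (negbTE DN) adde0.
apply: (@le_trans _ _ (\sum_(n < N.+1) (v n w)%:E)%E).
  by apply: lee_sum => n _; rewrite patchE; case: ifP; rewrite ?lee_fin.
by rewrite sumEFin lee_fin; move: DN; rewrite inE => -[[_ /= ]].
Qed.

(** Telescoping of [step]. The first [K] bounds the integral of [Y 0]; the product [K * K] is the
    drift budget times the conditional moment bound. Neither depends on [lam]. *)
Let maximal_bound K lam N : 0 <= K -> 0 <= lam ->
  (lam%:E * \sum_(n < N) P (X K lam n) <= (K + K * K)%:E)%E.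
Proof.
move=> K0 lam0.
have J0 n : (0 <= J K lam n)%E by apply: integral_ge0 => w _; rewrite lee_fin.
have ind : (lam%:E * \sum_(n < N) P (X K lam n) + I K lam N <=
    I K lam 0 + K%:E * \sum_(n < N) J K lam n)%E.
  elim: N => [|N IH]; first by rewrite !big_ord0 !mule0 add0e adde0.
  have S1 : (0 <= \sum_(n < N) P (X K lam n))%E by apply: sume_ge0.
  have S2 : (0 <= \sum_(n < N) J K lam n)%E by apply: sume_ge0.
  rewrite !big_ord_recr /= (ge0_muleDr _ S1 (measure_ge0 _ _)).
  rewrite (ge0_muleDr _ S2 (J0 _)).
  rewrite -addeA; apply: (le_trans (leeD2l _ (@step _ _ N K0 lam0))).
  by rewrite addeA [leRHS]addeA leeD2r.
have I0 n : (0 <= I K lam n)%E by apply: integral_ge0 => w _; rewrite lee_fin.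
apply: (@le_trans _ _ (I K lam 0 + K%:E * \sum_(n < N) J K lam n)%E).
  by apply: le_trans ind; rewrite leeDl.
rewrite EFinD EFinM leeD ?lee_wpmul2l ?sumJ//.
rewrite -[leRHS]mule1.
apply: (@le_trans _ _ (K%:E * P (D K lam 0))%E); last first.
  by rewrite lee_wpmul2l// probability_le1.
rewrite -integral_cst//; apply: ge0_le_integral => //.
- by move=> w _; rewrite lee_fin.
- by apply/measurable_EFinP; exact: measurable_funTS.
- by move=> w [[[/= h _] _] _]; rewrite lee_fin.
Qed.

(** Paths within the budget [K] that pass arbitrarily high levels. The levels start above [K], so
    that the value at time 0 is below each of them and every crossing occurs at some [n.+1]; the
    level [lam] bounds the probability by (K + K^2)/lam. *)
Let bad (K : nat) : set T := \bigcap_(l in setT) \bigcup_n X K%:R (K + l).+1%:R n.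

Let bad_negligible K : P (bad K) = 0%E.
Proof.
have mbad : measurable (bad K).
  apply: bigcap_measurable; first by exists 0%N.
  by move=> l _; exact: bigcup_measurable.
have le l : ((K + l).+1%:R%:E * P (bad K) <= (K%:R + K%:R * K%:R)%:E)%E.
  have U : (P (bad K) <= \sum_(n <oo) P (X K%:R (K + l).+1%:R n))%E.
    by apply: measure_sigma_subadditive => // w; apply.
  apply: (@le_trans _ _ ((K + l).+1%:R%:E * \sum_(n <oo) P (X K%:R (K + l).+1%:R n))%E).
    by rewrite lee_wpmul2l.
  rewrite -nneseriesZl//; apply: lime_le.
    by apply: is_cvg_nneseries => n _ _; exact: mule_ge0.
  apply: nearW => N; rewrite big_mkord -ge0_sume_distrr//.
  exact: maximal_bound.
have fin : P (bad K) \is a fin_num by exact: fin_num_measure.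
rewrite -(fineK fin); set r := fine _.
have r0 : 0 <= r by exact: fine_ge0.
have {}le l : (K + l).+1%:R * r <= K%:R + K%:R * K%:R.
  by rewrite -lee_fin EFinM fineK.
congr (_ %:E); apply/eqP; rewrite eq_le r0 andbT leNgt; apply/negP => rp.
have := le (Num.truncn ((K%:R + K%:R * K%:R) / r)).
apply/negP; rewrite -ltNge -ltr_pdivrMr// (lt_le_trans (truncnS_gt _))//.
by rewrite ler_nat ltnS leq_addl.
Qed.

(** A Robbins-Siegmund type statement, with boundedness in place of convergence. On a path with
    bounded drift sum and bounded conditional moments, one integer [K] meets all budget constraints
    at all times; if [Y] were unbounded, the first passages above the levels would put the path in
    [bad K]. *)
Lemma almost_supermartingale_bounded :
  {ae P, forall w, (exists C, forall n, \sum_(k < n) v k w <= C) ->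
    exists C, forall n, Y n w <= C}.
Proof.
have bad0 : {ae P, forall w, forall K, ~ bad K w}.
  apply/ae_foralln => K; exists (bad K); split.
  - apply: bigcap_measurable; first by exists 0%N.
    by move=> l _; exact: bigcup_measurable.
  - exact: bad_negligible.
  - by move=> w /= /contrapT.
apply: filterS2 bad0 M_bounded => w nbad [K1 hK1] [C hC].
apply: contrapT => noC.
have unb : forall c, exists n, c < Y n w.
  move=> c; apply: contrapT => h; apply: noC; exists c => n.
  by rewrite leNgt; apply/negP => hn; apply: h; exists n.
pose K := maxn K1 (maxn (Num.truncn (Y 0 w)).+1 (Num.truncn C).+1).
have KC : C <= K%:R.
  by rewrite (le_trans (ltW (truncnS_gt _)))// ler_nat /K !leq_max leqnn !orbT.
have KY : Y 0 w <= K%:R.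
  by rewrite (le_trans (ltW (truncnS_gt _)))// ler_nat /K !leq_max leqnn !orbT.
apply: (nbad K) => l _.
have [n0 hn0] := unb (K + l).+1%:R.
have HH n : H K%:R n w.
  split; last by rewrite /= (le_trans (hC _)).
  split => // k _; rewrite (le_trans (hK1 k))// lee_fin ler_nat.
  exact: leq_maxl.
have [n] : exists n, (K + l).+1%:R < Y n w /\
    forall k, (k < n)%N -> Y k w <= (K + l).+1%:R.
  have ex : exists n, (K + l).+1%:R < Y n w by exists n0.
  exists (ex_minn ex); case: ex_minnP => m hm min; split => // k km.
  by rewrite leNgt; apply/negP => /min; rewrite leqNgt km.
case: n => [|n] [hn lo]; last by exists n.
by move: hn; rewrite ltNge (le_trans KY)// ler_nat leqW// leq_addr.
Qed.

End almost_supermartingale.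
End maximal.

Section smooth_absolute_value.
Context {R : realType}.
Implicit Types (x y r : R).

(* Concavity of the square root for small [y], the Lipschitz property for
   large [y]. *)
Lemma sqrt1D_taylor r x y : 1 <= r <= 2 ->
  Num.sqrt (1 + (x + y) ^+ 2) <= Num.sqrt (1 + x ^+ 2) +
    x / Num.sqrt (1 + x ^+ 2) * y + 2 * `|y| `^ r.
Proof.
move=> /andP[r1 r2]; set s := Num.sqrt (1 + x ^+ 2).
have s1 : 1 <= s.
  by rewrite -(sqrtr1 R) /s ler_sqrt ?lerDl ?sqr_ge0// addr_ge0// sqr_ge0.
have s2 : s ^+ 2 = 1 + x ^+ 2 by rewrite sqr_sqrtr// addr_ge0// sqr_ge0.
have s0 : 0 < s by exact: lt_le_trans s1.
set c := x / s.
have cs : c * s = x by rewrite /c mulfVK// gt_eqF.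
have c1 : `|c| <= 1.
  rewrite -(@ler_pXn2r _ 2)// ?nnegrE// expr1n real_normK ?num_real//.
  rewrite /c expr_div_n s2 ler_pdivrMr ?mul1r; first by rewrite lerDr.
  by rewrite ltr_pwDl// sqr_ge0.
have [y1|y1] := leP `|y| 1.
  have yr : y ^+ 2 <= `|y| `^ r.
    have [->|y0] := eqVneq y 0; first by rewrite expr0n /= powR_ge0.
    rewrite -real_normK ?num_real// -powR_mulrn//.
    by apply: ger_powR => //; rewrite normr_gt0 y0.
  apply: (@le_trans _ _ (s + c * y + y ^+ 2 / 2)); last first.
    rewrite lerD2l; apply: le_trans (_ : y ^+ 2 <= _); last by have := powR_ge0 `|y| r; lra.
    by have := sqr_ge0 y; lra.
  have h0 : 0 <= s + c * y + y ^+ 2 / 2.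
    have : - 1 <= c * y.
      rewrite -[leLHS]opprK lerNl opprK -[X in _ <= X]mul1r.
      by rewrite (le_trans (ler_norm _))// normrN normrM ler_pM.
    by have := sqr_ge0 y; lra.
  rewrite -(ger0_norm h0) -sqrtr_sqr ler_sqrt ?sqr_ge0//.
  have -> : 1 + (x + y) ^+ 2 = s ^+ 2 + 2 * c * s * y + y ^+ 2.
    by rewrite s2 -mulrA -mulrA [c * (s * y)]mulrA cs; ring.
  (* This is the difference of the squares of the two sides, and it is nonnegative because [s] is at
     least 1. *)
  have : 0 <= (c * y + y ^+ 2 / 2) ^+ 2 + (s - 1) * y ^+ 2.
    by rewrite addr_ge0 ?sqr_ge0// mulr_ge0 ?sqr_ge0// subr_ge0.
  lra.
have yr : `|y| <= `|y| `^ r by apply: le1r_powR => //; exact: ltW.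
apply: (@le_trans _ _ (s + `|y|)).
  have sy : 0 <= s + `|y| by rewrite addr_ge0// ltW.
  rewrite -(ger0_norm sy) -sqrtr_sqr ler_sqrt ?sqr_ge0//.
  have xs : `|x| <= s by rewrite -cs normrM (gtr0_norm s0) ler_piMl// ltW.
  have : x * y <= s * `|y|.
    by rewrite (le_trans (ler_norm _))// normrM ler_pM.
  by rewrite !sqrrD s2 real_normK ?num_real//; lra.
have : - (c * y) <= `|y|.
  by rewrite (le_trans (ler_norm _))// normrN normrM ler_piMl.
lra.
Qed.

End smooth_absolute_value.

(** Inversion is discontinuous at 0, but it is [x] times the square of a real power of |x| with
    exponent -1, which is measurable; at 0 both sides vanish because the inverse of 0 is 0. *)
Lemma measurable_invr (R : realType) : measurable_fun setT (@GRing.inv R).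
Proof.
have -> : @GRing.inv R = (fun x => x * (`|x| `^ (-1)) ^+ 2).
  apply/funext => x; rewrite powR_inv1// exprVn real_normK ?num_real//.
  have [->|x0] := eqVneq x 0; first by rewrite mul0r invr0.
  by rewrite expr2 invfM mulrA divff// mul1r.
apply: measurable_funM => //; apply: measurable_funX.
exact: (measurableT_comp (measurable_powR (-1)) (@normr_measurable _ setT)).
Qed.

(** * Pathwise control of sums of noise terms *)

Section transforms.
Context {disp : measure_display} {T : measurableType disp} {R : realType}.
Variable P : probability T R.
Variable F : nat -> set (set T).
Hypothesis F_filtration : filtration F.
Variables (M : nat -> T -> \bar R) (z : nat -> T -> R).
Hypothesis z0 : forall n w, 0 <= z n w.
Hypothesis mz : forall n, measurable_wrt (F n.+1) (z n).
Hypothesis mM : forall n, measurable_wrt (F n) (M n).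
Hypothesis zM : forall n (K : R) A, 0 <= K -> F n A ->
  A `<=` [set w | (M n w <= K%:E)%E] ->
  (\int[P]_(w in A) (z n w)%:E <= \int[P]_(w in A) K%:E)%E.
Hypothesis M_bounded :
  {ae P, forall w, exists K : nat, forall n, (M n w <= K%:R%:E)%E}.

Let sF n : sigma_algebra setT (F n). Proof. by case: F_filtration. Qed.
Let FT n : F n `<=` measurable. Proof. by case: F_filtration. Qed.
Let mzT n : measurable_fun setT (z n).
Proof. exact: measurable_wrt_measurable (@mz n). Qed.

Lemma measurable_wrt_psum (f : nat -> T -> R) n :
  (forall n, measurable_wrt (F n.+1) (f n)) ->
  measurable_wrt (F n) (fun w => \sum_(k < n) f k w).
Proof.
move=> mf; apply: measurable_sum => k.
exact: measurable_wrt_mono (mf k).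
Qed.

(** The partial sums of |u k| z k form an almost supermartingale with zero martingale part and drift
    |u|. *)
Lemma weighted_psum_bounded (u : nat -> T -> R) :
  (forall n, measurable_wrt (F n) (u n)) ->
  {ae P, forall w, abs_summable (u ^~ w) ->
    abs_summable (fun k => u k w * z k w)}.
Proof.
move=> mu.
have mau n : measurable_wrt (F n) (fun w => `|u n w|).
  exact: (measurableT_comp (@normr_measurable _ setT) (mu n)).
have c0 n : centred P (F n) (cst 0 : T -> R).
  split; first exact: integrable0.
  by move=> A FA; rewrite integral0_eq.
have := @almost_supermartingale_bounded _ _ _ P F F_filtration M z z0 mzT mM zM
  M_bounded (fun=> cst 0) (fun n w => \sum_(k < n) `|u k w| * z k w)
  (fun=> cst 0) (fun n w => `|u n w|) c0.
case.
- move=> n; apply: (measurable_wrt_psum (f := fun k w => `|u k w| * z k w)) => k.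
  by apply: measurable_funM; [exact: measurable_wrt_mono (mau k)|exact: mz].
- by move=> n; exact: measurable_cst.
- exact: mau.
- by [].
- by move=> n w; apply: sumr_ge0 => k _; rewrite mulr_ge0.
- by move=> n w; rewrite big_ord_recr /= mul0r addr0.
move=> N H; exists N; case: H => mN N0 sub; split => // w nw; apply: sub => h.
apply: nw => /h [C hC]; exists C => n.
rewrite (le_trans _ (hC n))// ler_sum// => k _.
by rewrite normrM (ger0_norm (z0 _ _)).
Qed.

(** The process sqrt(1 + S^2) stands in for |S|: by [sqrt1D_taylor] its increment is a term linear
    in [zeta] plus at most 2 |u|^r |zeta|^r, so that a moment of order [r] suffices where squaring S
    would require order 2. *)
Lemma martingale_transform_bounded (zeta u : nat -> T -> R) (r c : R) :
  1 <= r <= 2 -> 0 <= c ->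
  (forall n, centred P (F n) (zeta n)) ->
  (forall n, measurable_wrt (F n.+1) (zeta n)) ->
  (forall n w, `|zeta n w| `^ r <= c * z n w) ->
  (forall n, measurable_wrt (F n) (u n)) ->
  {ae P, forall w, abs_summable (fun k => `|u k w| `^ r) ->
    bounded_seq (fun n => \sum_(k < n) u k w * zeta k w)}.
Proof.
move=> r12 c0 czeta mzeta zetaz mu.
pose S n w := \sum_(k < n) u k w * zeta k w.
have mS n : measurable_wrt (F n) (S n).
  apply: (measurable_wrt_psum (f := fun k w => u k w * zeta k w)) => k.
  by apply: measurable_funM; [exact: measurable_wrt_mono (mu k)|exact: mzeta].
pose Y n w := Num.sqrt (1 + S n w ^+ 2).
have msqrt : measurable_fun setT (@Num.sqrt R).
  exact: (continuous_measurable_fun (@sqrt_continuous R)).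
have mY n : measurable_wrt (F n) (Y n).
  apply: (measurableT_comp msqrt); apply: measurable_funD.
    exact: measurable_cst.
  by apply: measurable_funX; exact: mS.
have Y1 n w : 0 < Y n w.
  by rewrite sqrtr_gt0 ltr_pwDl// sqr_ge0.
have mau n : measurable_wrt (F n) (fun w => `|u n w|).
  exact: (measurableT_comp (@normr_measurable _ setT) (mu n)).
have := @almost_supermartingale_bounded _ _ _ P F F_filtration M z z0 mzT mM zM
  M_bounded zeta Y (fun n w => S n w / Y n w * u n w)
  (fun n w => 2 * c * `|u n w| `^ r) czeta mY.
case.
- move=> n; apply: measurable_funM; last exact: mu.
  apply: measurable_funM; first exact: mS.
  exact: (measurableT_comp (@measurable_invr R) (mY n)).
- move=> n; apply: measurable_funM; first exact: measurable_cst.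
  exact: (measurableT_comp (measurable_powR r) (mau n)).
- by move=> n w; rewrite !mulr_ge0// powR_ge0.
- by move=> n w; rewrite ltW.
- move=> n w; rewrite {1}/Y /S big_ord_recr /= -/(S n w).
  apply: (le_trans (sqrt1D_taylor (S n w) (u n w * zeta n w) r12)).
  rewrite -/(Y n w) mulrA lerD2l normrM powRM// -!mulrA ler_pM2l//.
  rewrite [leRHS]mulrCA ler_wpM2l ?powR_ge0//.
move=> N H; exists N; case: H => mN N0 sub; split => // w nw; apply: sub => h.
apply: nw => -[C hC].
have [|D hD] := h.
  exists (2 * c * C) => n; rewrite -mulr_sumr ler_wpM2l ?mulr_ge0//.
  apply: (le_trans _ (hC n)); apply: ler_sum => k _; exact: ler_norm.
exists D => n; apply: le_trans (hD n).
rewrite -sqrtr_sqr ler_sqrt ?addr_ge0 ?sqr_ge0//.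
by rewrite lerDr.
Qed.

End transforms.

Section noise.
Context {disp : measure_display} {T : measurableType disp} {R : realType}.
Variable P : probability T R.
Variable F : nat -> set (set T).
Hypothesis F_filtration : filtration F.

Let sF n : sigma_algebra setT (F n). Proof. by case: F_filtration. Qed.
Let FT n : F n `<=` measurable. Proof. by case: F_filtration. Qed.

Lemma powR_le1D (x s t : R) : 0 <= x -> 0 <= s <= t -> x `^ s <= 1 + x `^ t.
Proof.
move=> x0 /andP[s0 st]; have [x1|x1] := leP x 1.
  apply: (@le_trans _ _ 1); last by rewrite lerDl powR_ge0.
  have <- : 1 `^ s = 1 by rewrite powR1.
  by apply: (ge0_ler_powR s0); rewrite ?nnegrE.
by rewrite (@le_trans _ _ (x `^ t))// ?lerDr//; apply: ler_powR => //; exact: ltW.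
Qed.

(** In the nonnegative case the definition of [is_cond_expectation] grants no integrability of [Y];
    it is recovered from the integral over the whole space, which equals that of the constant
    [s]. *)
Lemma centred_cond_expectation n (Y : T -> R) (s : R) :
  is_cond_expectation P (F n) (EFin \o Y) (cst s%:E) ->
  centred P (F n) (fun w => Y w - s).
Proof.
move=> [mY _ cases YA].
have ics A : measurable A -> P.-integrable A (EFin \o cst s).
  by move=> mA; exact: finite_measure_integrable_cst.
have iY : P.-integrable setT (EFin \o Y).
  case: cases => [[]//|[Y0 s0]].
  apply/integrableP; split => //.
  under eq_integral do rewrite gee0_abs//.
  have [h1 _ _] := sF n.
  have h2 : F n setT by have [_ h2 _] := sF n; rewrite -(setD0 setT); exact: h2.
  rewrite -(YA _ h2); apply: (integrable_lty measurableT); exact: ics.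
split.
  apply: (@eq_integrable _ _ _ P setT measurableT ((EFin \o Y) \- (EFin \o cst s))%E) => //.
  apply: integrableB => //; exact: ics.
move=> A FA; have mA := FT FA.
under eq_integral do rewrite EFinB.
rewrite (@integralB _ _ _ P A mA (EFin \o Y) (EFin \o cst s)) //; first last.
- exact: ics.
- exact: (integrableS measurableT mA (@subsetT _ A) iY).
rewrite /= -(YA _ FA) subee//.
exact: (integrable_fin_num mA (ics _ mA)).
Qed.

Variable eps : nat -> T -> R.
Hypothesis eps_md : martingale_difference P F eps.
Variable a : R.
Hypothesis a0 : 0 <= a.
Hypothesis eps_moment : exists M : nat -> T -> \bar R,
  (forall n : nat,
    is_cond_expectation P (F n) (fun w => (`|eps n.+1 w| `^ a)%:E) (M n)) /\
  {ae P, forall w, (ereal_sup (range (fun n : nat => M n w)) < +oo)%E}.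

(** One control variable for every noise term: it dominates constants and all powers of |eps| with
    exponent between 0 and [a], so a single conditional bound serves all martingale transforms. *)
Definition envelope n w : R := 1 + `|eps n.+1 w| `^ a.

Lemma envelope_ge0 n w : 0 <= envelope n w.
Proof. by rewrite addr_ge0 ?powR_ge0. Qed.

Lemma measurable_wrt_eps n : measurable_wrt (F n.+1) (eps n.+1).
Proof. by case: (eps_md n). Qed.

Lemma measurable_wrt_envelope n : measurable_wrt (F n.+1) (envelope n).
Proof.
apply: measurable_funD; first exact: measurable_cst.
apply: (measurableT_comp (measurable_powR a)).
exact: (measurableT_comp (@normr_measurable _ setT) (@measurable_wrt_eps n)).
Qed.

(** The bound process is 1 plus the given conditional moment. On an event where it is at most [K]
    the moment is at most [K - 1], and a supremum below infinity along a path is below an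
    integer. *)
Lemma envelope_control : exists M : nat -> T -> \bar R,
  [/\ forall n, measurable_wrt (F n) (M n),
    forall n (K : R) A, 0 <= K -> F n A ->
      A `<=` [set w | (M n w <= K%:E)%E] ->
      (\int[P]_(w in A) (envelope n w)%:E <= \int[P]_(w in A) K%:E)%E &
    {ae P, forall w, exists K : nat, forall n, (M n w <= K%:R%:E)%E}].
Proof.
have [M [hM supM]] := eps_moment.
exists (fun n w => 1 + M n w)%E; split.
- move=> n; have [_ mM _ _] := hM n.
  by apply: emeasurable_funD => //; exact: measurable_cst.
- move=> n K A K0 FA AK; have mA := FT FA.
  have [mY mM cases MA] := hM n.
  have mYA : measurable_fun A (fun w => (`|eps n.+1 w| `^ a)%:E).
    exact: measurable_funTS mY.
  have mMA : measurable_fun A (M n).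
    apply: measurable_funTS; exact: measurable_wrt_measurable mM.
  rewrite /envelope; under eq_integral do rewrite EFinD.
  rewrite ge0_integralD//.
  rewrite -(MA _ FA).
  have AK' w : A w -> (M n w <= (K - 1)%:E)%E.
    move=> /AK /=; case: (M n w) => [r| |] /=; last by move=> _; rewrite leNye.
      by rewrite !lee_fin; lra.
    by rewrite addey// leye_eq.
  have le : (\int[P]_(w in A) M n w <= \int[P]_(w in A) (K - 1)%:E)%E.
    case: cases => [[_ iM]|[_ M0]].
      apply: le_integral => //.
      + exact: (integrableS measurableT mA (@subsetT _ A) iM).
      + exact: finite_measure_integrable_cst.
      + by move=> w; rewrite inE => /AK'.
    by apply: ge0_le_integral => //.
  apply: (le_trans (leeD2l _ le)).
  rewrite !(integral_cst P mA).
  have fA : P A \is a fin_num by exact: fin_num_measure.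
  have key (x : \bar R) : x \is a fin_num ->
      (1 * x + (K - 1)%:E * x <= K%:E * x)%E.
    by case: x => [r| |]// _; rewrite mul1e -!EFinM -EFinD lee_fin; lra.
  exact: key.
- apply: filterS supM => w hw.
  have [K hK] : exists K : nat, forall n, (M n w <= K%:R%:E)%E.
    move: hw; set s := ereal_sup _ => hs.
    have ub n : (M n w <= s)%E by apply: ereal_sup_ubound; exists n.
    exists (Num.truncn (fine s)).+1 => n; apply: (le_trans (ub n)).
    case: s hs {ub} => [r| |]//= _; last by rewrite leNye.
    by rewrite lee_fin ltW// truncnS_gt.
  exists K.+1 => n; rewrite -natr1 addrC EFinD leeD//.
Qed.

Lemma noise_supermartingale_bounded (zeta Y u v : nat -> T -> R) :
  (forall n, centred P (F n) (zeta n)) ->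
  (forall n, measurable_wrt (F n) (Y n)) ->
  (forall n, measurable_wrt (F n) (u n)) ->
  (forall n, measurable_wrt (F n) (v n)) ->
  (forall n w, 0 <= v n w) -> (forall n w, 0 <= Y n w) ->
  (forall n w, Y n.+1 w <= Y n w + u n w * zeta n w + v n w * envelope n w) ->
  {ae P, forall w, abs_summable (v ^~ w) -> bounded_seq (Y ^~ w)}.
Proof.
move=> cz mY mu mv v0 Y0 ineq.
have [M [mM zM supM]] := envelope_control.
have := almost_supermartingale_bounded F_filtration envelope_ge0 (fun n =>
  measurable_wrt_measurable (sF _) (@FT _) (@measurable_wrt_envelope n))
  mM zM supM cz mY mu mv v0 Y0 ineq.
apply: filterS => w h [C hC]; have [|D hD] := h.
  exists C => n; rewrite (le_trans _ (hC n))// ler_sum// => k _.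
  exact: ler_norm.
by exists D => n; rewrite ger0_norm.
Qed.

Lemma noise_summable (u : nat -> T -> R) :
  (forall n, measurable_wrt (F n) (u n)) ->
  {ae P, forall w, abs_summable (u ^~ w) ->
    abs_summable (fun k => u k w * envelope k w)}.
Proof.
have [M [mM zM supM]] := envelope_control.
exact: (weighted_psum_bounded F_filtration envelope_ge0
  measurable_wrt_envelope mM zM supM).
Qed.

Lemma noise_martingale_bounded (u : nat -> T -> R) : 2 <= a ->
  (forall n, measurable_wrt (F n) (u n)) ->
  {ae P, forall w, abs_summable (fun k => u k w ^+ 2) ->
    bounded_seq (fun n => \sum_(k < n) u k w * eps k.+1 w)}.
Proof.
move=> a2 mu; have [M [mM zM supM]] := envelope_control.
have : {ae P, forall w, abs_summable (fun k => `|u k w| `^ 2) ->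
    bounded_seq (fun n => \sum_(k < n) u k w * eps k.+1 w)}.
  apply: (martingale_transform_bounded F_filtration envelope_ge0
    measurable_wrt_envelope mM zM supM (c := 1)
    (zeta := fun k => eps k.+1) (u := u)) => //.
  - by apply/andP; split => //; lra.
  - move=> n; have [_ _ ce] := eps_md n.
    have [h1 h2] := centred_cond_expectation ce.
    have E : (fun w => eps n.+1 w - 0) = eps n.+1 by apply/funext => w; rewrite subr0.
    by split; rewrite -E.
  - exact: measurable_wrt_eps.
  - by move=> n w; rewrite mul1r; apply: powR_le1D => //; rewrite a2 andbT; lra.
apply: filterS => w h hs; apply: h; move: hs.
rewrite (_ : (fun k => u k w ^+ 2) = (fun k => `|u k w| `^ 2))//.
by apply/funext => k; rewrite powR_mulrn// real_normK ?num_real.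
Qed.

(** Centring costs a constant, from |x - s| <= 2 max(|x|, |s|), and [(2 * j)%:R * r <= a] lets
    [envelope] dominate the power [r] of eps^(2j). *)
Lemma noise_even_moment_bounded (j : nat) (s r : R) (u : nat -> T -> R) :
  1 <= r <= 2 -> (2 * j)%:R * r <= a ->
  (forall n, is_cond_expectation P (F n)
    (fun w => (eps n.+1 w ^+ (2 * j))%:E) (cst s%:E)) ->
  (forall n, measurable_wrt (F n) (u n)) ->
  {ae P, forall w, abs_summable (fun k => `|u k w| `^ r) ->
    bounded_seq (fun n => \sum_(k < n) u k w * (eps k.+1 w ^+ (2 * j) - s))}.
Proof.
move=> r12 jr cond mu; have [M [mM zM supM]] := envelope_control.
have /andP[r1 r2] := r12; have r0 : 0 <= r by lra.
apply: (martingale_transform_bounded F_filtration envelope_ge0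
    measurable_wrt_envelope mM zM supM (c := 2 `^ r * (1 + `|s| `^ r))
    (zeta := fun k w => eps k.+1 w ^+ (2 * j) - s) (u := u)) => //.
- by move=> n; exact: centred_cond_expectation.
- move=> n; apply: measurable_funB; last exact: measurable_cst.
  by apply: measurable_funX; exact: measurable_wrt_eps.
move=> n w; set x := _ ^+ _.
have xr : `|x| `^ r <= envelope n w.
  rewrite /x normrX -powR_mulrn// -powRrM; apply: powR_le1D => //.
  by rewrite jr andbT mulr_ge0.
have z1 : 1 <= envelope n w by rewrite lerDl powR_ge0.
have le : `|x - s| <= 2 * Num.max `|x| `|s|.
  rewrite (le_trans (ler_normB _ _))// mulr_natl mulr2n lerD//.
    by rewrite le_max lexx.
  by rewrite le_max lexx orbT.
apply: (@le_trans _ _ ((2 * Num.max `|x| `|s|) `^ r)).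
  by apply: ge0_ler_powR; rewrite ?nnegrE ?mulr_ge0 ?le_max ?normr_ge0.
rewrite powRM ?le_max ?normr_ge0// -mulrA ler_wpM2l ?powR_ge0//.
have s0 := powR_ge0 `|s| r; have x0 := powR_ge0 `|x| r.
by rewrite /Num.max; case: ifP => _; nra.
Qed.

End noise.

(** * Rates of growth and logarithmic asymptotics *)

Section growth.
Context {R : realType}.
Implicit Types (x y w : nat -> R) (e g C c : R).

(** The comparison of (B - A) B^(-1-g) with the integral of t^(-1-g) between [A] and [B], obtained
    from ln t <= t - 1 instead of integration. *)
Lemma powR_increment g (A B : R) : 0 < g -> 0 < A -> A <= B ->
  (B - A) * B `^ (- (1 + g)) <= (A `^ (- g) - B `^ (- g)) / g.
Proof.
move=> g0 A0 AB; have B0 : 0 < B := lt_le_trans A0 AB.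
have AE : A = B * (A / B) by rewrite mulrC mulfVK// gt_eqF.
have AB0 : 0 < A / B by rewrite divr_gt0.
rewrite ler_pdivlMr// {2}AE powRM ?(ltW B0) ?(ltW AB0)// opprD powRD; last first.
  by apply/implyP => _; rewrite gt_eqF.
rewrite powR_inv1 ?(ltW B0)//.
have h : 1 + g * (1 - A / B) <= (A / B) `^ (- g).
  rewrite /powR gt_eqF//; apply: le_trans (expR_ge1Dx _).
  rewrite lerD2l mulNr -mulrN (ler_wpM2l (ltW g0))// lerNr.
  rewrite opprB; have E : A / B = 1 + (A / B - 1) by ring.
  by rewrite [in ln _]E; apply: le_ln1Dx; lra.
rewrite -[X in _ <= _ - X]mulr1 -mulrBr.
have -> : (B - A) * (B^-1 * B `^ (- g)) * g = B `^ (- g) * (g * (1 - A / B)).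
  by field; rewrite gt_eqF.
by rewrite ler_wpM2l ?powR_ge0//; lra.
Qed.

Lemma summable_of_psum_le x w g : 0 < g -> (forall n, 0 < w n) ->
  (exists C, forall n, \sum_(k < n.+1) `|x k| <= C * w n) ->
  (exists c, 0 < c /\ forall n, c <= w n) ->
  abs_summable (fun k => x k * w k `^ (- (1 + g))).
Proof.
move=> g0 w0 [C hC] [c [c0 cw]].
pose T n := 1 + \sum_(k < n) `|x k|.
have T1 n : 1 <= T n by rewrite lerDl sumr_ge0.
have T0 n : 0 < T n := lt_le_trans ltr01 (T1 n).
pose D := c^-1 + `|C|.
have D0 : 0 < D by rewrite ltr_pwDl// invr_gt0.
have TD n : T n.+1 <= D * w n.
  rewrite /T /D mulrDl lerD//; first by rewrite mulrC ler_pdivlMr// mul1r.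
  by rewrite (le_trans (hC n))// ler_wpM2r ?ler_norm// ltW.
exists (D `^ (1 + g) / g) => n.
apply: (@le_trans _ _ (\sum_(k < n) D `^ (1 + g) / g * (T k `^ (- g) - T k.+1 `^ (- g)))).
  apply: ler_sum => k _.
  have h1 : `|x k| * T k.+1 `^ (- (1 + g)) <= (T k `^ (- g) - T k.+1 `^ (- g)) / g.
    have := powR_increment g0 (T0 k) (_ : T k <= T k.+1).
    have E : T k.+1 - T k = `|x k|.
      by rewrite /T big_ord_recr /=; ring.
    by rewrite E; apply; rewrite -subr_ge0 E.
  rewrite mulrAC -mulrA.
  apply: le_trans (_ : _ <= D `^ (1 + g) * (`|x k| * T k.+1 `^ (- (1 + g)))) _; last first.
    by rewrite ler_wpM2l ?powR_ge0.
  rewrite normrM mulrCA ler_wpM2l// ger0_norm ?powR_ge0//.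
  have /(_ (1 + g)) h2 : forall t, 0 <= t -> T k.+1 `^ t <= (D * w k) `^ t.
    by move=> t t0; apply: ge0_ler_powR => //; rewrite nnegrE ?mulr_ge0 ?ltW.
  have {}h2 := h2 (addr_ge0 ler01 (ltW g0)).
  rewrite !powRN ler_pdivlMr ?powR_gt0// mulrC ler_pdivrMr ?powR_gt0//.
  by rewrite (le_trans h2)// powRM ?(ltW D0) ?(ltW (w0 k)).
rewrite -mulr_sumr -[leRHS]mulr1 ler_wpM2l//.
  by rewrite divr_ge0 ?powR_ge0 ?ltW.
have -> : \sum_(k < n) (T k `^ (- g) - T k.+1 `^ (- g)) = T 0 `^ (- g) - T n `^ (- g).
  elim: n => [|n IH]; first by rewrite big_ord0 subrr.
  by rewrite big_ord_recr /= IH; ring.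
have -> : T 0 = 1 by rewrite /T big_ord0 addr0.
by rewrite powR1 lerBlDr lerDl powR_ge0.
Qed.

(** Kronecker's lemma in its boundedness form, by summation by parts: the weighted sums are bounded
    by [C] and the increments of [w] add up to [w n - w 0]. *)
Lemma psum_le_of_weighted x w C : (forall n, 0 < w n) ->
  {homo w : m n / (m <= n)%N >-> m <= n} ->
  (forall n, `|\sum_(k < n) x k / w k| <= C) ->
  forall n, `|\sum_(k < n) x k| <= 2 * C * w n.
Proof.
move=> w0 nd hC n.
pose p n := \sum_(k < n) x k / w k.
have C0 : 0 <= C := le_trans (normr_ge0 _) (hC 0%N).
have h : `|\sum_(k < n) x k - w n * p n| <= C * (w n - w 0).
  elim: n => [|n IH]; first by rewrite /p !big_ord0 mulr0 !subrr mulr0 normr0.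
  have -> : \sum_(k < n.+1) x k - w n.+1 * p n.+1 =
      (\sum_(k < n) x k - w n * p n) - (w n.+1 - w n) * p n.+1.
    have -> : p n = p n.+1 - x n / w n by rewrite /p big_ord_recr /= addrK.
    by rewrite big_ord_recr /=; field; rewrite gt_eqF.
  rewrite (le_trans (ler_normB _ _))//.
  have -> : C * (w n.+1 - w 0) = C * (w n - w 0) + (w n.+1 - w n) * C by ring.
  rewrite lerD// normrM ger0_norm ?subr_ge0 ?nd// ler_wpM2l ?subr_ge0 ?nd//.
  exact: hC.
have -> : \sum_(k < n) x k = (\sum_(k < n) x k - w n * p n) + w n * p n by rewrite subrK.
rewrite (le_trans (ler_normD _ _))//.
have h2 : `|w n * p n| <= w n * C.
  by rewrite normrM gtr0_norm// (ler_wpM2l (ltW (w0 n)))// ; exact: hC.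
have := mulr_ge0 C0 (ltW (w0 0%N)); lra.
Qed.

(** The shift by one keeps [s], and [L] below, at least 1 from n = 0 on, so that rates can be stated
    as inequalities valid for every n. *)
Definition s n : R := n.+1%:R.

Lemma s_ge1 n : 1 <= s n. Proof. by rewrite ler1n. Qed.
Lemma s_gt0 n : 0 < s n. Proof. by rewrite ltr0n. Qed.
Lemma sS n : s n.+1 = s n + 1. Proof. by rewrite /s -[in LHS]natr1. Qed.
Lemma s_nondecr : {homo s : m n / (m <= n)%N >-> m <= n}.
Proof. by move=> m n mn; rewrite ler_nat. Qed.

Definition L n : R := 1 + ln (s n).

Lemma L_ge1 n : 1 <= L n. Proof. by rewrite lerDl ln_ge0// s_ge1. Qed.
Lemma L_gt0 n : 0 < L n. Proof. exact: lt_le_trans (L_ge1 n). Qed.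

Lemma L_nondecr : {homo L : m n / (m <= n)%N >-> m <= n}.
Proof.
move=> m n mn; rewrite lerD2l ler_ln ?posrE ?s_gt0//; exact: s_nondecr.
Qed.

Lemma L_step_le n : L n.+1 - L n <= (s n)^-1.
Proof.
rewrite /L opprD addrACA subrr add0r -ln_div ?posrE ?s_gt0// sS.
rewrite mulrDl divff ?gt_eqF ?s_gt0// mul1r; apply: le_ln1Dx.
by rewrite (lt_le_trans (_ : _ < 0))// ?invr_ge0 ?ltW ?s_gt0// oppr_lt0.
Qed.

Lemma L_step_ge n : (s n.+1)^-1 <= L n.+1 - L n.
Proof.
rewrite /L opprD addrACA subrr add0r -[leRHS]opprK opprB lerNr.
rewrite -ln_div ?posrE ?s_gt0//.
have -> : s n / s n.+1 = 1 + (- (s n.+1)^-1).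
  have -> : s n = s n.+1 - 1 by rewrite sS addrK.
  by rewrite mulrBl divff ?mul1r// gt_eqF// s_gt0.
by apply: le_ln1Dx; rewrite ltrN2 invf_lt1 ?s_gt0// sS ltrDr s_gt0.
Qed.

Lemma L_double n : L n.+1 <= 2 * L n.
Proof.
have h : (s n)^-1 <= 1 by rewrite invf_le1 ?s_gt0 ?s_ge1.
have := le_trans (L_step_le n) h; have := L_ge1 n.
by move: (L n) (L n.+1) => u v; lra.
Qed.

Lemma s_double n : s n.+1 <= 2 * s n.
Proof. by rewrite sS; have := s_ge1 n; move: (s n) => u; lra. Qed.

End growth.

Section asymptotics.
Context {R : realType}.
Implicit Types (x y w Q : nat -> R) (e g C c : R).
Local Notation s := (@s R).
Local Notation L := (@L R).

(** Valid for every n rather than eventually; for a positive [y] the two agree, by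
    [bigO_eventually]. *)
Definition bigO y x := exists C, forall n, `|x n| <= C * y n.

Lemma bigO_ge0 y x : (forall n, 0 <= y n) -> bigO y x ->
  exists C, 0 <= C /\ forall n, `|x n| <= C * y n.
Proof.
move=> y0 [C hC]; exists `|C|; split => // n.
by rewrite (le_trans (hC n))// ler_wpM2r// ler_norm.
Qed.

Lemma bigOM y y' x x' : (forall n, 0 <= y n) -> (forall n, 0 <= y' n) ->
  bigO y x -> bigO y' x' -> bigO (fun n => y n * y' n) (fun n => x n * x' n).
Proof.
move=> y0 y'0 /bigO_ge0-/(_ y0)[C [C0 hC]] /bigO_ge0-/(_ y'0)[D [D0 hD]].
exists (C * D) => n; rewrite normrM mulrACA; exact: ler_pM.
Qed.

Lemma bigOD y x x' : bigO y x -> bigO y x' -> bigO y (fun n => x n + x' n).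
Proof.
move=> [C hC] [D hD]; exists (C + D) => n.
by rewrite mulrDl (le_trans (ler_normD _ _))// lerD.
Qed.

Lemma bigOZ y x c : bigO y x -> bigO y (fun n => c * x n).
Proof.
move=> [C hC]; exists (`|c| * C) => n.
by rewrite normrM -mulrA ler_wpM2l.
Qed.

Lemma bigO_sum y (I : Type) (r : seq I) (x : I -> nat -> R) :
  (forall i, bigO y (x i)) -> bigO y (fun n => \sum_(i <- r) x i n).
Proof.
move=> h; elim: r => [|i r [C hC]].
  by exists 0 => n; rewrite big_nil normr0 mul0r.
have [D hD] := h i; exists (D + C) => n.
by rewrite big_cons mulrDl (le_trans (ler_normD _ _))// lerD.
Qed.

Lemma bigO_le y x x' : (forall n, `|x' n| <= `|x n|) -> bigO y x -> bigO y x'.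
Proof. by move=> h [C hC]; exists C => n; exact: le_trans (h n) (hC n). Qed.

Lemma bigO_trans y y' x : (forall n, 0 <= y n) ->
  bigO y x -> bigO y' y -> bigO y' x.
Proof.
move=> y0 /bigO_ge0-/(_ y0)[C [C0 hC]] [D hD]; exists (C * D) => n.
rewrite (le_trans (hC n))// -mulrA ler_wpM2l//.
exact: le_trans (ler_norm _) (hD n).
Qed.

Lemma bigO_eventually y x N C : (forall n, 0 < y n) ->
  (forall n, (N <= n)%N -> `|x n| <= C * y n) -> bigO y x.
Proof.
move=> y0 h; exists (`|C| + \sum_(k < N) `|x k| / y k) => n.
have S0 m : 0 <= \sum_(k < m) `|x k| / y k.
  by apply: sumr_ge0 => k _; rewrite divr_ge0 ?(ltW (y0 k)).
rewrite mulrDl; have [Nn|nN] := leqP N n.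
  apply: (le_trans (h n Nn)); apply: (@le_trans _ _ (`|C| * y n)).
    by rewrite ler_wpM2r ?(ltW (y0 n)) ?ler_norm.
  by rewrite lerDl mulr_ge0 ?(ltW (y0 n)).
rewrite -[leLHS]add0r lerD ?mulr_ge0 ?(ltW (y0 n))//.
rewrite (bigD1 (Ordinal nN))//= mulrDl mulfVK ?gt_eqF// lerDl.
rewrite mulr_ge0 ?(ltW (y0 n))// sumr_ge0// => k _.
by rewrite divr_ge0 ?(ltW (y0 k)).
Qed.

Definition polyO e x := bigO (fun n => s n `^ e) x.
(** [Q] is meant to be a weight at least 1 with bounded averages. In [mild] below, every positive
    exponent is allowed, which absorbs powers of the logarithm and is stable under products. *)
Definition wO Q e x := bigO (fun n => Q n * s n `^ e) x.
Definition mild x := forall e, 0 < e -> polyO e x.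

Lemma s_powR_ge0 e n : 0 <= s n `^ e. Proof. exact: powR_ge0. Qed.
Hint Resolve s_powR_ge0 : core.

Lemma s_powR_gt0 e n : 0 < s n `^ e.
Proof. by rewrite powR_gt0// s_gt0. Qed.

Lemma s_powRD e e' n : s n `^ (e + e') = s n `^ e * s n `^ e'.
Proof. by rewrite powRD//; apply/implyP => _; rewrite gt_eqF// s_gt0. Qed.

Lemma s_powR_le e e' n : e <= e' -> s n `^ e <= s n `^ e'.
Proof. by move=> ee'; apply: ler_powR => //; exact: s_ge1. Qed.

Lemma s_powR_nondecr e : 0 <= e -> {homo (fun n => s n `^ e) : m n / (m <= n)%N >-> m <= n}.
Proof.
move=> e0 m n mn; apply: ge0_ler_powR; rewrite ?nnegrE ?(ltW (s_gt0 _))//.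
exact: s_nondecr.
Qed.

Lemma s_powR_small (u r : R) : 0 < u -> 0 < r ->
  exists N, forall n, (N <= n)%N -> s n `^ (- u) <= r.
Proof.
move=> u0 r0; exists (Num.truncn (r^-1 `^ u^-1)).+1 => n Nn.
have h : r^-1 `^ u^-1 <= s n.
  rewrite (le_trans (ltW (truncnS_gt _)))// /s ler_nat (leq_trans Nn)//.
have : (r^-1 `^ u^-1) `^ u <= s n `^ u.
  by apply: (ge0_ler_powR (ltW u0)) => //; rewrite nnegrE ?powR_ge0// ltW// s_gt0.
rewrite -powRrM mulVf ?gt_eqF// powRr1 ?invr_ge0 ?(ltW r0)// powRN => h2.
by rewrite -[leRHS]invrK lef_pV2 ?posrE ?s_powR_gt0// invr_gt0.
Qed.

Lemma polyOM e e' x x' : polyO e x -> polyO e' x' ->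
  polyO (e + e') (fun n => x n * x' n).
Proof.
rewrite /polyO (_ : (fun n => s n `^ (e + e')) = (fun n => s n `^ e * s n `^ e')).
  exact: bigOM.
by apply/funext => n; exact: s_powRD.
Qed.

Lemma wOM Q e e' x x' : (forall n, 0 <= Q n) -> wO Q e x -> polyO e' x' ->
  wO Q (e + e') (fun n => x n * x' n).
Proof.
move=> Q0.
rewrite /wO (_ : (fun n => Q n * s n `^ (e + e')) =
    (fun n => (Q n * s n `^ e) * s n `^ e')).
  by apply: bigOM => // n; exact: mulr_ge0.
by apply/funext => n; rewrite s_powRD mulrA.
Qed.

Lemma polyO_le e e' x : e <= e' -> polyO e x -> polyO e' x.
Proof.
move=> ee' h; apply: (bigO_trans _ h) => //; exists 1 => n.
by rewrite mul1r ger0_norm// s_powR_le.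
Qed.

Lemma wO_le Q e e' x : (forall n, 0 <= Q n) -> e <= e' -> wO Q e x -> wO Q e' x.
Proof.
move=> Q0 ee' h; apply: (bigO_trans _ h) => [n|]; first exact: mulr_ge0.
exists 1 => n; rewrite mul1r ger0_norm ?mulr_ge0//.
by rewrite ler_wpM2l// s_powR_le.
Qed.

Lemma polyO_wO Q e x : (forall n, 1 <= Q n) -> polyO e x -> wO Q e x.
Proof.
move=> Q1 h; apply: (bigO_trans _ h) => //; exists 1 => n.
by rewrite mul1r ger0_norm// ler_peMl.
Qed.

Lemma polyO_cst c : polyO 0 (fun=> c).
Proof. by exists `|c| => n; rewrite powRr0 mulr1. Qed.

Lemma polyO_powR e : polyO e (fun n => s n `^ e).
Proof. by exists 1 => n; rewrite mul1r ger0_norm. Qed.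

Lemma polyOX e x m : polyO e x -> polyO (e * m%:R) (fun n => x n ^+ m).
Proof.
move=> h; elim: m => [|m IH].
  by rewrite mulr0; under eq_fun do rewrite expr0; exact: polyO_cst.
under eq_fun do rewrite exprS.
have -> : e * m.+1%:R = e + e * m%:R by rewrite -natr1 mulrDr mulr1 addrC.
exact: polyOM.
Qed.

Lemma polyO_norm_powR e r x : 0 <= r -> polyO e x ->
  polyO (e * r) (fun n => `|x n| `^ r).
Proof.
move=> r0 /bigO_ge0-/(_ (s_powR_ge0 e))[C [C0 hC]]; exists (C `^ r) => n.
rewrite ger0_norm ?powR_ge0// powRrM -powRM//.
apply: ge0_ler_powR; rewrite ?nnegrE//; first exact: mulr_ge0.
Qed.

Lemma mildM x x' : mild x -> mild x' -> mild (fun n => x n * x' n).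
Proof.
move=> h h' e e0; rewrite (splitr e); apply: polyOM; [apply: h|apply: h'];
  by rewrite divr_gt0.
Qed.

Lemma mildD x x' : mild x -> mild x' -> mild (fun n => x n + x' n).
Proof. by move=> h h' e e0; apply: bigOD; [exact: h|exact: h']. Qed.

Lemma mild_cst c : mild (fun=> c).
Proof. by move=> e e0; apply: polyO_le (polyO_cst c); exact: ltW. Qed.

Lemma mildX x m : mild x -> mild (fun n => x n ^+ m).
Proof.
move=> h; elim: m => [|m IH]; first exact: mild_cst.
by under eq_fun do rewrite exprS; exact: mildM.
Qed.

Lemma mild_bigO x y : (forall n, 0 <= y n) -> mild y -> bigO y x -> mild x.
Proof. by move=> y0 h hx e e0; apply: (bigO_trans y0 hx); exact: h. Qed.

Lemma mild_L : mild L.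
Proof.
move=> e e0; exists (1 + e^-1) => n.
rewrite ger0_norm ?(le_trans ler01 (L_ge1 n))//.
have h : ln (s n) <= s n `^ e / e.
  rewrite ler_pdivlMr// mulrC -ln_powR.
  have h2 : ln (1 + (s n `^ e - 1)) <= s n `^ e - 1.
    by apply: le_ln1Dx; have := s_powR_gt0 e n; lra.
  by move: h2; rewrite subrKC => h2; rewrite (le_trans h2)// lerBlDr lerDl.
have h3 : 1 <= s n `^ e.
  by rewrite -[X in X <= _](powRr0 (s n)); apply: s_powR_le; exact: ltW.
by rewrite mulrDl mul1r lerD// mulrC.
Qed.

Lemma mild_L_powR t : mild (fun n => L n `^ t).
Proof.
have h := mildX (Num.truncn t).+1 mild_L.
apply: mild_bigO h _ => [n|]; first by rewrite exprn_ge0// ltW// L_gt0.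
exists 1 => n; rewrite mul1r ger0_norm ?powR_ge0// -powR_mulrn ?(ltW (L_gt0 n))//.
by apply: ler_powR; [exact: L_ge1|rewrite ltW// truncnS_gt].
Qed.

Lemma abs_summable_bigO y x : abs_summable y -> bigO (fun n => `|y n|) x ->
  abs_summable x.
Proof.
move=> [C hC] /bigO_ge0-/(_ (fun n => normr_ge0 _))[D [D0 hD]].
exists (D * C) => n; apply: (@le_trans _ _ (\sum_(k < n) D * `|y k|)).
  by apply: ler_sum => k _; exact: hD.
by rewrite -mulr_sumr ler_wpM2l.
Qed.

Lemma abs_summable_le y x : abs_summable y -> (forall n, `|x n| <= `|y n|) ->
  abs_summable x.
Proof.
by move=> hy h; apply: abs_summable_bigO hy _; exists 1 => n; rewrite mul1r.
Qed.

Lemma abs_summableD x x' : abs_summable x -> abs_summable x' ->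
  abs_summable (fun n => x n + x' n).
Proof.
move=> [C hC] [D hD]; exists (C + D) => n.
apply: (@le_trans _ _ (\sum_(k < n) (`|x k| + `|x' k|))).
  by apply: ler_sum => k _; exact: ler_normD.
by rewrite big_split lerD.
Qed.

Lemma abs_summableZ x c : abs_summable x -> abs_summable (fun n => c * x n).
Proof.
by move=> h; apply: abs_summable_bigO h _; exists `|c| => n; rewrite normrM.
Qed.

Lemma abs_summable_bounded x : abs_summable x ->
  bounded_seq (fun n => \sum_(k < n) x k).
Proof.
by move=> [C hC]; exists C => n; exact: le_trans (ler_norm_sum _ _ _) (hC n).
Qed.

Lemma bounded_seqD x x' : bounded_seq x -> bounded_seq x' ->
  bounded_seq (fun n => x n + x' n).
Proof.
move=> [C hC] [D hD]; exists (C + D) => n.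
by rewrite (le_trans (ler_normD _ _))// lerD.
Qed.

Lemma bounded_seqZ x c : bounded_seq x -> bounded_seq (fun n => c * x n).
Proof.
by move=> [C hC]; exists (`|c| * C) => n; rewrite normrM ler_wpM2l.
Qed.

(** [summable_of_psum_le] applied to [Q] itself against [s]: bounded averages make the weight
    harmless, and the threshold is still the exponent -1. *)
Lemma wO_summable Q e x : e < -1 -> (forall n, 0 <= Q n) ->
  (exists C, forall n, \sum_(k < n.+1) Q k <= C * s n) -> wO Q e x ->
  abs_summable x.
Proof.
move=> e1 Q0 [C hC] hx.
have : abs_summable (fun k => Q k * s k `^ (- (1 + (- e - 1)))).
  apply: summable_of_psum_le; first by lra.
  - exact: s_gt0.
  - exists C => n; rewrite (le_trans _ (hC n))//; apply: ler_sum => k _.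
    by rewrite ger0_norm.
  - by exists 1; split => // n; exact: s_ge1.
have -> : - (1 + (- e - 1)) = e by ring.
move=> h; apply: abs_summable_bigO h _; apply: (bigO_trans _ hx) => [n|].
  exact: mulr_ge0.
by exists 1 => n; rewrite mul1r.
Qed.

Lemma polyO_summable e x : e < -1 -> polyO e x -> abs_summable x.
Proof.
move=> e1 hx; apply: (@wO_summable (fun=> 1) e) => //.
  by exists 1 => n; rewrite sumr_const card_ord mul1r.
exact: polyO_wO.
Qed.

(** Equality with c log n up to o(log n). The constant [K] takes care of small indices, so that the
    notion is linear and bounded sequences have coefficient 0. *)
Definition asymp x c := forall e, 0 < e ->
  exists K, forall n, `|x n - c * L n| <= K + e * L n.

Lemma asympD x x' c c' : asymp x c -> asymp x' c' ->
  asymp (fun n => x n + x' n) (c + c').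
Proof.
move=> h h' e e0; have e2 : 0 < e / 2 by rewrite divr_gt0.
have [K hK] := h _ e2; have [K' hK'] := h' _ e2; exists (K + K') => n.
have -> : x n + x' n - (c + c') * L n = (x n - c * L n) + (x' n - c' * L n) by ring.
rewrite (le_trans (ler_normD _ _))// (le_trans (lerD (hK n) (hK' n)))//.
by move: (L n) => l; lra.
Qed.

Lemma asympZ x c b : asymp x c -> asymp (fun n => b * x n) (b * c).
Proof.
move=> h e e0; have b0 : 0 < `|b| + 1 by rewrite ltr_wpDl.
have [K hK] := h (e / (`|b| + 1)) (divr_gt0 e0 b0); exists (`|b| * K) => n.
rewrite -mulrA -mulrBr normrM (le_trans (ler_wpM2l _ (hK n)))// mulrDr lerD2l.
rewrite mulrA ler_wpM2r ?(ltW (L_gt0 _))// mulrCA -[leRHS]mulr1 ler_wpM2l ?(ltW e0)//.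
by rewrite ler_pdivrMr// mul1r lerDl.
Qed.

Lemma asymp_bounded x : bounded_seq x -> asymp x 0.
Proof.
move=> [C hC] e e0; exists C => n; rewrite mul0r subr0 (le_trans (hC n))//.
by rewrite lerDl; apply: mulr_ge0; [exact: ltW|exact: ltW (L_gt0 n)].
Qed.

Lemma asymp_L_powR x g : 0 < g -> g <= 1 -> bigO (fun n => L n `^ (1 - g)) x -> asymp x 0.
Proof.
move=> g0 g1 /bigO_ge0-/(_ (fun n => powR_ge0 _ _))[C [C0 hC]] e e0.
(* The threshold (C/e)^(1/g) is the value of L beyond which C L^(1-g) is at most e L; below it the
   constant suffices. *)
exists (C * (C / e) `^ g^-1) => n; rewrite mul0r subr0 (le_trans (hC n))//.
have L0 : 0 < L n := L_gt0 n; have L1 : 1 <= L n := L_ge1 n.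
have [h|h] := leP (L n) ((C / e) `^ g^-1).
  apply: (@le_trans _ _ (C * (C / e) `^ g^-1)); last first.
    by rewrite lerDl; apply: mulr_ge0; exact: ltW.
  by rewrite ler_wpM2l// (le_trans _ h)// ler1_powR// lerBlDr lerDl ltW.
apply: (@le_trans _ _ (e * L n)); last first.
  by rewrite lerDr mulr_ge0// powR_ge0.
rewrite powRD; last by apply/implyP => _; rewrite gt_eqF.
rewrite powRr1 ?(ltW L0)// mulrCA [leRHS]mulrC ler_wpM2l ?(ltW L0)//.
rewrite powRN ler_pdivrMr ?powR_gt0// mulrC -ler_pdivrMr//.
have : ((C / e) `^ g^-1) `^ g <= L n `^ g.
  apply: ge0_ler_powR; rewrite ?(ltW g0) ?nnegrE ?powR_ge0//; exact: ltW.
by rewrite -powRrM mulVf ?gt_eqF// powRr1// divr_ge0// ltW.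
Qed.

Lemma eq_asymp x y c : (forall n, x n = y n) -> asymp x c -> asymp y c.
Proof. by move=> /funext ->. Qed.

Lemma asymp_bigO_L x c : asymp x c -> bigO L x.
Proof.
move=> h; have [K hK] := h 1 ltr01; exists (`|K| + 1 + `|c|) => n.
have E : x n = (x n - c * L n) + c * L n by rewrite subrK.
rewrite E (le_trans (ler_normD _ _))// mulrDl lerD//; last first.
  by rewrite normrM (gtr0_norm (L_gt0 n)).
rewrite (le_trans (hK n))// mulrDl lerD//.
by rewrite (le_trans (ler_norm _))// ler_peMr// L_ge1.
Qed.

Lemma asymp_harmonic : asymp (fun n => \sum_(k < n) (s k)^-1) 1.
Proof.
have ub n : \sum_(k < n) (s k)^-1 <= L n + 1 - (s n)^-1.
  elim: n => [|n IH].
    by rewrite big_ord0 /s invr1 addrK (le_trans ler01 (L_ge1 0)).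
  rewrite big_ord_recr /=; have := @L_step_ge R n; move: IH.
  move: (\sum_(k < n) _) (L n) (L n.+1) (s n)^-1 (s n.+1)^-1 => u v w a b; lra.
have lb n : L n - 1 <= \sum_(k < n) (s k)^-1.
  elim: n => [|n IH].
    by rewrite big_ord0 /L /s ln1 addr0 subrr.
  rewrite big_ord_recr /=; have := @L_step_le R n; move: IH.
  move: (\sum_(k < n) _) (L n) (L n.+1) (s n)^-1 => u v w a; lra.
move=> e e0; exists 1 => n; rewrite mul1r.
have := ub n; have := lb n; have : 0 <= (s n)^-1 by rewrite invr_ge0 ltW// s_gt0.
have : 0 <= e * L n by apply: mulr_ge0; [exact: ltW|exact: ltW (L_gt0 n)].
move: (\sum_(k < n) _) (L n) (s n)^-1 (e * L n) => u v a b; rewrite ler_norml.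
by move=> *; apply/andP; split; lra.
Qed.

End asymptotics.

Section linear_recursion.
Context {R : realType}.
Implicit Types (x y E : nat -> R) (e m c : R).
Local Notation s := (@s R).
Local Notation L := (@L R).

(** With [D] the deviation of the sum from (c/m) L, the relation reads D(n+1) = (1 - m/s) D(n) +
    forcing/s, the forcing being at most a constant plus e L. Once [s n] exceeds [m], this pulls [D]
    towards that size. Then [y] is recovered from the relation itself, where the leading
    coefficients cancel. *)
Lemma asymp_linear_recursion y E m c : 1 <= m -> asymp E c ->
  (forall n, y n + m * \sum_(k < n) y k / s k = E n) ->
  asymp (fun n => \sum_(k < n) y k / s k) (c / m) /\ asymp y 0.
Proof.
move=> m1 hE hy; have m0 : 0 < m by lra.
pose Z n := \sum_(k < n) y k / s k.
have aZ : asymp Z (c / m).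
  move=> e e0; have [K hK] := hE e e0.
  pose D n := Z n - c / m * L n.
  pose N := (Num.truncn m).+1.
  (* [K'] is at least |K| + |c / m|, the constant part of the forcing, which closes the induction;
     the last sum covers the finitely many indices before [s n] exceeds [m]. *)
  pose K' := `|K| + `|c / m| + \sum_(k < N.+1) `|D k|.
  have Dle n : (n <= N)%N -> `|D n| <= K' + e * L n.
    move=> nN; rewrite /K' (bigD1 (Ordinal (nN : (n < N.+1)%N)))//= addrCA -addrA lerDl.
    rewrite addr_ge0 ?addr_ge0//; last by apply: mulr_ge0; [exact: ltW|exact: ltW (L_gt0 n)].
    exact: sumr_ge0.
  exists K' => n; rewrite -/(Z n) -/(D n).
  elim: n => [|n IH]; first exact: Dle.
  have [nN|Nn] := leqP n.+1 N; first exact: Dle.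
  have ms : m <= s n.
    rewrite (le_trans (ltW (truncnS_gt m)))// /s ler_nat -/N ltnW//.
  have s0 : 0 < s n := s_gt0 n.
  have t0 : 0 < (s n)^-1 by rewrite invr_gt0.
  have mt : m * (s n)^-1 <= 1 by rewrite ler_pdivrMr// mul1r.
  have DE : D n.+1 = (1 - m * (s n)^-1) * D n + (E n - c * L n) * (s n)^-1
      - c / m * (L n.+1 - L n).
    rewrite -hy /D {1}/Z big_ord_recr /= -/(Z n).
    move: s0 (L n) (L n.+1) (Z n) (y n) => /gt_eqF; move: (s n) => t t0' ? ? ? ?.
    by field; rewrite t0' (gt_eqF m0).
  have l0 : 0 <= L n.+1 - L n by rewrite subr_ge0; exact: L_nondecr.
  have l1 : L n.+1 - L n <= (s n)^-1 := L_step_le n.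
  have Ln0 : 0 < L n := L_gt0 n.
  have h1 : `|(1 - m * (s n)^-1) * D n| <= (1 - m * (s n)^-1) * (K' + e * L n).
    by rewrite normrM ger0_norm ?subr_ge0// ler_wpM2l ?subr_ge0.
  have h2 : `|(E n - c * L n) * (s n)^-1| <= (`|K| + e * L n) * (s n)^-1.
    rewrite normrM (gtr0_norm t0) ler_wpM2r ?(ltW t0)// (le_trans (hK n))// lerD2r.
    exact: ler_norm.
  have h3 : `|c / m * (L n.+1 - L n)| <= `|c / m| * (s n)^-1.
    by rewrite normrM (ger0_norm l0) ler_wpM2l.
  have KK : `|K| + `|c / m| <= K' by rewrite lerDl sumr_ge0.
  rewrite DE (le_trans (ler_normB _ _))// (le_trans (lerD (ler_normD _ _) (lexx _)))//.
  have el : e * L n <= e * L n.+1.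
    by rewrite ler_wpM2l ?(ltW e0)//; exact: L_nondecr.
  apply: le_trans (_ : (1 - m * (s n)^-1) * (K' + e * L n) +
     (`|K| + e * L n) * (s n)^-1 + `|c / m| * (s n)^-1 <= _).
    by do 2?apply: lerD.
  have K'0 : 0 <= K' by rewrite (le_trans _ KK)// addr_ge0.
  have eL0 : 0 <= e * L n by apply: mulr_ge0; exact: ltW.
  move: KK el t0 mt K'0 eL0 m1; clear.
  move: `|K| `|c / m| K' (e * L n) (e * L n.+1) (s n)^-1 => u v w p p' t *.
  have : 0 <= (w - u - v) * t by rewrite mulr_ge0//; [lra|exact: ltW].
  have : 0 <= (m - 1) * t * (w + p).
    by rewrite !mulr_ge0//; [lra|exact: ltW|exact: addr_ge0].
  nra.
split => //.
have -> : y = fun n => E n + (- m) * Z n by apply/funext => n; rewrite -hy /Z mulNr addrK.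
have -> : 0 = c + (- m) * (c / m) by field; rewrite gt_eqF.
by apply: asympD => //; exact: asympZ.
Qed.

Lemma asymp_shift x c : asymp x c -> asymp (fun n => x n.+1) c.
Proof.
move=> h e e0; have [K hK] := h e e0; exists (K + e + `|c|) => n.
have st : `|L n.+1 - L n| <= 1.
  rewrite ger0_norm ?subr_ge0 ?L_nondecr//.
  by rewrite (le_trans (L_step_le n))// invf_le1 ?s_ge1 ?s_gt0.
have -> : x n.+1 - c * L n = (x n.+1 - c * L n.+1) + c * (L n.+1 - L n) by ring.
rewrite (le_trans (ler_normD _ _))// normrM.
have := hK n.+1; have : `|c| * `|L n.+1 - L n| <= `|c| by rewrite ler_piMr.
have : e * (L n.+1 - L n) <= e by rewrite ler_piMr ?(ltW e0)// (le_trans (ler_norm _)).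
move: (L n.+1) (L n) => u v; lra.
Qed.

Lemma ln_unbounded (A : R) : exists N : nat, forall n, (N <= n)%N -> A <= ln n%:R.
Proof.
exists (Num.truncn (expR A)).+1 => n Nn.
have h : expR A <= n%:R.
  by rewrite (le_trans (ltW (truncnS_gt _)))// ler_nat.
rewrite -[leLHS](expRK A) ler_ln ?posrE ?expR_gt0//.
exact: lt_le_trans (expR_gt0 _) h.
Qed.

Lemma asymp_cvg x c : asymp x c ->
  (fun n : nat => (ln n%:R)^-1 * x n) @ \oo --> c.
Proof.
move=> h; apply/cvgrPdist_le => /= e e0.
have e2 : 0 < e / 2 by rewrite divr_gt0.
have [K hK] := h (e / 2) e2.
(* Chosen so that (e/2) A is the sum of |K|, of 2 (e/2) and of 2 |c|, the last two because [L n] and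
   ln n differ by at most 2. *)
pose A := (`|K| + e + 2 * `|c|) * 2 / e.
have A0 : 0 <= A by rewrite !mulr_ge0// ?addr_ge0 ?mulr_ge0 ?invr_ge0 ?(ltW e0).
have [N hN] := ln_unbounded (A + 1).
exists N.+1 => // n /= Nn; have n0 : (0 < n)%N by exact: leq_trans Nn.
have {}hN := hN n (ltnW Nn).
have l0 : 0 < ln (n%:R : R) by lra.
have [l1 l2] : 0 <= L n - ln n%:R /\ L n - ln n%:R <= 2.
  case: n n0 {Nn hN l0} => // n _.
  have E : L n = 1 + ln n.+1%:R by [].
  have := @L_step_le R n; have := @L_nondecr R n n.+1 (leqnSn n); rewrite {}E.
  have : (s n)^-1 <= 1 by rewrite invf_le1 ?s_ge1 ?s_gt0.
  by move: (L n.+1) (ln _) (s n)^-1 => u v t *; split; lra.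
rewrite -[leLHS]normrN opprB.
have -> : (ln n%:R)^-1 * x n - c = (x n - c * ln n%:R) / ln n%:R.
  by rewrite mulrBl mulfK ?gt_eqF// mulrC.
rewrite normrM normfV (gtr0_norm l0) ler_pdivrMr//.
have -> : x n - c * ln n%:R = (x n - c * L n) + c * (L n - ln n%:R) by ring.
rewrite (le_trans (ler_normD _ _))// normrM (ger0_norm l1).
have h1 := hK n; have h2 : `|c| * (L n - ln n%:R) <= `|c| * 2 by rewrite ler_wpM2l.
have h3 : (e / 2) * (L n - ln n%:R) <= (e / 2) * 2 by rewrite ler_wpM2l ?(ltW e2).
have h4 : (e / 2) * A <= (e / 2) * ln n%:R.
  by rewrite ler_wpM2l ?(ltW e2)//; lra.
have h5 : (e / 2) * A = `|K| + e + 2 * `|c| by rewrite /A; field; rewrite gt_eqF.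
have h6 := ler_norm K.
move: h1 h2 h3 h4 h5 h6; move: (`|x n - c * L n|) `|c| `|K| (L n) (ln n%:R) => u v w l t; lra.
Qed.

End linear_recursion.

(** * Expansion of powers of the energy *)

Section expansion.
Context {R : realType}.
Implicit Types (x b f e : R) (m : nat).

(** The part of (x + 2 e b + e^2 f)^m that is quadratic in e: one factor e^2 f, or two factors 2 e b
    among the m, whence 4 m (m-1)/2. For m <= 1 the second coefficient is 0, so the truncated
    exponent does no harm. *)
Definition second_order x b f m : R :=
  m%:R * f * x ^+ m.-1 + (2 * m * m.-1)%:R * b ^+ 2 * x ^+ m.-2.

Definition expansion x b f e m : R :=
  x ^+ m + 2 * m%:R * e * b * x ^+ m.-1 + e ^+ 2 * second_order x b f m.

Lemma second_order_ge0 x b f m : 0 <= x -> 0 <= f -> 0 <= second_order x b f m.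
Proof.
move=> x0 f0; apply: addr_ge0; apply: mulr_ge0; rewrite ?exprn_ge0//.
  exact: mulr_ge0.
by rewrite mulr_ge0 ?sqr_ge0.
Qed.

Lemma second_order_le x b f m : 0 <= x -> 0 <= f -> b ^+ 2 <= f * x ->
  second_order x b f m <= (2 * m ^ 2)%:R * f * x ^+ m.-1.
Proof.
move=> x0 f0 bf; rewrite /second_order.
case: m => [|[|m]].
- by rewrite /= !mul0r addr0.
- by rewrite /= !mulr1 muln0 !mul0r addr0 ler_wpM2r// ler1n.
have h : b ^+ 2 * x ^+ m <= f * x ^+ m.+1.
  by rewrite [x ^+ m.+1]exprS mulrA ler_wpM2r ?exprn_ge0.
have h0 : 0 <= f * x ^+ m.+1 by rewrite mulr_ge0 ?exprn_ge0.
have -> : m.+2%:R * f * x ^+ m.+2.-1 + (2 * m.+2 * m.+2.-1)%:R * b ^+ 2 * x ^+ m.+2.-2 =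
    m.+2%:R * (f * x ^+ m.+1) + (2 * m.+2 * m.+1)%:R * (b ^+ 2 * x ^+ m).
  by rewrite /= !mulrA.
have -> : (2 * m.+2 ^ 2)%:R * f * x ^+ m.+2.-1 = (2 * m.+2 ^ 2)%:R * (f * x ^+ m.+1).
  by rewrite /= !mulrA.
move: h h0; move: (b ^+ 2 * _) (f * _) => u v uv v0.
apply: (@le_trans _ _ (m.+2%:R * v + (2 * m.+2 * m.+1)%:R * v)).
  by rewrite lerD2l ler_wpM2l.
rewrite -mulrDl ler_wpM2r// -natrD ler_nat; lia.
Qed.

(* As [|b| <= sqrt f * sqrt x], the base [x + 2 e b + e^2 f] is at most
   [(sqrt x + |e| sqrt f)^2]; the remainder collects the terms with at least
   three factors [sqrt f]. *)
Lemma expansion_remainder m : exists C,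
  [/\ 0 <= C, ((m <= 1)%N -> C = 0) & forall x b f e : R,
  0 <= x -> 0 <= f <= 1 -> b ^+ 2 <= f * x ->
  `|(x + 2 * e * b + e ^+ 2 * f) ^+ m - expansion x b f e m| <=
  C * (f * Num.sqrt f) * ((1 + `|e|) * (1 + Num.sqrt x)) ^+ (2 * m)].
Proof.
elim: m => [|[|m] [C [C0 _ IH]]].
- exists 0; split => // x b f e _ _ _.
  rewrite /expansion /second_order /= !expr0 !mul0r !(mulr0, addr0, mul0r, mul0n).
  by rewrite subrr normr0.
- exists 0; split => // x b f e _ _ _.
  rewrite /expansion /second_order /= !expr1 !expr0 muln0 !(mul0r, mulr1, addr0, mul1r).
  by rewrite subrr normr0.
(* The new contribution is 6 (m+1)^2 from the term in e^3 and 2 (m+1)^2 from the term in e^4,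
   bounded in [g3le] and [g4le]. *)
exists (C + (8 * m.+1 ^ 2)%:R); split => //; first by rewrite addr_ge0.
move=> x b f e x0 /andP[f0 f1] bf.
pose y := Num.sqrt x; pose phi := Num.sqrt f.
have y0 : 0 <= y by exact: sqrtr_ge0.
have p0 : 0 <= phi by exact: sqrtr_ge0.
have yy : y ^+ 2 = x by rewrite sqr_sqrtr.
have pp : phi ^+ 2 = f by rewrite sqr_sqrtr.
have p1 : phi <= 1 by rewrite -(sqrtr1 R) ler_sqrt.
have by_ : `|b| <= phi * y.
  by rewrite -(@ler_pXn2r _ 2)// ?nnegrE ?mulr_ge0// exprMn yy pp real_normK ?num_real.
pose v := x + 2 * e * b + e ^+ 2 * f.
pose W := (1 + `|e|) * (1 + y).
have e0 : 0 <= `|e| by [].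
have W1 : 1 <= W by rewrite /W; nra.
have vW : `|v| <= W ^+ 2.
  have h1 : `|v| <= x + 2 * `|e| * `|b| + `|e| ^+ 2 * f.
    have E1 : `|2 * e * b| = 2 * `|e| * `|b| by rewrite !normrM (@ger0_norm _ 2).
    have E2 : `|e ^+ 2 * f| = `|e| ^+ 2 * f by rewrite normrM (ger0_norm f0) normrX.
    rewrite (le_trans (ler_normD _ _))// E2 lerD2r.
    by rewrite (le_trans (ler_normD _ _))// E1 (ger0_norm x0).
  rewrite (le_trans h1)// -yy -pp /W.
  have h2 : `|e| * `|b| <= `|e| * (phi * y) by rewrite ler_wpM2l.
  apply: (@le_trans _ _ ((y + `|e| * phi) ^+ 2)).
    by move: h2; rewrite -mulrA; move: (`|e| * `|b|) => t; nra.
  rewrite ler_pXn2r ?nnegrE ?addr_ge0 ?mulr_ge0 ?addr_ge0//.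
  have : `|e| * phi <= `|e| * 1 by rewrite ler_wpM2l.
  by have := mulr_ge0 e0 y0; nra.
pose h := second_order x b f m.+1.
have h0 : 0 <= h by exact: second_order_ge0.
have hle : h <= (2 * m.+1 ^ 2)%:R * f * x ^+ m by exact: second_order_le.
pose k := x ^+ m.
have k0 : 0 <= k by rewrite exprn_ge0.
pose g3 := 2 * b * h + f * (2 * m.+1%:R * b * k).
pose g4 := f * h.
(* Multiplying the expansion by one more factor reproduces the next expansion through order 2 in e;
   what is left over has orders 3 and 4 only. *)
have key : v * expansion x b f e m.+1 - expansion x b f e m.+2 =
    e ^+ 3 * g3 + e ^+ 4 * g4.
  rewrite /g3 /g4 /h /k /expansion /v /second_order /=.
  case: m {IH h h0 hle k k0 g3 g4} => [|m] /=.
    rewrite ?muln0 ?muln1 ?mulr0n; ring.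
  rewrite !natrM; have -> : x ^+ m.+3 = x * (x * (x * x ^+ m)) by rewrite !exprS.
  have -> : x ^+ m.+2 = x * (x * x ^+ m) by rewrite !exprS.
  have -> : x ^+ m.+1 = x * x ^+ m by rewrite exprS.
  rewrite -![m.+3%:R]natr1 -![m.+2%:R]natr1 -![m.+1%:R]natr1.
  move: (x ^+ m) (m%:R : R) => t c; ring.
have -> : v ^+ m.+2 - expansion x b f e m.+2 =
    v * (v ^+ m.+1 - expansion x b f e m.+1) + (e ^+ 3 * g3 + e ^+ 4 * g4).
  by rewrite -key exprS; ring.
have nat1 : (1 : R) <= m.+1%:R by rewrite ler1n.
have M2 : (m.+1 ^ 2)%:R = m.+1%:R ^+ 2 :> R by rewrite natrX.
have M8 : (8 * m.+1 ^ 2)%:R = 8 * m.+1%:R ^+ 2 :> R by rewrite natrM M2.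
have M2' : (2 * m.+1 ^ 2)%:R = 2 * m.+1%:R ^+ 2 :> R by rewrite natrM M2.
rewrite M2' in hle.
have f3 : 0 <= f * phi by exact: mulr_ge0.
have xk : k = y ^+ (2 * m) by rewrite exprM yy.
have g3le : `|g3| <= 6 * m.+1%:R ^+ 2 * (f * phi) * y ^+ (2 * m).+1.
  have -> : 6 * m.+1%:R ^+ 2 * (f * phi) * y ^+ (2 * m).+1 =
      2 * (phi * y) * (2 * m.+1%:R ^+ 2 * f * k) + 2 * m.+1%:R ^+ 2 * f * (phi * y) * k :> R.
    by rewrite [y ^+ (2 * m).+1]exprS -xk; ring.
  rewrite (le_trans (ler_normD _ _))// lerD//.
    rewrite !normrM (ger0_norm h0) ger0_norm// ler_pM// ?mulr_ge0//.
    by rewrite ler_wpM2l.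
  rewrite !normrM (ger0_norm f0) (ger0_norm k0) (@ger0_norm _ 2)// (@ger0_norm _ m.+1%:R)//.
  have : `|b| * k <= phi * y * k by rewrite ler_wpM2r.
  have : 0 <= `|b| * k by rewrite mulr_ge0.
  rewrite -!mulrA; move: (`|b| * k) (phi * (y * k)) => s t s0 st.
  have h5 : f * (m.+1%:R * s) <= f * (m.+1%:R ^+ 2 * t).
    by rewrite ler_wpM2l// ler_pM// expr2 ler_peMr.
  have -> : f * (2 * (m.+1%:R * s)) = 2 * (f * (m.+1%:R * s)) by ring.
  rewrite [leRHS](_ : _ = 2 * (f * (m.+1%:R ^+ 2 * t))); last by ring.
  exact: ler_wpM2l.
have g4le : `|g4| <= 2 * m.+1%:R ^+ 2 * (f * phi) * y ^+ (2 * m).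
  rewrite ger0_norm ?mulr_ge0// /g4 -xk.
  apply: (@le_trans _ _ (f * (2 * m.+1%:R ^+ 2 * f * k))).
    by rewrite ler_wpM2l.
  have -> : f * (2 * m.+1%:R ^+ 2 * f * k) = (f * (2 * m.+1%:R ^+ 2) * k) * f :> R by ring.
  have -> : 2 * m.+1%:R ^+ 2 * (f * phi) * k = (f * (2 * m.+1%:R ^+ 2) * k) * phi :> R by ring.
  rewrite ler_wpM2l//; first by rewrite !mulr_ge0// exprn_ge0.
  by rewrite -pp expr2 ler_piMr.
have We i j : (i <= 2 * m.+2)%N -> (j <= 2 * m.+2)%N ->
    `|e| ^+ i * y ^+ j <= W ^+ (2 * m.+2).
  move=> hi hj; rewrite /W exprMn ler_pM ?exprn_ge0//.
    apply: (@le_trans _ _ ((1 + `|e|) ^+ i)).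
      by rewrite lerXn2r ?nnegrE ?addr_ge0// lerDr.
    by apply: ler_weXn2l => //; rewrite lerDl.
  apply: (@le_trans _ _ ((1 + y) ^+ j)).
    by rewrite lerXn2r ?nnegrE ?addr_ge0// lerDr.
  by apply: ler_weXn2l => //; rewrite lerDl.
rewrite -/phi -/y -/W.
have t1 : `|v * (v ^+ m.+1 - expansion x b f e m.+1)| <=
    C * (f * phi) * W ^+ (2 * m.+2).
  have E : W ^+ (2 * m.+2) = W ^+ 2 * W ^+ (2 * m.+1).
    by rewrite -exprD -mulnS.
  have fI : 0 <= f <= 1 by rewrite f0.
  have IHv := IH x b f e x0 fI bf.
  rewrite normrM E [leRHS]mulrCA.
  exact (ler_pM (normr_ge0 _) (normr_ge0 _) vW IHv).
have t2 : `|e ^+ 3 * g3| <= 6 * m.+1%:R ^+ 2 * (f * phi) * W ^+ (2 * m.+2).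
  rewrite normrM normrX.
  apply: (@le_trans _ _ (`|e| ^+ 3 * (6 * m.+1%:R ^+ 2 * (f * phi) * y ^+ (2 * m).+1))).
    by rewrite ler_wpM2l ?exprn_ge0.
  by rewrite mulrCA ler_wpM2l ?mulr_ge0 ?exprn_ge0// We//; clear; lia.
have t3 : `|e ^+ 4 * g4| <= 2 * m.+1%:R ^+ 2 * (f * phi) * W ^+ (2 * m.+2).
  rewrite normrM normrX.
  apply: (@le_trans _ _ (`|e| ^+ 4 * (2 * m.+1%:R ^+ 2 * (f * phi) * y ^+ (2 * m)))).
    by rewrite ler_wpM2l ?exprn_ge0.
  by rewrite mulrCA ler_wpM2l ?mulr_ge0 ?exprn_ge0// We//; clear; lia.
rewrite (le_trans (ler_normD _ _))// (le_trans (lerD t1 (ler_normD _ _)))//.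
rewrite (le_trans (lerD (lexx _) (lerD t2 t3)))// M8.
have -> // : C * (f * phi) * W ^+ (2 * m.+2) +
    (6 * m.+1%:R ^+ 2 * (f * phi) * W ^+ (2 * m.+2) +
     2 * m.+1%:R ^+ 2 * (f * phi) * W ^+ (2 * m.+2)) =
    (C + 8 * m.+1%:R ^+ 2) * (f * phi) * W ^+ (2 * m.+2).
move: (W ^+ (2 * m.+2)) => t; ring.
Qed.

(* The bound [f <= 1] is relaxed to [f <= F] by rescaling
   [(e, b, f) := (sqrt F e, b / sqrt F, f / F)]. *)
Lemma expansion_envelope m (a F : R) : (2 * m)%:R <= a -> 1 <= F -> exists C,
  [/\ 0 <= C, ((m <= 1)%N -> C = 0) & forall x b f e : R,
  0 <= x -> 0 <= f <= F -> b ^+ 2 <= f * x ->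
  `|(x + 2 * e * b + e ^+ 2 * f) ^+ m - expansion x b f e m| <=
  C * (f * Num.sqrt f * (1 + x) ^+ m) * (1 + `|e| `^ a)].
Proof.
move=> ma F1; have [C [C0 Cm hC]] := expansion_remainder m.
have F0 : 0 < F := lt_le_trans ltr01 F1.
pose r := Num.sqrt F.
have rr : r ^+ 2 = F by rewrite sqr_sqrtr ?(ltW F0).
have r1 : 1 <= r by rewrite -(sqrtr1 R) /r ler_sqrt ?(ltW F0).
have r0 : 0 < r := lt_le_trans ltr01 r1.
exists (C * F ^+ m * (2 ^+ (2 * m) * 2 * 2 ^+ m)); split.
- by rewrite !mulr_ge0 ?exprn_ge0 ?(ltW F0).
- by move=> /Cm ->; rewrite !mul0r.
move=> x b f e x0 /andP[f0 fF] bf.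
have := hC x (b / r) (f / F) (e * r) x0.
have -> : x + 2 * (e * r) * (b / r) + (e * r) ^+ 2 * (f / F) =
    x + 2 * e * b + e ^+ 2 * f.
  by rewrite -rr; field; rewrite gt_eqF.
have -> : expansion x (b / r) (f / F) (e * r) m = expansion x b f e m.
  by rewrite /expansion /second_order -rr; field; rewrite gt_eqF.
have fF01 : 0 <= f / F <= 1.
  by rewrite divr_ge0 ?(ltW F0)//= ler_pdivrMr// mul1r.
have bfF : (b / r) ^+ 2 <= f / F * x.
  by rewrite expr_div_n rr [leRHS]mulrAC ler_wpM2r ?invr_ge0 ?(ltW F0).
move=> /(_ fF01 bfF) h; apply: (le_trans h).
have sx0 : 0 <= Num.sqrt x by exact: sqrtr_ge0.
have sf0 : 0 <= Num.sqrt f by exact: sqrtr_ge0.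
have h1 : f / F * Num.sqrt (f / F) <= f * Num.sqrt f.
  rewrite ler_pM ?sqrtr_ge0 ?divr_ge0 ?(ltW F0)//.
    by rewrite ler_pdivrMr// ler_peMr.
  by rewrite ler_sqrt// ler_pdivrMr// ler_peMr.
have e1 : 0 <= `|e| by [].
have h2 : (1 + `|e * r|) ^+ (2 * m) <= F ^+ m * (2 ^+ (2 * m) * 2 * (1 + `|e| `^ a)).
  rewrite normrM (gtr0_norm r0).
  apply: (@le_trans _ _ ((r * (1 + `|e|)) ^+ (2 * m))).
    rewrite lerXn2r ?nnegrE ?addr_ge0 ?mulr_ge0 ?(ltW r0) ?addr_ge0//.
    by rewrite mulrDr mulr1 [r * _]mulrC lerD2r.
  rewrite exprMn exprM rr ler_wpM2l ?exprn_ge0 ?(ltW F0)// -mulrA.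
  have m0 : 0 <= 1 + `|e| `^ a by rewrite addr_ge0 ?powR_ge0.
  have [el|el] := leP `|e| 1.
    apply: (@le_trans _ _ (2 ^+ (2 * m) * 1)).
      rewrite mulr1 lerXn2r ?nnegrE ?addr_ge0//; lra.
    by rewrite ler_wpM2l ?exprn_ge0//; have := powR_ge0 `|e| a; lra.
  apply: (@le_trans _ _ ((2 * `|e|) ^+ (2 * m))).
    by rewrite lerXn2r ?nnegrE ?addr_ge0//; lra.
  rewrite exprMn ler_wpM2l ?exprn_ge0//.
  rewrite -(powR_mulrn (2 * m) e1) (le_trans (ler_powR (ltW el) ma))//.
  by have := powR_ge0 `|e| a; lra.
have h3 : (1 + Num.sqrt x) ^+ (2 * m) <= 2 ^+ m * (1 + x) ^+ m.
  rewrite exprM -exprMn lerXn2r ?nnegrE ?sqr_ge0 ?mulr_ge0 ?addr_ge0//.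
  by have := sqr_sqrtr x0; have := sqr_ge0 (1 - Num.sqrt x); rewrite !expr2; lra.
rewrite exprMn.
have -> : C * F ^+ m * (2 ^+ (2 * m) * 2 * 2 ^+ m) * (f * Num.sqrt f * (1 + x) ^+ m) *
    (1 + `|e| `^ a) = C * (f * Num.sqrt f) *
    ((F ^+ m * (2 ^+ (2 * m) * 2 * (1 + `|e| `^ a))) * (2 ^+ m * (1 + x) ^+ m)).
  by move: (F ^+ m) (2 ^+ (2 * m)) (2 ^+ m) ((1 + x) ^+ m) => *; ring.
apply: ler_pM.
- apply: mulr_ge0 => //; apply: mulr_ge0; last exact: sqrtr_ge0.
  by case/andP: fF01.
- by apply: mulr_ge0; apply: exprn_ge0; apply: addr_ge0.
- by rewrite ler_wpM2l.
- by rewrite ler_pM ?exprn_ge0 ?addr_ge0.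
Qed.

End expansion.

(** * Stable companion matrices *)

Section matrix_norm.
Context {R : realType}.

(** The entrywise l1 norm: submultiplicative for rectangular factors and invariant under
    transposition, so it serves alike for matrices, vectors and outer products. *)
Definition nrm m n (A : 'M[R]_(m, n)) : R := \sum_i \sum_j `|A i j|.

Lemma nrm_ge0 m n (A : 'M[R]_(m, n)) : 0 <= nrm A.
Proof. by apply: sumr_ge0 => i _; apply: sumr_ge0. Qed.

Lemma entry_le_nrm m n (A : 'M[R]_(m, n)) i j : `|A i j| <= nrm A.
Proof.
rewrite /nrm (bigD1 i)//= (bigD1 j)//= -addrA lerDl addr_ge0//.
  exact: sumr_ge0.
by apply: sumr_ge0 => k _; apply: sumr_ge0.
Qed.

Lemma nrmD m n (A B : 'M[R]_(m, n)) : nrm (A + B) <= nrm A + nrm B.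
Proof.
rewrite /nrm -big_split; apply: ler_sum => i _; rewrite -big_split.
by apply: ler_sum => j _; rewrite mxE ler_normD.
Qed.

Lemma nrmZ m n c (A : 'M[R]_(m, n)) : nrm (c *: A) = `|c| * nrm A.
Proof.
rewrite /nrm mulr_sumr; apply: eq_bigr => i _; rewrite mulr_sumr.
by apply: eq_bigr => j _; rewrite mxE normrM.
Qed.

Lemma nrmN m n (A : 'M[R]_(m, n)) : nrm (- A) = nrm A.
Proof. by rewrite -scaleN1r nrmZ normrN1 mul1r. Qed.

Lemma nrmB m n (A B : 'M[R]_(m, n)) : nrm (A - B) <= nrm A + nrm B.
Proof. by rewrite -(nrmN B) nrmD. Qed.

Lemma nrm0 m n : nrm (0 : 'M[R]_(m, n)) = 0.
Proof.
by rewrite /nrm big1// => i _; rewrite big1// => j _; rewrite mxE normr0.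
Qed.

Lemma nrm_eq0 m n (A : 'M[R]_(m, n)) : nrm A = 0 -> A = 0.
Proof.
move=> A0; apply/matrixP => i j; rewrite mxE; apply/eqP.
by rewrite -normr_le0 -A0 entry_le_nrm.
Qed.

Lemma nrm_tr m n (A : 'M[R]_(m, n)) : nrm A^T = nrm A.
Proof.
rewrite /nrm exchange_big; apply: eq_bigr => i _; apply: eq_bigr => j _.
by rewrite mxE.
Qed.

Lemma nrm_sum m n (I : Type) (r : seq I) (A : I -> 'M[R]_(m, n)) :
  nrm (\sum_(i <- r) A i) <= \sum_(i <- r) nrm (A i).
Proof.
elim: r => [|i r IH]; first by rewrite !big_nil nrm0.
by rewrite !big_cons (le_trans (nrmD _ _))// lerD2l.
Qed.

Lemma nrmM m n p (A : 'M[R]_(m, n)) (B : 'M[R]_(n, p)) :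
  nrm (A *m B) <= nrm A * nrm B.
Proof.
have row k : \sum_j `|B k j| <= nrm B.
  rewrite /nrm (bigD1 k)//= lerDl.
  by apply: sumr_ge0 => i _; apply: sumr_ge0.
rewrite /nrm mulr_suml; apply: ler_sum => i _.
apply: (@le_trans _ _ (\sum_j \sum_k `|A i k| * `|B k j|)).
  apply: ler_sum => j _; rewrite mxE (le_trans (ler_norm_sum _ _ _))//.
  by apply: ler_sum => k _; rewrite normrM.
rewrite exchange_big mulr_suml; apply: ler_sum => k _.
by rewrite -mulr_sumr ler_wpM2l// row.
Qed.

Lemma nrm_scalar11 (A : 'M[R]_1) : nrm A = `|A 0 0|.
Proof. by rewrite /nrm big_ord1 big_ord1. Qed.

Lemma nrmM3 m n p q (A : 'M[R]_(m, n)) (B : 'M[R]_(n, p)) (D : 'M[R]_(p, q)) :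
  nrm (A *m B *m D) <= nrm A * nrm B * nrm D.
Proof. by rewrite (le_trans (nrmM _ _))// ler_wpM2r ?nrm_ge0// nrmM. Qed.

Lemma nrm_sqr_le n (v : 'cV[R]_n) : nrm v ^+ 2 <= n%:R * \sum_i v i 0 ^+ 2.
Proof.
have E : nrm v = \sum_i `|v i 0| by apply: eq_bigr => i _; rewrite big_ord1.
have h (a : 'I_n -> R) : (\sum_i a i) ^+ 2 <= n%:R * \sum_i a i ^+ 2.
  rewrite expr2 mulr_suml.
  apply: (@le_trans _ _ (\sum_i \sum_j (a i ^+ 2 + a j ^+ 2) / 2)).
    apply: ler_sum => i _; rewrite mulr_sumr; apply: ler_sum => j _.
    by have := sqr_ge0 (a i - a j); nra.
  under eq_bigr do rewrite -mulr_suml big_split /= sumr_const card_ord.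
  rewrite -mulr_suml big_split /= sumr_const card_ord !sumrMnl.
  have half (x : R) : (x + x) / 2 = x by field.
  by rewrite half mulr_natl.
rewrite E (le_trans (h _))// ler_wpM2l//; apply: ler_sum => i _.
by rewrite real_normK ?num_real.
Qed.

End matrix_norm.

(** * Geometric decay of matrix powers *)

Section geometric_decay.
Context {R : realType} {d : nat}.
Local Notation normc := (@Normc.normc R).
Implicit Types (A : 'M[R]_d.+1) (Z M : 'M[R[i]]_d.+1).

Lemma normc_ge0 (z : R[i]) : 0 <= normc z.
Proof. by case: z => a b; exact: sqrtr_ge0. Qed.

Lemma normc_real (a : R) : normc (real_complex R a) = `|a|.
Proof. by rewrite /Normc.normc /= expr0n /= addr0 sqrtr_sqr. Qed.

(** Induction on the list of roots, in place of a Jordan form: (Z - z) M is annihilated by the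
    remaining factors, and Z^(n+1) M = z Z^n M + Z^n (Z - z) M is a scalar recursion with
    geometrically decaying input. The rate [t] is taken strictly above both |z| and [rho], so that
    no polynomial factor appears. *)
Let decay_poly (r : seq R[i]) Z M :
  all (fun z => normc z < 1) r ->
  horner_mx Z (\prod_(z <- r) ('X - z%:P)) *m M = 0 ->
  exists K rho, [/\ 0 <= K, 0 < rho, rho < 1 &
    forall n i j, normc ((Z ^+ n *m M) i j) <= K * rho ^+ n].
Proof.
elim: r M => [|z r IH] M /=.
  rewrite big_nil rmorph1 mul1mx => _ ->; exists 0, 2^-1; split => //.
    by rewrite invf_lt1// ltr1n.
  by move=> n i j; rewrite mulmx0 mxE Normc.normc0 mul0r.
move=> /andP[z1 r1] h.
have [|K [rho [K0 rho0 rho1 hK]]] := IH ((Z - z%:M) *m M) r1.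
  move: h; rewrite big_cons mulrC rmorphM rmorphB /= horner_mx_X horner_mx_C.
  by rewrite -mulmxE mulmxA.
pose m := Num.max (normc z) rho; pose t := (1 + m) / 2.
have m1 : m < 1 by rewrite gt_max z1.
have [zm rm] : normc z <= m /\ rho <= m by rewrite !le_max !lexx orbT.
have mt : m < t by rewrite /t; lra.
have t1 : t < 1 by rewrite /t; lra.
have t0 : 0 < t by rewrite (lt_trans _ mt)// (lt_le_trans rho0).
pose K' := (\sum_i \sum_j normc (M i j)) + K / (t - normc z).
have tz : 0 < t - normc z by rewrite subr_gt0 (le_lt_trans zm).
have S0 : 0 <= \sum_i \sum_j normc (M i j).
  by apply: sumr_ge0 => i _; apply: sumr_ge0 => j _; exact: normc_ge0.
have K'0 : 0 <= K' by rewrite addr_ge0// divr_ge0// ltW.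
exists K', t; split => // n i j; elim: n => [|n IHn].
  rewrite !expr0 mulr1 mul1mx /K' (bigD1 i)//= (bigD1 j)//= -!addrA lerDl.
  rewrite !addr_ge0// ?divr_ge0 ?(ltW tz)//.
    by apply: sumr_ge0 => k _; exact: normc_ge0.
  by apply: sumr_ge0 => k _; apply: sumr_ge0 => l _; exact: normc_ge0.
have -> : Z ^+ n.+1 *m M = z *: (Z ^+ n *m M) + Z ^+ n *m ((Z - z%:M) *m M).
  rewrite mulmxBl mulmxBr [Z ^+ n *m (z%:M *m M)]mulmxA.
  rewrite (scalar_mxC z (Z ^+ n)) mul_scalar_mx -scalemxAl addrC subrK.
  by rewrite exprSr -mulmxE mulmxA.
rewrite mxE (le_trans (le_normcD _ _))// mxE Normc.normcM.
apply: (@le_trans _ _ (normc z * (K' * t ^+ n) + K * t ^+ n)).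
  apply: lerD; first by rewrite ler_wpM2l// normc_ge0.
  rewrite (le_trans (hK n i j))// ler_wpM2l// lerXn2r ?nnegrE ?(ltW t0) ?(ltW rho0)//.
  by rewrite ltW// (le_lt_trans rm).
have -> : K' * t ^+ n.+1 = normc z * (K' * t ^+ n) + K' * (t - normc z) * t ^+ n.
  by rewrite exprS; ring.
rewrite lerD2l ler_wpM2r ?exprn_ge0 ?(ltW t0)// -ler_pdivrMr//.
by rewrite lerDr.
Qed.

(** Cayley-Hamilton starts [decay_poly] with M = 1. Since [sup] is an upper bound only for bounded
    sets, the moduli of the eigenvalues are bounded by their sum over the list of roots. *)
Lemma spectral_radius_decay A : spectral_radius A < 1 ->
  exists K rho, [/\ 0 <= K, 0 < rho, rho < 1 &
    forall n, nrm (A ^+ n) <= K * rho ^+ n].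
Proof.
move=> sr; pose Z := map_mx (real_complex R) A.
have [r cE] := closed_field_poly_normal (char_poly Z).
move: cE; rewrite (monicP (char_poly_monic Z)) scale1r => cE.
have eigE z : eigenvalue Z z = (z \in r).
  by rewrite eigenvalue_root_char cE root_prod_XsubC.
have r1 : all (fun z => normc z < 1) r.
  apply/allP => z zr; apply: le_lt_trans sr.
  apply: sup_upper_bound; last first.
    exists z; first by rewrite eigE.
    by rewrite normc_def; case: (z).
  split; first by exists (normc z), z; rewrite ?eigE// normc_def; case: (z).
  exists (\sum_(y <- r) normc y) => c [y].
  rewrite eigE => yr; rewrite normc_def => /eqP.
  rewrite eq_complex /= eqxx andbT => /eqP <-.
  rewrite (big_rem y yr) /=; case: (y) => a b /=; rewrite lerDl.
  by apply: sumr_ge0 => x _; exact: normc_ge0.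
have [|K [rho [K0 rho0 rho1 hK]]] := @decay_poly r Z 1%:M r1.
  by rewrite -cE Cayley_Hamilton mul0mx.
exists (K *+ d.+1 *+ d.+1), rho; split => //; first by rewrite !mulrn_wge0.
move=> n; rewrite /nrm.
apply: (@le_trans _ _ (\sum_(i < d.+1) \sum_(j < d.+1) K * rho ^+ n)).
  apply: ler_sum => i _; apply: ler_sum => j _.
  have := hK n i j; rewrite mulmx1 /Z.
  have -> : map_mx (real_complex R) A ^+ n = map_mx (real_complex R) (A ^+ n).
    by rewrite -rmorphXn.
  by rewrite mxE normc_real.
by rewrite !sumr_const !card_ord !mulrnAl.
Qed.

End geometric_decay.

(** * The Lyapunov equation and the limiting covariance *)

Section lyapunov.
Context {R : realType} {d : nat}.
Implicit Types (A W : 'M[R]_d.+1).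

Definition decaying A := exists K rho, [/\ 0 <= K, 0 < rho, rho < 1 &
  forall n, nrm (A ^+ n) <= K * rho ^+ n].

Lemma decaying_eventually A (e : R) : decaying A -> 0 < e ->
  exists n, nrm (A ^+ n) <= e.
Proof.
move=> [K [rho [K0 rho0 rho1 hK]]] e0.
have : (fun n => K * rho ^+ n) @ \oo --> K * 0.
  by apply: cvgMr; apply: cvg_expr; rewrite gtr0_norm.
rewrite mulr0 => /cvgrPdist_le /(_ e e0) [n _ /(_ n (leqnn n))] /=.
rewrite sub0r normrN => h; exists n; rewrite (le_trans (hK n))//.
exact: le_trans (ler_norm _) h.
Qed.

Lemma trmx_expr A n : (A ^+ n)^T = A^T ^+ n.
Proof.
by elim: n => [|n IH]; [rewrite !expr0 trmx1|rewrite exprS exprSr trmx_mul IH].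
Qed.

Lemma lyapunov_iterate A W n :
  W = \sum_(k < n) A ^+ k *m (W - A *m W *m A^T) *m (A ^+ k)^T +
      A ^+ n *m W *m (A ^+ n)^T.
Proof.
elim: n => [|n IH]; first by rewrite big_ord0 add0r !expr0 trmx1 mulmx1 mul1mx.
rewrite {1}IH big_ord_recr /= -addrA; congr (_ + _).
rewrite mulmxBr mulmxBl -[LHS](subrK (A ^+ n.+1 *m W *m (A ^+ n.+1)^T)).
congr (_ - _ + _).
by rewrite exprSr trmx_mul !mulmxA.
Qed.

(** Iterating the equation until A^n has norm at most 1/2 leaves a multiple of the defect plus at
    most half the norm of [W], which is absorbed. The bound gives uniqueness for the Lyapunov
    equation and transfers rates from the defect to [W]. *)
Lemma lyapunov_stable A : decaying A ->
  exists c, 0 <= c /\ forall W, nrm W <= c * nrm (W - A *m W *m A^T).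
Proof.
move=> dA; have [n hn] := decaying_eventually dA (ltac:(by rewrite invr_gt0) : (0 : R) < 2^-1).
pose c0 := \sum_(k < n) nrm (A ^+ k) ^+ 2.
have c00 : 0 <= c0 by apply: sumr_ge0 => k _; rewrite sqr_ge0.
exists (2 * c0); split; first by rewrite mulr_ge0.
move=> W; set E := W - _.
have h1 : nrm (\sum_(k < n) A ^+ k *m E *m (A ^+ k)^T) <= c0 * nrm E.
  rewrite (le_trans (nrm_sum _ _))// /c0 mulr_suml; apply: ler_sum => k _.
  by rewrite (le_trans (nrmM3 _ _ _))// nrm_tr expr2 mulrAC.
have h2 : nrm (A ^+ n *m W *m (A ^+ n)^T) <= nrm W / 2.
  rewrite (le_trans (nrmM3 _ _ _))// nrm_tr mulrAC mulrC ler_wpM2l ?nrm_ge0//.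
  rewrite -[leRHS]mulr1 ler_pM ?nrm_ge0// (le_trans hn)// invf_le1//.
  by rewrite ler1n.
have h3 : nrm W <= c0 * nrm E + nrm W / 2.
  rewrite {1}(lyapunov_iterate A W n) (le_trans (nrmD _ _))// lerD//.
by rewrite -mulrA; move: h3; move: (c0 * _) (nrm W) => u v; lra.
Qed.

Lemma abs_summable_cvg (x : nat -> R) : abs_summable x ->
  cvgn (fun n => \sum_(0 <= k < n) x k).
Proof.
move=> [C hC]; apply: (@normed_cvg _ _ x); apply: nondecreasing_is_cvgn.
  by apply: nondecreasing_series => n _ _; exact: normr_ge0.
by exists C => _ [n _ <-]; have := hC n; rewrite -(big_mkord xpredT (fun k => `|x k|)).
Qed.

Variables (theta : 'cV[R]_d.+1) (sigma : R).
Let C := companion theta.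
Hypothesis dC : decaying C.
Let Gam : 'M[R]_d.+1 := noise_cov sigma.
Let Lc := limit_cov C sigma.

Lemma limit_cov_cvg i j :
  (fun n : nat => (\sum_(0 <= k < n) C ^+ k *m Gam *m C^T ^+ k) i j) @ \oo
    --> Lc i j.
Proof.
have E : (fun n : nat => (\sum_(0 <= k < n) C ^+ k *m Gam *m C^T ^+ k) i j) =
    (fun n : nat => \sum_(0 <= k < n) (C ^+ k *m Gam *m C^T ^+ k) i j).
  by apply/funext => n; rewrite summxE.
rewrite E mxE; apply: abs_summable_cvg.
have [K [rho [K0 rho0 rho1 hK]]] := dC.
exists (K ^+ 2 * nrm Gam * (1 - rho)^-1) => n.
apply: (@le_trans _ _ (\sum_(k < n) K ^+ 2 * nrm Gam * rho ^+ k)).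
  apply: ler_sum => k _; rewrite (le_trans (entry_le_nrm _ _ _))//.
  rewrite (le_trans (nrmM3 _ _ _))// -trmx_expr nrm_tr.
  have h : nrm (C ^+ k) <= K by rewrite (le_trans (hK k))// ler_piMr// exprn_ile1 ?ltW.
  have -> : K ^+ 2 * nrm Gam * rho ^+ k = K * (K * rho ^+ k) * nrm Gam by ring.
  by rewrite mulrAC ler_wpM2r ?nrm_ge0// ler_pM ?nrm_ge0.
rewrite -mulr_sumr ler_wpM2l ?mulr_ge0 ?sqr_ge0 ?nrm_ge0//.
have r1 : 0 < 1 - rho by rewrite subr_gt0.
rewrite -[leRHS]mul1r ler_pdivlMr//.
have -> : (\sum_(k < n) rho ^+ k) * (1 - rho) = 1 - rho ^+ n.
  by have := subrX1 rho n => h; rewrite -[RHS]opprB h; ring.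
by rewrite lerBlDr lerDl exprn_ge0 ?ltW.
Qed.

(** Passage to the limit in S(n+1) - C S(n) C^t = Gamma, where S(n) are the partial sums of the
    series. *)
Lemma limit_cov_lyapunov : Lc - C *m Lc *m C^T = Gam.
Proof.
apply/matrixP => i j.
pose Sn n : 'M[R]_d.+1 := \sum_(0 <= k < n) C ^+ k *m Gam *m C^T ^+ k.
have SnS n : Sn n.+1 - C *m Sn n *m C^T = Gam.
  rewrite /Sn big_nat_recl// !expr0 mulmx1 mul1mx mulmx_sumr mulmx_suml.
  rewrite -[RHS]addr0 -addrA; congr (_ + _); apply/eqP; rewrite subr_eq0; apply/eqP.
  by apply: eq_bigr => k _; rewrite exprS exprSr -!mulmxE !mulmxA.
have lhs : (fun n => (Sn n.+1 - C *m Sn n *m C^T) i j) @ \oo -->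
    (Lc - C *m Lc *m C^T) i j.
  rewrite [X in _ --> X]mxE; under eq_fun do rewrite mxE.
  apply: cvgD; first by rewrite (cvg_shiftS (fun n => Sn n i j)); exact: limit_cov_cvg.
  rewrite mxE; under eq_fun do rewrite mxE; apply: cvgN.
  rewrite mxE; under eq_fun do rewrite mxE.
  apply: cvg_big => [|b _]; first exact: add_continuous.
  apply: cvgMl.
  rewrite mxE; under eq_fun do rewrite mxE.
  apply: cvg_big => [|a _]; first exact: add_continuous.
  by apply: cvgMr; exact: limit_cov_cvg.
have rhs : (fun n => (Sn n.+1 - C *m Sn n *m C^T) i j) @ \oo --> Gam i j.
  by under eq_fun do rewrite SnS; exact: cvg_cst.
by rewrite -(cvg_lim _ lhs)// (cvg_lim _ rhs).
Qed.

Lemma noise_cov_sym : Gam^T = Gam.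
Proof. by apply/matrixP => i j; rewrite !mxE andbC. Qed.

(** The transpose solves the same equation, and [lyapunov_stable] forces the difference to
    vanish. *)
Lemma limit_cov_sym : Lc^T = Lc.
Proof.
have [c [c0 hc]] := lyapunov_stable dC.
apply/eqP; rewrite -subr_eq0; apply/eqP; apply: nrm_eq0; apply/eqP.
rewrite eq_le nrm_ge0 andbT (le_trans (hc _))//.
have -> : Lc^T - Lc - C *m (Lc^T - Lc) *m C^T =
    (Lc - C *m Lc *m C^T)^T - (Lc - C *m Lc *m C^T).
  have E (a b c' e : 'M[R]_d.+1) : a - b - (c' - e) = (a - c') - (b - e).
    by rewrite !opprB addrACA [RHS]addrACA [- b - _]addrC.
  by rewrite [(Lc - _)^T]linearB /= !trmx_mul trmxK mulmxBr mulmxBl E !mulmxA.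
by rewrite limit_cov_lyapunov noise_cov_sym subrr nrm0 mulr0.
Qed.

Lemma quad_form_noise_cov (x : 'cV[R]_d.+1) :
  quad_form Gam x = (sigma * x 0 0) ^+ 2.
Proof.
rewrite /quad_form mxE (bigD1 0)//= big1 ?addr0; last first.
  move=> j j0; rewrite mxE big1 ?mul0r// => k _; rewrite !mxE.
  rewrite [j == 0%N :> nat](_ : _ = false) ?andbF ?mulr0//.
  exact/negbTE.
rewrite mxE (bigD1 0)//= big1 ?addr0; last first.
  move=> j j0; rewrite !mxE [j == 0%N :> nat](_ : _ = false) ?mulr0//.
  exact/negbTE.
by rewrite !mxE /=; ring.
Qed.

Lemma companion_tr_entry (x : 'cV[R]_d.+1) (i : 'I_d.+1) : x 0 0 = 0 ->
  forall (i1 : 'I_d.+1), i1 = i.+1 :> nat -> (C^T *m x) i 0 = x i1 0.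
Proof.
move=> x0 i1 ii1; rewrite mxE (bigD1 i1)//= big1 ?addr0; last first.
  move=> j jn; rewrite !mxE; case: eqP => [j0|_].
    have -> : j = 0 by exact/val_inj.
    by rewrite x0 mulr0.
  rewrite [j == i.+1 :> nat](_ : _ = false) ?mul0r//.
  by apply/negbTE; apply: contra jn => /eqP h; apply/eqP/val_inj; rewrite /= h.
by rewrite !mxE ii1 /= eqxx mul1r.
Qed.

(** While the first coordinate vanishes, C^t acts as a shift, so coordinate j of [x] is brought to
    position 0 after j steps. If position 0 stayed null at all times, [x] would be 0. *)
Lemma companion_observable (x : 'cV[R]_d.+1) : x != 0 ->
  exists k : nat, ((C ^+ k)^T *m x) 0 0 != 0.
Proof.
move=> xn0; apply: contrapT => /forallNP nex.
have z k : ((C ^+ k)^T *m x) 0 0 = 0.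
  by apply/eqP; apply: contrapT => /negP; exact: nex.
have h k : forall i j : 'I_d.+1, j = (i + k)%N :> nat ->
    ((C ^+ k)^T *m x) i 0 = x j 0.
  elim: k => [|k IH] i j ij.
    rewrite expr0 trmx1 mul1mx; congr (x _ _).
    by apply/val_inj; rewrite /= ij addn0.
  have i1d : (i.+1 < d.+1)%N.
    by rewrite (leq_ltn_trans _ (ltn_ord j))// ij addnS ltnS leq_addr.
  rewrite exprSr trmx_mul -mulmxA.
  rewrite (companion_tr_entry (z k) (erefl : Ordinal i1d = i.+1 :> nat)).
  by apply: IH; rewrite /= ij addnS.
case/eqP: xn0; apply/matrixP => j l; rewrite ord1 mxE.
by rewrite -(h j 0 j) ?z.
Qed.

Lemma quad_form_conj m n (A : 'M[R]_(m, n)) (x : 'cV[R]_m) (B : 'M[R]_n) :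
  (x^T *m (A *m B *m A^T) *m x) 0 0 = quad_form B (A^T *m x).
Proof. by rewrite /quad_form trmx_mul trmxK !mulmxA. Qed.

(** The iterated equation writes the form as a sum of squares, one of which is a fixed t > 0 by
    [companion_observable], plus a remainder that tends to 0 and is at most t/2 for a suitable n. *)
Lemma limit_cov_posdef : sigma != 0 -> sym_posdef Lc.
Proof.
move=> s0; split; first exact: limit_cov_sym.
move=> x xn0; have [k0 hk0] := companion_observable xn0.
set t := (sigma * ((C ^+ k0)^T *m x) 0 0) ^+ 2.
have t0 : 0 < t by rewrite exprn_even_gt0 //= mulf_neq0.
have dec n : quad_form Lc x = \sum_(k < n) (sigma * ((C ^+ k)^T *m x) 0 0) ^+ 2
    + quad_form Lc ((C ^+ n)^T *m x).
  rewrite {1}/quad_form {1}(lyapunov_iterate C Lc n) limit_cov_lyapunov.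
  rewrite mulmxDr mulmxDl mxE quad_form_conj; congr (_ + _).
  rewrite mulmx_sumr mulmx_suml summxE; apply: eq_bigr => k _.
  by rewrite quad_form_conj quad_form_noise_cov.
pose c := nrm x ^+ 2 * nrm Lc + 1.
have c0 : 0 < c by rewrite ltr_wpDl// mulr_ge0 ?sqr_ge0 ?nrm_ge0.
have [K [rho [K0 rho0 rho1 hK]]] := dC.
have [n [nk hn]] : exists n, (k0 < n)%N /\ nrm (C ^+ n) ^+ 2 * c <= t / 2.
  have : (fun n => (K * rho ^+ n) * (K * rho ^+ n) * c) @ \oo --> (K * 0) * (K * 0) * c.
    have h : (fun n => K * rho ^+ n) @ \oo --> K * 0.
      by apply: cvgMr; apply: cvg_expr; rewrite gtr0_norm.
    by apply: cvgMl; apply: cvgM.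
  rewrite !mulr0 mul0r => /cvgrPdist_le /(_ (t / 2) (divr_gt0 t0 (ltr0Sn _ 1))) [m _ hm].
  exists (maxn m k0.+1); split; first exact: leq_maxr.
  have := hm (maxn m k0.+1) (leq_maxl _ _); rewrite /= sub0r normrN => h.
  apply: le_trans (le_trans (ler_norm _) h).
  by rewrite ler_wpM2r ?(ltW c0)// expr2 ler_pM ?nrm_ge0.
rewrite (dec n) (bigD1 (Ordinal nk))//= -/t -addrA.
have S0 : 0 <= \sum_(i < n | i != Ordinal nk) (sigma * ((C ^+ i)^T *m x) 0 0) ^+ 2.
  by apply: sumr_ge0 => i _; exact: sqr_ge0.
have : `|quad_form Lc ((C ^+ n)^T *m x)| <= t / 2.
  apply: le_trans hn; rewrite -nrm_scalar11 (le_trans (nrmM3 _ _ _))// nrm_tr.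
  have h : nrm ((C ^+ n)^T *m x) <= nrm (C ^+ n) * nrm x.
    by rewrite (le_trans (nrmM _ _))// nrm_tr.
  rewrite /c mulrDr mulr1 -[leLHS]addr0 lerD ?sqr_ge0//.
  rewrite mulrAC [leRHS]mulrA ler_wpM2r ?nrm_ge0// -exprMn expr2.
  by rewrite ler_pM ?nrm_ge0.
rewrite ler_norml => /andP[h _].
by move: h t0 S0; clear; move: (quad_form _ _) (\sum_(i < n | _) _) t => u v w; lra.
Qed.

End lyapunov.

(** * Recursive least squares *)

Section positive_definite.
Context {R : realType} {d : nat}.
Implicit Types (D S : 'M[R]_d) (u v : 'cV[R]_d).

Definition bil_form D u v : R := (u^T *m D *m v) 0 0.

Lemma bil_form_sym D u v : D^T = D -> bil_form D u v = bil_form D v u.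
Proof.
move=> DT; rewrite /bil_form.
have -> : (u^T *m D *m v) 0 0 = ((u^T *m D *m v)^T) 0 0 by rewrite [RHS]mxE.
by rewrite !trmx_mul trmxK DT mulmxA.
Qed.

Lemma quad_formD D u v (e : R) : D^T = D ->
  quad_form D (u + e *: v) =
  quad_form D u + 2 * e * bil_form D v u + e ^+ 2 * quad_form D v.
Proof.
move=> DT; have E : (u + e *: v)^T *m D *m (u + e *: v) =
    u^T *m D *m u + e *: (u^T *m D *m v) + e *: (v^T *m D *m u) +
    (e * e) *: (v^T *m D *m v).
  rewrite [(u + _)^T]linearD /= [(e *: v)^T]linearZ /=.
  rewrite !mulmxDr !mulmxDl -!scalemxAr -!scalemxAl scalerA.
  by rewrite -!addrA; congr (_ + _); rewrite addrCA.
have e11 (X Y : 'M[R]_1) : (X + Y) 0 0 = X 0 0 + Y 0 0 by rewrite mxE.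
have z11 c (X : 'M[R]_1) : (c *: X) 0 0 = c * X 0 0 by rewrite mxE.
rewrite /quad_form E !e11 !z11 -/(bil_form D u v) -/(bil_form D v u).
by rewrite (bil_form_sym u v DT); ring.
Qed.

Lemma quad_form_ge0 D u : sym_posdef D -> 0 <= quad_form D u.
Proof.
move=> [_ h]; have [->|/h/ltW//] := eqVneq u 0.
by rewrite /quad_form mulmx0 mxE.
Qed.

Lemma bil_form_CS D u v : sym_posdef D ->
  bil_form D u v ^+ 2 <= quad_form D u * quad_form D v.
Proof.
move=> pD; have [DT h] := pD.
have [->|un0] := eqVneq u 0.
  by rewrite /bil_form /quad_form trmx0 !mul0mx !mxE expr0n /= mul0r.
have f0 := h _ un0.
have := quad_form_ge0 (v + (- (bil_form D u v / quad_form D u)) *: u) pD.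
rewrite quad_formD//; set b := bil_form D u v; set f := quad_form D u.
have -> : quad_form D v + 2 * - (b / f) * b + (- (b / f)) ^+ 2 * f =
    quad_form D v - b ^+ 2 / f by field; rewrite gt_eqF.
by rewrite subr_ge0 ler_pdivrMr// mulrC.
Qed.

Lemma posdef_unit D : sym_posdef D -> D \in unitmx.
Proof.
move=> [DT h]; rewrite unitmxE unitfE; apply/negP => /det0P[v vn0 vD].
have : 0 < quad_form D v^T.
  by apply: h; apply: contra vn0 => /eqP E; rewrite -[v]trmxK E trmx0.
by rewrite /quad_form trmxK vD mul0mx mxE ltxx.
Qed.

Lemma posdef_inv D : sym_posdef D -> sym_posdef (invmx D).
Proof.
move=> pD; have uD := posdef_unit pD; have [DT h] := pD; split.
  by rewrite trmx_inv DT.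
move=> v vn0; have : 0 < quad_form D (invmx D *m v).
  apply: h; apply: contra vn0 => /eqP E.
  by rewrite -[v]mul1mx -(mulmxV uD) -mulmxA E mulmx0.
rewrite /quad_form trmx_mul trmx_inv DT.
by rewrite -!mulmxA mulmxA [D *m (_ *m _)]mulmxA mulmxV// mul1mx mulmxA.
Qed.

Lemma posdef_add_rank1 D u : sym_posdef D -> sym_posdef (D + u *m u^T).
Proof.
move=> [DT h]; split; first by rewrite linearD /= trmx_mul trmxK DT.
move=> v vn0; rewrite /quad_form mulmxDr mulmxDl mxE ltr_pwDl//; first exact: h.
rewrite mulmxA -mulmxA mxE big_ord1.
have -> : (v^T *m u) 0 0 = (u^T *m v) 0 0.
  have -> : (v^T *m u) 0 0 = ((v^T *m u)^T) 0 0 by rewrite [RHS]mxE.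
  by rewrite trmx_mul trmxK.
by rewrite -expr2 sqr_ge0.
Qed.

Lemma quad_form_le_nrm D u : `|quad_form D u| <= nrm D * nrm u ^+ 2.
Proof.
rewrite -nrm_scalar11 (le_trans (nrmM3 _ _ _))// nrm_tr expr2.
by rewrite mulrAC mulrC.
Qed.

Lemma bil_form_le_nrm D u v : `|bil_form D u v| <= nrm D * (nrm u * nrm v).
Proof.
rewrite -nrm_scalar11 (le_trans (nrmM3 _ _ _))// nrm_tr.
by rewrite mulrAC mulrC.
Qed.

Lemma quad_formB D D' u : quad_form (D - D') u = quad_form D u - quad_form D' u.
Proof. by rewrite /quad_form mulmxBr mulmxBl !mxE. Qed.

Lemma bil_formB D D' u v :
  bil_form (D - D') u v = bil_form D u v - bil_form D' u v.
Proof. by rewrite /bil_form mulmxBr mulmxBl !mxE. Qed.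

Lemma quad_formZ D c u : quad_form (c *: D) u = c * quad_form D u.
Proof. by rewrite /quad_form -scalemxAr -scalemxAl mxE. Qed.

Lemma bil_formZ D c u v : bil_form (c *: D) u v = c * bil_form D u v.
Proof. by rewrite /bil_form -scalemxAr -scalemxAl mxE. Qed.

End positive_definite.

Section recursive_least_squares.
Context {R : realType} {d : nat}.
Variables (S : 'M[R]_d) (theta : 'cV[R]_d).
Hypothesis S_posdef : sym_posdef S.
Variables (Phi : nat -> 'cV[R]_d) (e : nat -> R).

Definition gramS n : 'M[R]_d := \sum_(k < n) Phi k *m (Phi k)^T + S.
Definition score n : 'cV[R]_d := \sum_(k < n) e k *: Phi k - S *m theta.
Definition gain n := invmx (gramS n).
Definition energy n := quad_form (gain n) (score n).
Definition energy_after n := quad_form (gain n.+1) (score n).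
Definition leverage n := quad_form (gain n.+1) (Phi n).
Definition slope n := bil_form (gain n.+1) (Phi n) (score n).
(** The error Phi_n^t (estimate - theta) of the prediction made before the update; [slope] is the
    same expression with the updated gain. *)
Definition pred_error n := bil_form (gain n) (Phi n) (score n).

Lemma gramS_S n : gramS n.+1 = gramS n + Phi n *m (Phi n)^T.
Proof. by rewrite /gramS big_ord_recr /= addrAC. Qed.

Lemma score_S n : score n.+1 = score n + e n *: Phi n.
Proof. by rewrite /score big_ord_recr /= addrAC. Qed.

Lemma gramS_posdef n : sym_posdef (gramS n).
Proof.
elim: n => [|n IH]; first by rewrite /gramS big_ord0 add0r.
by rewrite gramS_S; exact: posdef_add_rank1.
Qed.

Lemma gain_posdef n : sym_posdef (gain n).
Proof. exact: posdef_inv (gramS_posdef n). Qed.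

Lemma gain_sym n : (gain n)^T = gain n.
Proof. by case: (gain_posdef n). Qed.

Lemma energy_S n : energy n.+1 =
  energy_after n + 2 * e n * slope n + e n ^+ 2 * leverage n.
Proof. by rewrite /energy score_S quad_formD// gain_sym. Qed.

(** The resolvent identity for the two Gram matrices, a form of the Sherman-Morrison formula without
    denominator. *)
Lemma gain_step n : gain n = gain n.+1 + gain n.+1 *m Phi n *m ((Phi n)^T *m gain n).
Proof.
have u1 := posdef_unit (gramS_posdef n); have u2 := posdef_unit (gramS_posdef n.+1).
have : gain n.+1 *m gramS n.+1 *m gain n = gain n by rewrite mulVmx// mul1mx.
rewrite {1}gramS_S mulmxDr mulmxDl -[gain n.+1 *m gramS n *m _]mulmxA mulmxV// mulmx1.
by move=> h; rewrite -[LHS]h !mulmxA.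
Qed.

Lemma energy_ge0 n : 0 <= energy n.
Proof. exact: quad_form_ge0 (gain_posdef n). Qed.

Lemma energy_after_ge0 n : 0 <= energy_after n.
Proof. exact: quad_form_ge0 (gain_posdef _). Qed.

Lemma leverage_ge0 n : 0 <= leverage n.
Proof. exact: quad_form_ge0 (gain_posdef _). Qed.

Lemma slope_sqr_le n : slope n ^+ 2 <= leverage n * energy_after n.
Proof. exact: bil_form_CS (gain_posdef _). Qed.

Let gain_step_bil (u v : 'cV[R]_d) n : bil_form (gain n) u v =
  bil_form (gain n.+1) u v +
  bil_form (gain n.+1) u (Phi n) * bil_form (gain n) (Phi n) v.
Proof.
rewrite {1}/bil_form {1}gain_step mulmxDr mulmxDl mxE; congr (_ + _).
have -> : u^T *m (gain n.+1 *m Phi n *m ((Phi n)^T *m gain n)) *m v =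
    u^T *m gain n.+1 *m Phi n *m ((Phi n)^T *m gain n *m v) by rewrite !mulmxA.
by rewrite mxE big_ord1.
Qed.

Lemma energy_diff n : energy n - energy_after n = slope n * pred_error n.
Proof.
rewrite /energy /energy_after /quad_form -/(bil_form (gain n) _ _).
rewrite gain_step_bil -/(bil_form (gain n.+1) _ _) addrC addKr.
by rewrite (bil_form_sym _ _ (gain_sym n.+1)).
Qed.

Lemma slope_pred_error n : slope n = (1 - leverage n) * pred_error n.
Proof.
have h : pred_error n = slope n + leverage n * pred_error n.
  exact: gain_step_bil.
by rewrite mulrBl mul1r {1}h addrK.
Qed.

Lemma leverage_gain n : quad_form (gain n) (Phi n) =
  leverage n + leverage n * quad_form (gain n) (Phi n).
Proof. exact: gain_step_bil. Qed.

(** With g the value at [Phi n] of the gain before the update, [leverage_gain] amounts to f = g / (1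
    + g). *)
Lemma leverage_lt1 n : leverage n < 1.
Proof.
have h := leverage_gain n.
have g0 := quad_form_ge0 (Phi n) (gain_posdef n).
have l0 := leverage_ge0 n.
rewrite ltNge; apply/negP => l1.
have : 0 <= (leverage n - 1) * quad_form (gain n) (Phi n).
  by rewrite mulr_ge0// subr_ge0.
lra.
Qed.

Lemma slope_sqr n : slope n ^+ 2 = (1 - leverage n) * (energy n - energy_after n).
Proof. by rewrite energy_diff expr2 {2}slope_pred_error; ring. Qed.

Lemma energy_drop n :
  energy n - energy_after n = (1 - leverage n) * pred_error n ^+ 2.
Proof. by rewrite energy_diff slope_pred_error; ring. Qed.

Lemma energy_after_le n : energy_after n <= energy n.
Proof.
rewrite -subr_ge0 energy_drop mulr_ge0 ?sqr_ge0// subr_ge0 ltW//.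
exact: leverage_lt1.
Qed.

(* [score n = gramS n *m gain n *m score n] and Cauchy-Schwarz for the form
   [gramS n]. *)
Lemma score_le n : nrm (score n) ^+ 2 <= d%:R ^+ 2 * nrm (gramS n) * energy n.
Proof.
have pA := gramS_posdef n; have uA := posdef_unit pA.
have h i : score n i 0 ^+ 2 <= nrm (gramS n) * energy n.
  have -> : score n i 0 = bil_form (gramS n) (delta_mx i 0) (gain n *m score n).
    rewrite /bil_form trmx_delta -mulmxA [gramS n *m _]mulmxA mulmxV//.
    by rewrite mul1mx -rowE [RHS]mxE.
  rewrite (le_trans (bil_form_CS _ _ pA))//; apply: ler_pM.
  - exact: quad_form_ge0.
  - exact: quad_form_ge0.
  - rewrite (le_trans _ (entry_le_nrm (gramS n) i i))// /quad_form.
    rewrite trmx_delta -rowE -colE [X in X <= _]mxE [X in X <= _]mxE; exact: ler_norm.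
  - rewrite /quad_form trmx_mul gain_sym /energy /quad_form.
    by rewrite -!mulmxA [gramS n *m _]mulmxA mulmxV// mul1mx.
rewrite (le_trans (nrm_sqr_le _))// expr2 -!mulrA ler_wpM2l//.
rewrite mulr_natl -[X in _ *+ X]card_ord -sumr_const.
by apply: ler_sum => i _; rewrite h.
Qed.

End recursive_least_squares.

(** * Convergence rate of the Gram matrix *)

Section autoregressive_path.
Context {R : realType} {d : nat}.
Variables (theta : 'cV[R]_d.+1) (sigma : R) (S : 'M[R]_d.+1).
Let C := companion theta.
Hypothesis C_decaying : decaying C.
Hypothesis S_posdef : sym_posdef S.
Local Notation s := (@s R).
Let Lc := limit_cov C sigma.
Let E1 : 'cV[R]_d.+1 := delta_mx 0 0.
Variables (Phi : nat -> 'cV[R]_d.+1) (e : nat -> R).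
Hypothesis Phi_S : forall n, Phi n.+1 = C *m Phi n + e n *: E1.

Let nrmE1 : nrm E1 <= 1.
Proof.
rewrite /nrm; under eq_bigr do rewrite big_ord1.
rewrite (bigD1 0)//= big1; last first.
  by move=> i i0; rewrite mxE (negbTE i0) /= normr0.
by rewrite mxE eqxx addr0 normr1.
Qed.

Let Phi_closed n : Phi n = C ^+ n *m Phi 0%N +
  \sum_(k < n) e k *: (C ^+ (n - k.+1) *m E1).
Proof.
elim: n => [|n IH]; first by rewrite big_ord0 addr0 expr0 mul1mx.
rewrite Phi_S {1}IH big_ord_recr /= subnn expr0 mul1mx mulmxDr addrA.
rewrite exprS -mulmxE mulmxA; congr (_ + _ + _).
rewrite mulmx_sumr; apply: eq_bigr => k _.
by rewrite -scalemxAr mulmxA [in RHS]subSn// exprS.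
Qed.

(** Variation of constants: the powers of C decay geometrically, so their convolution with the noise
    grows no faster than the noise. *)
Lemma regressor_growth (b : R) : 0 <= b -> polyO b e ->
  polyO b (fun n => nrm (Phi n)).
Proof.
move=> b0 /bigO_ge0-/(_ (fun n => powR_ge0 _ _))[D [D0 hD]].
have [K [rho [K0 rho0 rho1 hK]]] := C_decaying.
have r1 : 0 < 1 - rho by rewrite subr_gt0.
exists (K * nrm (Phi 0%N) + K * D / (1 - rho)) => n; rewrite ger0_norm ?nrm_ge0//.
have s1 : 1 <= s n `^ b.
  by rewrite -[X in X <= _](powRr0 (s n)); apply: s_powR_le.
rewrite Phi_closed (le_trans (nrmD _ _))// mulrDl lerD//.
  rewrite (le_trans (nrmM _ _))//.
  rewrite -[X in X <= _]mulr1 ler_pM ?mulr_ge0 ?nrm_ge0// ler_wpM2r ?nrm_ge0//.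
  by rewrite (le_trans (hK n))// ler_piMr// exprn_ile1 ?(ltW rho0) ?(ltW rho1).
rewrite (le_trans (nrm_sum _ _))//.
have geo m : \sum_(k < m) rho ^+ (m - k.+1) <= (1 - rho)^-1.
  elim: m => [|m IH]; first by rewrite big_ord0 invr_ge0 ltW.
  rewrite big_ord_recr /= subnn expr0.
  have -> : \sum_(i < m) rho ^+ (m.+1 - i.+1) = rho * \sum_(k < m) rho ^+ (m - k.+1).
    rewrite mulr_sumr; apply: eq_bigr => k _.
    by rewrite -exprS -(subSn (ltn_ord k)).
  apply: (@le_trans _ _ (rho * (1 - rho)^-1 + 1)).
    by rewrite lerD2r ler_wpM2l// ltW.
  rewrite le_eqVlt; apply/orP; left; apply/eqP; field.
  by rewrite gt_eqF.
apply: (@le_trans _ _ (\sum_(k < n) D * s n `^ b * K * rho ^+ (n - k.+1))).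
  apply: ler_sum => k _; rewrite nrmZ -mulrA ler_pM ?nrm_ge0//.
    rewrite (le_trans (hD k))// ler_wpM2l// s_powR_nondecr// ltnW//.
  rewrite (le_trans (nrmM _ _))// -[leRHS]mulr1 ler_pM ?nrm_ge0//.
rewrite -mulr_sumr.
have -> : K * D / (1 - rho) * s n `^ b = D * s n `^ b * K * (1 - rho)^-1 by ring.
by rewrite ler_wpM2l// !mulr_ge0// powR_ge0.
Qed.

(** The defect of [W] in the Lyapunov equation consists of boundary terms, a martingale sum of e_k
    Phi_k, the centred sum of e_k^2 and constants, each of smaller order than n under the
    assumptions of [gram_rate]. A single [noise_cov sigma] is left over because [s n] is n + 1. *)
Let W n := gramS S Phi n - s n *: Lc.

Let cross n : 'cV[R]_d.+1 := \sum_(k < n) e k *: Phi k.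

Let W_lyapunov n : W n - C *m W n *m C^T =
  Phi 0%N *m (Phi 0%N)^T - Phi n *m (Phi n)^T +
  (C *m cross n *m E1^T + E1 *m (cross n)^T *m C^T) +
  (\sum_(k < n) (e k ^+ 2 - sigma ^+ 2)) *: (E1 *m E1^T) -
  noise_cov sigma + (S - C *m S *m C^T).
Proof.
have GE : noise_cov sigma = sigma ^+ 2 *: (E1 *m E1^T) :> 'M[R]_d.+1.
  apply/matrixP => i j; rewrite !mxE big_ord1 !mxE !eqxx andbT.
  rewrite -!val_eqE /= andbT.
  by case: (_ == _)%N; case: (_ == _)%N; rewrite /= ?mulr1 ?mulr0 ?mul0r.
have step k : Phi k.+1 *m (Phi k.+1)^T = C *m (Phi k *m (Phi k)^T) *m C^T +
    e k *: (C *m Phi k *m E1^T + E1 *m (Phi k)^T *m C^T) +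
    e k ^+ 2 *: (E1 *m E1^T).
  rewrite Phi_S [(_ + _)^T]linearD /= [(e k *: E1)^T]linearZ /= trmx_mul.
  rewrite mulmxDr !mulmxDl -!scalemxAr -!scalemxAl scalerA -expr2.
  rewrite !mulmxA scalerDr -!addrA; congr (_ + _).
  by rewrite addrCA.
have tel : \sum_(k < n) Phi k.+1 *m (Phi k.+1)^T =
    \sum_(k < n) Phi k *m (Phi k)^T + Phi n *m (Phi n)^T - Phi 0%N *m (Phi 0%N)^T.
  pose G k := Phi k *m (Phi k)^T.
  have t1 : \sum_(k < n.+1) G k = \sum_(k < n) G k + G n by rewrite big_ord_recr.
  have t2 : \sum_(k < n.+1) G k = G 0%N + \sum_(k < n) G k.+1 by rewrite big_ord_recl.
  by rewrite -t1 t2 addrAC subrr add0r.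
have cr : \sum_(k < n) e k *: (C *m Phi k *m E1^T + E1 *m (Phi k)^T *m C^T) =
    C *m cross n *m E1^T + E1 *m (cross n)^T *m C^T.
  rewrite /cross [(\sum_(k < n) _)^T]linear_sum /= !mulmx_sumr !mulmx_suml -big_split.
  apply: eq_bigr => k _; rewrite scalerDr [(e k *: Phi k)^T]linearZ /=.
  by rewrite -!scalemxAr -!scalemxAl.
have sqs : \sum_(k < n) e k ^+ 2 *: (E1 *m E1^T) =
    (\sum_(k < n) (e k ^+ 2 - sigma ^+ 2)) *: (E1 *m E1^T) + n%:R *: noise_cov sigma.
  rewrite -scaler_suml sumrB sumr_const card_ord GE scalerA -scalerDl.
  by rewrite mulr_natl subrK.
have main : C *m (\sum_(k < n) Phi k *m (Phi k)^T) *m C^T =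
    \sum_(k < n) Phi k *m (Phi k)^T + Phi n *m (Phi n)^T - Phi 0%N *m (Phi 0%N)^T
    - (C *m cross n *m E1^T + E1 *m (cross n)^T *m C^T)
    - ((\sum_(k < n) (e k ^+ 2 - sigma ^+ 2)) *: (E1 *m E1^T) + n%:R *: noise_cov sigma).
  rewrite -tel -cr -sqs mulmx_sumr mulmx_suml -!sumrB; apply: eq_bigr => k _.
  by rewrite step [RHS]addrAC !addrK.
have Ly : C *m Lc *m C^T = Lc - noise_cov sigma.
  by rewrite -(limit_cov_lyapunov sigma C_decaying) opprB addrC subrK.
rewrite /W /gramS mulmxBr mulmxBl mulmxDr mulmxDl main -scalemxAr -scalemxAl Ly.
have -> : s n = 1 + n%:R by rewrite /s -natr1 addrC.
move: (\sum_(k < n) Phi k *m _) (Phi n *m _) (Phi 0%N *m _) (_ *: (E1 *m E1^T))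
  (noise_cov sigma) (C *m S *m C^T) (C *m _ *m _ + _) => X1 X2 X3 X4 X5 X6 X7.
apply/matrixP => i j; rewrite !mxE.
move: (X1 i j) (X2 i j) (X3 i j) (X4 i j) (X5 i j) (X6 i j) (X7 i j) (Lc i j) (S i j).
move=> *; ring.
Qed.

(** Each term of [W_lyapunov] is O(n^(1-del)), the condition on [b] and [del] handling the boundary
    term |Phi_n|^2, and [lyapunov_stable] turns this into a rate for [W] itself. *)
Lemma gram_rate (b del : R) : 0 < del -> del <= 1 -> 0 <= b -> b *+ 2 + del <= 1 ->
  polyO b (fun n => nrm (Phi n)) ->
  (forall i, polyO (1 - del) (fun n => \sum_(k < n) Phi k i 0 * e k)) ->
  polyO (1 - del) (fun n => \sum_(k < n) (e k ^+ 2 - sigma ^+ 2)) ->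
  polyO (- del) (fun n => nrm ((s n)^-1 *: gramS S Phi n - Lc)).
Proof.
move=> del0 del1 b0 bdel hPhi hcross hsq.
have [c [c0 hc]] := lyapunov_stable C_decaying.
have cst0 x : polyO (1 - del) (fun=> x : R).
  by apply: polyO_le (polyO_cst x); rewrite subr_ge0.
have hW : polyO (1 - del) (fun n => nrm (W n - C *m W n *m C^T)).
  pose y n := nrm (Phi 0%N *m (Phi 0%N)^T) + nrm (Phi n) ^+ 2 +
    2 * nrm C * nrm (cross n) + `|\sum_(k < n) (e k ^+ 2 - sigma ^+ 2)| +
    nrm (noise_cov sigma : 'M[R]_d.+1) + nrm (S - C *m S *m C^T).
  have y0 n : 0 <= y n.
    by rewrite !addr_ge0 ?nrm_ge0 ?sqr_ge0// !mulr_ge0 ?nrm_ge0.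
  apply: (@bigO_le _ _ y) => [n|].
    rewrite (ger0_norm (y0 n)) ger0_norm ?nrm_ge0// W_lyapunov /y.
    have h1 : nrm (C *m cross n *m E1^T) <= nrm C * nrm (cross n).
      rewrite (le_trans (nrmM _ _))// nrm_tr -[leRHS]mulr1.
      by rewrite ler_pM ?nrm_ge0 ?nrmM.
    have h2 : nrm (E1 *m (cross n)^T *m C^T) <= nrm C * nrm (cross n).
      rewrite -nrm_tr !trmx_mul !trmxK mulmxA //.
    have h3 : nrm (Phi n *m (Phi n)^T) <= nrm (Phi n) ^+ 2.
      by rewrite (le_trans (nrmM _ _))// nrm_tr expr2.
    have h4 : nrm (E1 *m E1^T) <= 1.
      rewrite (le_trans (nrmM _ _))// nrm_tr -[leRHS]mulr1.
      by rewrite ler_pM ?nrm_ge0.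
    set q := \sum_(k < n) (e k ^+ 2 - sigma ^+ 2).
    have h5 : nrm (q *: (E1 *m E1^T)) <= `|q| by rewrite nrmZ ler_piMr.
    apply: le_trans (nrmD _ _) _; rewrite lerD2r.
    apply: le_trans (nrmB _ _) _; rewrite lerD2r.
    apply: le_trans (nrmD _ _) _; apply: lerD => //.
    apply: le_trans (nrmD _ _) _; apply: lerD => //.
      by apply: le_trans (nrmB _ _) _; rewrite lerD2l.
    rewrite -mulrA mulr_natl mulr2n; apply: le_trans (nrmD _ _) _; exact: lerD.
  rewrite /y; apply: bigOD; last exact: cst0.
  apply: bigOD; last exact: cst0.
  apply: bigOD; last by apply: bigO_le hsq => n; rewrite normr_id.
  apply: bigOD.
    apply: bigOD; first exact: cst0.
    have := polyOX 2 hPhi; apply: polyO_le.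
    by move: bdel; rewrite mulr_natr; lra.
  apply: bigOZ; rewrite /nrm; apply: bigO_sum => i; apply: bigO_sum => j.
  apply: bigO_le (hcross i) => n; rewrite normr_id ord1 /cross summxE.
  rewrite (eq_bigr (fun k : 'I_n => Phi k i 0 * e k))// => k _.
  by rewrite mxE mulrC.
have hW' : polyO (1 - del) (fun n => nrm (W n)).
  apply: bigO_le (bigOZ c hW) => n; rewrite !ger0_norm ?mulr_ge0 ?nrm_ge0//.
have := polyOM (@polyO_powR R (-1)) hW'.
have -> : -1 + (1 - del) = - del by ring.
apply: bigO_le => n.
have sn0 : 0 < s n := s_gt0 n.
have -> : (s n)^-1 *: gramS S Phi n - Lc = (s n)^-1 *: W n.
  by rewrite scalerBr scalerA mulVf ?gt_eqF// scale1r.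
rewrite nrmZ powR_inv1 ?(ltW sn0)//.
by rewrite (@ger0_norm _ (s n)^-1) ?invr_ge0 ?(ltW sn0).
Qed.

(** A resolvent identity between the scaled gain and the inverse of [Lc]. It first bounds the scaled
    gain by a constant plus at most half of itself, from some index on, and then gives the rate. *)
Lemma gain_rate (del : R) : sigma != 0 -> 0 < del ->
  polyO (- del) (fun n => nrm ((s n)^-1 *: gramS S Phi n - Lc)) ->
  polyO 0 (fun n => nrm (s n *: gain S Phi n)) /\
  polyO (- del) (fun n => nrm (s n *: gain S Phi n - invmx Lc)).
Proof.
move=> sg0 del0 hG; have pL := limit_cov_posdef C_decaying sg0.
have uL := posdef_unit pL.
have key n : s n *: gain S Phi n - invmx Lc =
    - ((s n *: gain S Phi n) *m ((s n)^-1 *: gramS S Phi n - Lc) *m invmx Lc).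
  have sn0 : s n != 0 by rewrite gt_eqF// s_gt0.
  have t : (s n *: gain S Phi n) *m ((s n)^-1 *: gramS S Phi n) = 1%:M.
    rewrite -scalemxAr -scalemxAl scalerA mulVf// scale1r mulVmx//.
    exact: posdef_unit (gramS_posdef S_posdef Phi n).
  rewrite mulmxBr mulmxBl t mul1mx -[_ *m Lc *m _]mulmxA mulmxV//.
  by rewrite mulmx1 opprB.
have bd : polyO 0 (fun n => nrm (s n *: gain S Phi n)).
  have [K [K0 hK]] := bigO_ge0 (fun n => powR_ge0 _ _) hG.
  pose li := nrm (invmx Lc).
  have li0 : 0 <= li by exact: nrm_ge0.
  have A0 : 0 < 2 * (K * li) + 1 by rewrite ltr_wpDl// !mulr_ge0.
  have [|N small] := @s_powR_small R del (2 * (K * li) + 1)^-1 del0.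
    by rewrite invr_gt0.
  have hN n : (N <= n)%N -> K * s n `^ (- del) * li <= 2^-1.
    move=> /small h; rewrite mulrAC (le_trans (ler_wpM2l _ h)) ?mulr_ge0//.
    by rewrite ler_pdivrMr//; move: (K * li) => z; lra.
  apply: (@bigO_eventually _ _ _ N (2 * li)) => [n|n Nn]; first exact: s_powR_gt0.
  rewrite powRr0 mulr1 ger0_norm ?nrm_ge0//.
  set B := s n *: gain S Phi n; have B0 : 0 <= nrm B by exact: nrm_ge0.
  have h1 : nrm B <= li + nrm B * 2^-1.
    have kB : B = invmx Lc - B *m ((s n)^-1 *: gramS S Phi n - Lc) *m invmx Lc.
      by have /eqP := key n; rewrite -/B subr_eq addrC => /eqP.
    rewrite {1}kB.
    rewrite (le_trans (nrmD _ _))// nrmN lerD2l (le_trans (nrmM3 _ _ _))//.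
    rewrite -mulrA ler_wpM2l// -/li (le_trans _ (hN n Nn))// ler_wpM2r//.
    by have := hK n; rewrite ger0_norm ?nrm_ge0.
  lra.
split => //; have := polyOM bd hG; rewrite add0r => h.
apply: bigO_le (bigOZ (nrm (invmx Lc)) h) => n.
rewrite !ger0_norm ?mulr_ge0 ?nrm_ge0// key nrmN (le_trans (nrmM3 _ _ _))//.
by rewrite mulrC.
Qed.

End autoregressive_path.

(** * Trajectories *)

Section negligible_terms.
Context {R : realType}.
Implicit Types (x y Q : nat -> R).
Local Notation s := (@s R).
Local Notation L := (@L R).

(** [wmild] describes terms like the leverage, nearly of size Q n / n, and [negl] the summable ones,
    by [negl_summable]. The rule used throughout is [wmild_decay]: a [wmild] term times anything
    polynomially small is negligible. *)
Definition decay x := exists eta, 0 < eta /\ polyO (- eta) x.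
Definition negl Q x := exists eta, 0 < eta /\ wO Q (-1 - eta) x.
Definition wmild Q x := forall e, 0 < e -> wO Q (-1 + e) x.

Lemma decay_mild x y : decay x -> mild y -> decay (fun n => x n * y n).
Proof.
move=> [eta [e0 hx]] hy; exists (eta / 2); split; first by rewrite divr_gt0.
have -> : - (eta / 2) = - eta + eta / 2 by lra.
by apply: polyOM => //; apply: hy; rewrite divr_gt0.
Qed.

Lemma decayD x y : decay x -> decay y -> decay (fun n => x n + y n).
Proof.
move=> [e1 [e10 hx]] [e2 [e20 hy]]; exists (Num.min e1 e2).
split; first by rewrite lt_min e10.
by apply: bigOD; [apply: polyO_le hx|apply: polyO_le hy];
  rewrite lerN2 ge_min lexx ?orbT.
Qed.

Lemma decay_le x y : (forall n, `|y n| <= `|x n|) -> decay x -> decay y.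
Proof. by move=> h [e1 [e10 hx]]; exists e1; split=> //; exact: bigO_le hx. Qed.

Lemma decayM x y : decay x -> decay y -> decay (fun n => x n * y n).
Proof.
move=> [e1 [e10 hx]] [e2 [e20 hy]]; exists (e1 + e2); split; first exact: addr_gt0.
by rewrite opprD; exact: polyOM.
Qed.

Lemma decay_is_mild x : decay x -> mild x.
Proof. by move=> [e1 [e10 hx]] e e0; apply: polyO_le hx; lra. Qed.

Lemma decay_inv_s : decay (fun n => (s n)^-1).
Proof.
exists 1; split => //; have := @polyO_powR R (-1).
by apply: bigO_le => n; rewrite powR_inv1 ?(ltW (s_gt0 n)).
Qed.

Variable Q : nat -> R.
Hypothesis Q1 : forall n, 1 <= Q n.

Let Q0 n : 0 <= Q n. Proof. exact: le_trans ler01 (Q1 n). Qed.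

Lemma negl_summable x : (exists C, forall n, \sum_(k < n.+1) Q k <= C * s n) ->
  negl Q x -> abs_summable x.
Proof.
move=> QS [eta [eta0 hx]]; apply: (wO_summable (Q := Q) (e := -1 - eta)) => //.
by rewrite ltrBlDr ltrDl.
Qed.

Lemma neglD x y : negl Q x -> negl Q y -> negl Q (fun n => x n + y n).
Proof.
move=> [e1 [e10 hx]] [e2 [e20 hy]]; exists (Num.min e1 e2).
split; first by rewrite lt_min e10.
by apply: bigOD; [apply: wO_le hx => //|apply: wO_le hy => //];
  rewrite lerD2l lerN2 ge_min lexx ?orbT.
Qed.

Lemma negl_le x y : (forall n, `|y n| <= `|x n|) -> negl Q x -> negl Q y.
Proof. by move=> h [e1 [e10 hx]]; exists e1; split=> //; exact: bigO_le hx. Qed.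

Lemma neglN x : negl Q x -> negl Q (fun n => - x n).
Proof. by move=> h; apply: negl_le h => n; rewrite normrN. Qed.

Lemma neglZ c x : negl Q x -> negl Q (fun n => c * x n).
Proof. by move=> [e1 [e10 hx]]; exists e1; split=> //; exact: bigOZ. Qed.

Lemma negl_mild x y : negl Q x -> mild y -> negl Q (fun n => x n * y n).
Proof.
move=> [eta [e0 hx]] hy; exists (eta / 2); split; first by rewrite divr_gt0.
have -> : -1 - eta / 2 = (-1 - eta) + eta / 2 by lra.
by apply: wOM => //; apply: hy; rewrite divr_gt0.
Qed.

Lemma wmild_wO x : wO Q (-1) x -> wmild Q x.
Proof. by move=> hx e e0; apply: wO_le hx => //; rewrite lerDl ltW. Qed.

Lemma wmild_mild x y : wmild Q x -> mild y -> wmild Q (fun n => x n * y n).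
Proof.
move=> hx hy e e0; have -> : -1 + e = (-1 + e / 2) + e / 2 by lra.
by apply: wOM => //; [apply: hx|apply: hy]; rewrite divr_gt0.
Qed.

Lemma wmild_decay x y : wmild Q x -> decay y -> negl Q (fun n => x n * y n).
Proof.
move=> hx [eta [eta0 hy]]; exists (eta / 2); split; first by rewrite divr_gt0.
have -> : -1 - eta / 2 = (-1 + eta / 2) + - eta by lra.
by apply: wOM => //; apply: hx; rewrite divr_gt0.
Qed.

Lemma wmild_le x y : (forall n, `|y n| <= `|x n|) -> wmild Q x -> wmild Q y.
Proof. by move=> h hx e e0; exact: bigO_le (hx e e0). Qed.

Lemma wmild_inv_s : wmild Q (fun n => (s n)^-1).
Proof.
apply: wmild_wO; apply: polyO_wO => //; have := @polyO_powR R (-1).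
by apply: bigO_le => n; rewrite powR_inv1 ?(ltW (s_gt0 n)).
Qed.

Lemma decayX_sub x y : mild x -> decay (fun n => y n - x n) ->
  forall j, decay (fun n => y n ^+ j - x n ^+ j).
Proof.
move=> mx dxy j.
have my : mild y.
  have := mildD mx (decay_is_mild dxy).
  by rewrite (_ : (fun n => _) = y)//; apply/funext => n; rewrite addrC subrK.
under eq_fun do rewrite subrXX.
apply: decay_mild => // e e0; apply: bigO_sum => i.
by apply: mildM => //; apply: mildX.
Qed.

Lemma summation_by_parts (c J : nat -> R) n :
  \sum_(k < n) c k * (J k.+1 - J k) =
  c n * J n - c 0%N * J 0%N - \sum_(k < n) J k.+1 * (c k.+1 - c k).
Proof.
elim: n => [|n IH]; first by rewrite !big_ord0 subrr subr0.
by rewrite !big_ord_recr /= IH; ring.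
Qed.

End negligible_terms.

Section regular_path.
Context {R : realType}.
Local Notation s := (@s R).
Local Notation L := (@L R).

(* Along a trajectory: [V], [x] are the values of the score energy before and
   after the information matrix is updated, [f] the leverage, [b] the slope, and
   the primed sequences are their analogues for the limiting matrix
   [n * limit_cov]; [J] sums the deviations of [h] from its mean [dd]. *)
Record regular_path (dd eta : R) (Q e f b x V f' b' x' V' h J : nat -> R) := {
  rp_eta : 0 < eta;
  rp_Q1 : forall n, 1 <= Q n;
  rp_QS : exists C, forall n, \sum_(k < n.+1) Q k <= C * s n;
  rp_f01 : forall n, 0 <= f n <= 1;
  rp_fQ : wO Q (-1) f;
  rp_fd : polyO (- eta) f;
  rp_x0 : forall n, 0 <= x n;
  rp_xV : forall n, x n <= V n;
  rp_b : forall n, b n ^+ 2 = (1 - f n) * (V n - x n);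
  rp_bfx : forall n, b n ^+ 2 <= f n * x n;
  rp_rec : forall n, V n.+1 = x n + 2 * e n * b n + e n ^+ 2 * f n;
  rp_f'0 : forall n, 0 <= f' n;
  rp_V'0 : forall n, 0 <= V' n;
  rp_x' : forall n, x' n = V' n * (s n / s n.+1);
  rp_bfx' : forall n, b' n ^+ 2 <= f' n * x' n;
  rp_rec' : forall n, V' n.+1 = x' n + 2 * e n * b' n + e n ^+ 2 * f' n;
  rp_VV : bigO (fun n => s n `^ (- eta) * V n) (fun n => V' n - V n);
  rp_f'd : polyO (- eta) f';
  rp_ff : wO Q (-1 - eta) (fun n => f' n - f n);
  rp_bb : bigO (fun n => Q n * s n `^ (-1 - eta) * V n)
    (fun n => b' n ^+ 2 - b n ^+ 2);
  rp_hf : wO Q (-1 - eta) (fun n => h n / s n - f n);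
  rp_J : polyO (1 - eta) J;
  rp_JS : forall n, J n.+1 = J n + (h n - dd) }.

Variables (dd eta : R) (Q e f b x V f' b' x' V' h J : nat -> R).
Hypothesis rp : regular_path dd eta Q e f b x V f' b' x' V' h J.

Let Q1 := rp_Q1 rp.
Let Q0 n : 0 <= Q n. Proof. exact: le_trans ler01 (Q1 n). Qed.
Let QS := rp_QS rp.
Let f0 n : 0 <= f n. Proof. by have /andP[] := rp_f01 rp n. Qed.
Let x0 := rp_x0 rp.
Let xV := rp_xV rp.
Let V0 n : 0 <= V n. Proof. exact: le_trans (x0 n) (xV n). Qed.

Lemma rp_fdecay : decay f.
Proof. by exists eta; split; [exact: rp_eta rp|exact: rp_fd rp]. Qed.

Lemma rp_fwmild : wmild Q f.
Proof. exact: wmild_wO (rp_fQ rp). Qed.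

Lemma rp_ffnegl : negl Q (fun n => f' n - f n).
Proof. by exists eta; split; [exact: rp_eta rp|exact: rp_ff rp]. Qed.

Lemma negl_is_wmild y : negl Q y -> wmild Q y.
Proof. by move=> [e1 [e10 hy]] e2 e20; apply: wO_le hy => //; lra. Qed.

Lemma rp_f'wmild : wmild Q f'.
Proof.
move=> e1 e10; have := bigOD (rp_fwmild e10) (negl_is_wmild rp_ffnegl e10).
by apply: bigO_le => n; rewrite addrC subrK.
Qed.

(** If f <= 1/2, then b^2 is at least half the drop and at most f x; if f > 1/2, the drop is at most
    V, hence at most 2 f V. *)
Lemma drop_le n : V n - x n <= 2 * (f n * V n).
Proof.
have [f2|f2] := leP (f n) 2^-1.
  have : 2^-1 * (V n - x n) <= (1 - f n) * (V n - x n).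
    by rewrite ler_wpM2r ?subr_ge0//; lra.
  rewrite -(rp_b rp) => hh; have := le_trans hh (rp_bfx rp n).
  have : f n * x n <= f n * V n by rewrite ler_wpM2l.
  by move: (f n * x n) (f n * V n) (V n) (x n) hh => *; lra.
have : 2^-1 * V n <= f n * V n by rewrite ler_wpM2r// ltW.
by have := x0 n; move: (f n * V n) (V n) (x n) => *; lra.
Qed.

Lemma slope_le_drop n : b n ^+ 2 <= V n - x n.
Proof. by rewrite (rp_b rp) ler_piMl ?subr_ge0// lerBlDr lerDl. Qed.

Lemma V'_le : exists C, 0 <= C /\ forall n, V' n <= C * V n.
Proof.
have y0 n : 0 <= s n `^ (- eta) * V n by rewrite mulr_ge0 ?powR_ge0.
have [C [C0 hC]] := bigO_ge0 y0 (rp_VV rp).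
exists (C + 1); split; first exact: addr_ge0.
move=> n; rewrite mulrDl mul1r -lerBlDr (le_trans (ler_norm _))//.
rewrite (le_trans (hC n))// ler_wpM2l// ler_piMl//.
rewrite -[leRHS](powRr0 (s n)) s_powR_le// oppr_le0 ltW//; exact: rp_eta rp.
Qed.

Lemma x'0 n : 0 <= x' n.
Proof.
rewrite (rp_x' rp) mulr_ge0 ?(rp_V'0 rp)// divr_ge0 ?(ltW (s_gt0 _))//.
Qed.

Lemma x'_le n : x' n <= V' n.
Proof.
rewrite (rp_x' rp) ler_piMr ?(rp_V'0 rp)// ler_pdivrMr ?s_gt0// mul1r.
exact: s_nondecr.
Qed.

Lemma drop_identity m n : V n ^+ m - x n ^+ m =
  (V n - x n) * \sum_(i < m) V n ^+ (m.-1 - i) * x n ^+ i.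
Proof.
by rewrite subrXX.
Qed.

Lemma drop_power_ge m n : (0 < m)%N ->
  (V n - x n) * V n ^+ m.-1 <= V n ^+ m - x n ^+ m.
Proof.
case: m => // m _; rewrite drop_identity ler_wpM2l ?subr_ge0//.
rewrite big_ord_recl /= subn0 expr0 mulr1 lerDl sumr_ge0// => i _.
by rewrite mulr_ge0 ?exprn_ge0.
Qed.

Lemma drop_power_ge0 m n : 0 <= V n ^+ m - x n ^+ m.
Proof. by rewrite subr_ge0 lerXn2r ?nnegrE. Qed.

Lemma mild_of_power (g : R) m : (0 < m)%N ->
  bounded_seq (fun n => V n ^+ m / L n `^ (1 + g)) -> mild V.
Proof.
move=> m0 [C hC].
have h1 : bigO (fun n => L n `^ (1 + g)) (fun n => V n ^+ m).
  exists C => n; have L0 : 0 < L n `^ (1 + g) by rewrite powR_gt0// L_gt0.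
  have := hC n; rewrite normrM (@ger0_norm _ (_)^-1) ?invr_ge0 ?(ltW L0)//.
  by rewrite ler_pdivrMr.
have h2 : mild (fun n => 1 + V n ^+ m).
  apply: mildD; first exact: mild_cst.
  by apply: mild_bigO h1 => [n|]; [exact: powR_ge0|exact: mild_L_powR].
apply: mild_bigO h2 _ => [n|]; first by rewrite addr_ge0 ?exprn_ge0.
exists 1 => n; rewrite mul1r ger0_norm//.
have [V1|V1] := leP (V n) 1.
  by rewrite (le_trans V1)// lerDl exprn_ge0.
apply: (@le_trans _ _ (V n ^+ m)); last by rewrite lerDr.
by case: m m0 {hC h1} => // m _; rewrite exprS ler_peMr// exprn_ege1// ltW.
Qed.

(** One factor V^(m-1) joins b^2 to be bounded by the drop of V^m; the other is at most a constant
    times L^((1+g)(1-1/m)). The condition on [g] is the resulting comparison of exponents of L. *)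
Lemma slope_power_summable (g : R) m : (0 < m)%N -> 0 < g -> g <= 1 ->
  (1 + g) * (2 - m%:R^-1) <= 2 - 2 * g ->
  bounded_seq (fun n => V n ^+ m / L n `^ (1 + g)) ->
  abs_summable (fun n => (V n ^+ m - x n ^+ m) / L n `^ (1 + g)) ->
  abs_summable (fun n => b n ^+ 2 * V n ^+ (2 * m.-1) / L n `^ (1 - g) ^+ 2).
Proof.
move=> m0 g0 g1 gm [C hC] hs.
have mR : (0 : R) < m%:R by rewrite ltr0n.
pose K := `|C| + 1; have K1 : 1 <= K by rewrite lerDr.
have K0 : 0 < K := lt_le_trans ltr01 K1.
pose t := m.-1%:R / m%:R : R.
have t0 : 0 <= t by rewrite divr_ge0.
have t1 : t = 1 - m%:R^-1.
  rewrite /t -subn1 natrB// mulrBl divff ?gt_eqF// mul1r.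
  by [].
have tle : t <= 1 by rewrite t1 lerBlDr lerDl invr_ge0 ltW.
have Vm n : V n ^+ m <= K * L n `^ (1 + g).
  have L0 : 0 < L n `^ (1 + g) by rewrite powR_gt0// L_gt0.
  have := hC n; rewrite ger0_norm; last by rewrite divr_ge0 ?exprn_ge0 ?(ltW L0).
  rewrite ler_pdivrMr// => hh; rewrite (le_trans hh)// ler_wpM2r ?(ltW L0)//.
  by rewrite (le_trans (ler_norm C))// lerDl.
have Vm1 n : V n ^+ m.-1 <= K * L n `^ ((1 + g) * t).
  have -> : V n ^+ m.-1 = (V n ^+ m) `^ t.
    rewrite -!powR_mulrn// -powRrM /t mulrCA divff ?gt_eqF// mulr1.
    by rewrite powR_mulrn.
  apply: (@le_trans _ _ ((K * L n `^ (1 + g)) `^ t)).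
    apply: (ge0_ler_powR t0) => //; rewrite nnegrE ?exprn_ge0//.
    by rewrite mulr_ge0 ?powR_ge0 ?(ltW K0).
  rewrite powRM ?powR_ge0 ?(ltW K0)// -powRrM ler_wpM2r ?powR_ge0//.
  exact: ler1_powR.
apply: abs_summable_bigO hs _; exists K => n.
have L0 : 0 < L n := L_gt0 n.
have La e1 : 0 < L n `^ e1 by rewrite powR_gt0.
rewrite !ger0_norm; last 2 first.
- by rewrite divr_ge0 ?drop_power_ge0 ?(ltW (La _)).
- by apply: divr_ge0; [apply: mulr_ge0; rewrite ?sqr_ge0// exprn_ge0|exact: sqr_ge0].
have -> : L n `^ (1 - g) ^+ 2 = L n `^ (2 - 2 * g).
  rewrite -powR_mulrn ?powR_ge0// -powRrM; congr (_ `^ _); ring.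
rewrite ler_pdivrMr//.
have e1 : b n ^+ 2 * V n ^+ (2 * m.-1) <= (V n ^+ m - x n ^+ m) * (K * L n `^ ((1 + g) * t)).
  rewrite mul2n -addnn exprD mulrA; apply: ler_pM => //.
  - by apply: mulr_ge0; rewrite ?sqr_ge0// exprn_ge0.
  - by rewrite exprn_ge0.
  - rewrite (le_trans _ (drop_power_ge n m0))// ler_wpM2r ?exprn_ge0//.
    exact: slope_le_drop.
rewrite (le_trans e1)// mulrCA -!mulrA ler_wpM2l ?(ltW K0)// ler_wpM2l ?drop_power_ge0//.
rewrite -ler_pdivrMl ?invr_gt0// invrK -powRD; last by apply/implyP => _; rewrite gt_eqF.
apply: ler_powR; first exact: L_ge1.
by move: gm; rewrite t1; move: (m%:R^-1) => u; lra.
Qed.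

Section stage.
Variables (g : R) (m : nat).
Hypothesis mV : mild V.

Let mx : mild x.
Proof.
by apply: mild_bigO mV _ => //; exists 1 => n; rewrite mul1r ger0_norm.
Qed.

Lemma mild_V' : mild V'.
Proof.
have [C [C0 hC]] := V'_le; apply: mild_bigO mV _ => //; exists C => n.
by rewrite ger0_norm ?(rp_V'0 rp).
Qed.

Lemma mild_x' : mild x'.
Proof.
apply: mild_bigO mild_V' _; first exact: rp_V'0 rp.
by exists 1 => n; rewrite mul1r ger0_norm ?x'0// x'_le.
Qed.

Lemma decay_V'V : decay (fun n => V' n - V n).
Proof.
have : decay (fun n => s n `^ (- eta) * V n).
  apply: decay_mild mV; exists eta; split; first exact: rp_eta rp.
  exact: polyO_powR.
move=> [e1 [e10 hh]]; exists e1; split => //.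
by apply: (bigO_trans _ (rp_VV rp) hh) => n; rewrite mulr_ge0 ?powR_ge0.
Qed.

Lemma decay_xV : decay (fun n => x n - V n).
Proof.
have := decay_mild rp_fdecay (mildM (mild_cst 2) mV).
apply: decay_le => n; rewrite -normrN opprB ger0_norm ?subr_ge0//.
rewrite (le_trans (drop_le n))// mulrCA; exact: ler_norm.
Qed.

Lemma decay_x'V : decay (fun n => x' n - V n).
Proof.
have hh : decay (fun n => x' n - V' n).
  have := decay_mild (@decay_inv_s R) mild_V'; apply: decay_le => n.
  have sn0 := s_gt0 (R := R) n; have sm0 := s_gt0 (R := R) n.+1.
  have -> : x' n - V' n = - (V' n / s n.+1).
    have E : s n = s n.+1 - 1 by rewrite sS addrK.
    rewrite (rp_x' rp) E mulrBl divff ?gt_eqF// mul1r mulrBr mulr1.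
    by rewrite addrAC subrr add0r.
  rewrite normrN !normrM mulrC ler_wpM2r// !ger0_norm ?invr_ge0 ?(ltW sn0) ?(ltW sm0)//.
  by rewrite lef_pV2 ?posrE// s_nondecr.
have := decayD hh decay_V'V; apply: decay_le => n.
by rewrite addrA subrK.
Qed.

Lemma wmild_slope : wmild Q (fun n => b n ^+ 2).
Proof.
have := wmild_mild Q1 rp_fwmild mx; apply: wmild_le => n.
by rewrite ger0_norm ?sqr_ge0// (le_trans (rp_bfx rp n))// ler_norm.
Qed.

Lemma negl_slope' : negl Q (fun n => b' n ^+ 2 - b n ^+ 2).
Proof.
have : negl Q (fun n => Q n * s n `^ (-1 - eta) * V n).
  apply: negl_mild => //; exists eta; split; first exact: rp_eta rp.
  by exists 1 => n; rewrite mul1r ger0_norm ?mulr_ge0 ?powR_ge0.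
move=> [e1 [e10 hh]]; exists e1; split => //.
by apply: (bigO_trans _ (rp_bb rp) hh) => n; rewrite !mulr_ge0 ?powR_ge0.
Qed.

(** Whichever form is being expanded, its second-order term may be evaluated at [V], [b] and [f]:
    each substitution costs a negligible term. Both expansions thus have the same leading
    coefficient. *)
Lemma second_order_negl (z b1 f1 : nat -> R) :
  decay (fun n => z n - V n) -> negl Q (fun n => f1 n - f n) ->
  negl Q (fun n => b1 n ^+ 2 - b n ^+ 2) ->
  negl Q (fun n => second_order (z n) (b1 n) (f1 n) m -
    (m%:R * (f n * V n ^+ m.-1) + (2 * m * m.-1)%:R * (b n ^+ 2 * V n ^+ m.-2))).
Proof.
move=> dz nf nb.
have mz : mild z.
  have := mildD mV (decay_is_mild dz).
  by rewrite (_ : (fun n => _) = z)//; apply/funext => n; rewrite addrC subrK.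
have h1 := neglZ m%:R (neglD Q1 (negl_mild Q1 nf (mildX m.-1 mz))
  (wmild_decay Q1 rp_fwmild (decayX_sub mV dz m.-1))).
have h2 := neglZ (2 * m * m.-1)%:R (neglD Q1 (negl_mild Q1 nb (mildX m.-2 mz))
  (wmild_decay Q1 wmild_slope (decayX_sub mV dz m.-2))).
have := neglD Q1 h1 h2; apply: negl_le => n; rewrite /second_order.
by rewrite le_eqVlt; apply/orP; left; apply/eqP; congr (`|_|); ring.
Qed.

End stage.
End regular_path.

(** * Asymptotics of sums along a trajectory *)

Section expansion_along_path.
Context {R : realType}.
Local Notation s := (@s R).
Local Notation L := (@L R).
Implicit Types (Q e v z b f : nat -> R).

Lemma decay_sqrt f : (forall n, 0 <= f n) -> decay f ->
  decay (fun n => Num.sqrt (f n)).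
Proof.
move=> f0 [eta [eta0 hf]]; exists (eta * 2^-1); split.
  by rewrite mulr_gt0// invr_gt0.
have := @polyO_norm_powR _ _ 2^-1 _ _ hf; rewrite mulNr.
have h2 : (0 : R) <= 2^-1 by rewrite invr_ge0.
move=> /(_ h2); apply: bigO_le => n.
by rewrite (ger0_norm (f0 n)) powR12_sqrt.
Qed.

(** |y|^r is |y| times |y|^(r-1), and the second factor decays polynomially since r > 1. *)
Lemma wmild_powR_negl Q y r : (forall n, 1 <= Q n) -> 1 < r ->
  wmild Q y -> decay y -> negl Q (fun n => `|y n| `^ r).
Proof.
move=> Q1 r1 hw [eta [eta0 hd]].
have r0 : 0 < r - 1 by rewrite subr_gt0.
have hd' : decay (fun n => `|y n| `^ (r - 1)).
  exists (eta * (r - 1)); split; first exact: mulr_gt0.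
  by rewrite -mulNr; apply: polyO_norm_powR => //; exact: ltW.
have := wmild_decay Q1 hw hd'; apply: negl_le => n.
rewrite normrM (@ger0_norm _ (`|y n| `^ (r - 1))) ?powR_ge0//.
rewrite (@ger0_norm _ (`|y n| `^ r)) ?powR_ge0//.
have [->|y0] := eqVneq (y n) 0.
  by rewrite normr0 mul0r powR0// gt_eqF// (lt_trans ltr01).
rewrite -[X in _ <= X * _](powRr1 (normr_ge0 (y n))) -powRD.
  by rewrite addrC subrK.
by apply/implyP => _; rewrite normr_eq0.
Qed.

(** The first-order terms form a martingale, O(L^(1-g)) and hence o(log n) by Kronecker's lemma;
    replacing e^2 by its mean [sig] in the second-order terms costs a bounded martingale; the
    remainder is absolutely summable. What survives is [sig] times the sum of the second-order
    terms. *)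
Lemma expansion_sum (a g sig c : R) m e v z b f :
  (2 * m)%:R <= a -> 0 < g -> g <= 1 ->
  (forall n, 0 <= z n) -> (forall n, 0 <= f n) -> bounded_seq f ->
  (forall n, b n ^+ 2 <= f n * z n) ->
  (forall n, v n.+1 = z n + 2 * e n * b n + e n ^+ 2 * f n) ->
  bounded_seq (fun n => \sum_(k < n) b k * z k ^+ m.-1 / L k `^ (1 - g) * e k) ->
  bounded_seq (fun n => \sum_(k < n)
    second_order (z k) (b k) (f k) m * (e k ^+ 2 - sig)) ->
  abs_summable (fun k =>
    f k * Num.sqrt (f k) * (1 + z k) ^+ m * (1 + `|e k| `^ a)) ->
  asymp (fun n => \sum_(k < n) second_order (z k) (b k) (f k) m) c ->
  asymp (fun n => v n ^+ m - \sum_(k < n) (z k ^+ m - v k ^+ m)) (sig * c).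
Proof.
move=> ma g0 g1 z0 f0 [F hF] bfz rec hmart hso hR hc.
pose F1 := 1 + `|F|.
have [|C [C0 _ hC]] := @expansion_envelope R m a F1 ma; first by rewrite lerDl.
pose Rm k := v k.+1 ^+ m - expansion (z k) (b k) (f k) (e k) m.
have RmS : abs_summable Rm.
  apply: abs_summable_bigO hR _; exists C => n.
  rewrite /Rm rec (le_trans (hC _ _ _ _ (z0 n) _ (bfz n)))//.
    rewrite f0 (le_trans (ler_norm _))// (le_trans (hF n))//.
    by rewrite /F1 (le_trans (ler_norm F))// lerDr.
  by rewrite -mulrA ler_wpM2l// ler_norm.
have E n : v n ^+ m - \sum_(k < n) (z k ^+ m - v k ^+ m) =
    v 0%N ^+ m + (2 * m%:R) * (\sum_(k < n) b k * z k ^+ m.-1 * e k) +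
    (\sum_(k < n) second_order (z k) (b k) (f k) m * (e k ^+ 2 - sig) +
     (sig * \sum_(k < n) second_order (z k) (b k) (f k) m + \sum_(k < n) Rm k)).
  elim: n => [|n IH]; first by rewrite !big_ord0 !(mulr0, addr0) subr0.
  have -> : v n.+1 ^+ m - \sum_(k < n.+1) (z k ^+ m - v k ^+ m) =
      (v n ^+ m - \sum_(k < n) (z k ^+ m - v k ^+ m)) + (v n.+1 ^+ m - z n ^+ m).
    by rewrite big_ord_recr /=; ring.
  have -> : v n.+1 ^+ m = Rm n + expansion (z n) (b n) (f n) (e n) m by rewrite /Rm subrK.
  rewrite IH !big_ord_recr /= /expansion; ring.
have amart : asymp (fun n => \sum_(k < n) b k * z k ^+ m.-1 * e k) 0.
  apply: (asymp_L_powR g0 g1); case: hmart => D hD; exists (2 * D) => n.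
  apply: (psum_le_of_weighted (x := fun k => b k * z k ^+ m.-1 * e k)
    (w := fun k => L k `^ (1 - g))) => [k|i j ij|k].
  - by rewrite powR_gt0// L_gt0.
  - apply: ge0_ler_powR; rewrite ?subr_ge0// ?nnegrE ?(ltW (L_gt0 _))//.
    exact: L_nondecr.
  - rewrite (eq_bigr (fun k : 'I_ _ => b k * z k ^+ m.-1 / L k `^ (1 - g) * e k)).
      exact: hD.
    by move=> i _; rewrite mulrAC.
have -> : sig * c = (0 + (2 * m%:R) * 0) + (0 + (sig * c + 0)).
  by rewrite !(mulr0, addr0, add0r).
apply: (eq_asymp (fun n => esym (E n))).
apply: asympD.
  apply: asympD; last exact: asympZ.
  by apply: asymp_bounded; exists `|v 0%N ^+ m|.
apply: asympD; first exact: asymp_bounded.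
apply: asympD; first exact: asympZ.
exact/asymp_bounded/abs_summable_bounded.
Qed.

Lemma asymp_add_summable (x y : nat -> R) c :
  asymp (fun n => \sum_(k < n) x k) c -> abs_summable y ->
  asymp (fun n => \sum_(k < n) (x k + y k)) c.
Proof.
move=> hx hy; rewrite -[c]addr0.
apply: (@eq_asymp _ (fun n => \sum_(k < n) x k + \sum_(k < n) y k)).
  by move=> n; rewrite big_split.
by apply: asympD => //; exact/asymp_bounded/abs_summable_bounded.
Qed.

Lemma asymp_sum_close (x y : nat -> R) c :
  asymp (fun n => \sum_(k < n) x k) c -> abs_summable (fun k => y k - x k) ->
  asymp (fun n => \sum_(k < n) y k) c.
Proof.
move=> hx hy; have := asymp_add_summable hx hy; apply: eq_asymp => n.
by apply: eq_bigr => k _; rewrite addrC subrK.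
Qed.

End expansion_along_path.

Section stage_conclusion.
Context {R : realType}.
Local Notation s := (@s R).
Local Notation L := (@L R).
Variables (dd eta : R) (Q e f b x V f' b' x' V' h J : nat -> R).
Hypothesis rp : regular_path dd eta Q e f b x V f' b' x' V' h J.

Let Q1 := rp_Q1 rp.
Let Q0 n : 0 <= Q n. Proof. exact: le_trans ler01 (Q1 n). Qed.
Let QS := rp_QS rp.
Let f0 n : 0 <= f n. Proof. by have /andP[] := rp_f01 rp n. Qed.
Let x0 := rp_x0 rp.
Let xV := rp_xV rp.
Let V0 n : 0 <= V n. Proof. exact: le_trans (x0 n) (xV n). Qed.
Let f'0 := rp_f'0 rp.
Let f'decay : decay f'.
Proof. by exists eta; split; [exact: rp_eta rp|exact: rp_f'd rp]. Qed.

Lemma inv_s_step n :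
  (s n.+1)^-1 - (s n)^-1 = - ((s n)^-1 * (s n.+1)^-1) :> R.
Proof.
have : 0 < s n := s_gt0 n; rewrite sS; move: (s n) => A A0.
by field; rewrite (gt_eqF A0) gt_eqF// addr_gt0.
Qed.

(** The leverage is close to h/s, and h fluctuates around [dd] with partial sums [J] of smaller
    order than n, so summation by parts leaves [dd] times the harmonic sum. *)
Lemma leverage_asymp : asymp (fun n => \sum_(k < n) f k) dd.
Proof.
have JO := rp_J rp.
have h1 : abs_summable (fun k => f k - h k / s k).
  have [C hC] : negl Q (fun n => h n / s n - f n).
    by exists eta; split; [exact: rp_eta rp|exact: rp_hf rp].
  apply: (negl_summable Q1 QS); apply: (@negl_le _ _ (fun n => h n / s n - f n)).
    by move=> n; rewrite -normrN opprB.
  by exists C.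
apply: (@asymp_sum_close _ (fun k => h k / s k)) => //.
have e0 := rp_eta rp.
have hJ : bounded_seq (fun n => \sum_(k < n) (s k)^-1 * (J k.+1 - J k)).
  have -> : (fun n => \sum_(k < n) (s k)^-1 * (J k.+1 - J k)) =
      (fun n => (s n)^-1 * J n + - ((s 0)^-1 * J 0%N) +
        - \sum_(k < n) J k.+1 * ((s k.+1)^-1 - (s k)^-1)).
    by apply/funext => n; exact: (summation_by_parts (fun k => (s k)^-1) J n).
  have h2 : bounded_seq (fun n => (s n)^-1 * J n).
    have := polyOM (@polyO_powR R (-1)) JO.
    have -> : -1 + (1 - eta) = - eta by ring.
    move=> /(bigO_ge0 (fun n => powR_ge0 _ _))[C [C0 hC]]; exists C => n.
    have := hC n; rewrite powR_inv1 ?(ltW (s_gt0 n))// => /le_trans; apply.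
    rewrite ler_piMr// -[leRHS](powRr0 (s n)) s_powR_le// oppr_le0 ltW//.
  have h3 : bounded_seq (fun n => - \sum_(k < n) J k.+1 * ((s k.+1)^-1 - (s k)^-1)).
    have : abs_summable (fun k => J k.+1 * ((s k.+1)^-1 - (s k)^-1)).
      apply: (@polyO_summable _ (-1 - eta)); first by lra.
      have [C [C0 hC]] := bigO_ge0 (fun n => powR_ge0 _ _) JO.
      exists (C * 2) => n.
      have sn0 : 0 < s n := s_gt0 n; have sm0 : 0 < s n.+1 := s_gt0 n.+1.
      have -> : (s n.+1)^-1 - (s n)^-1 = - ((s n)^-1 * (s n.+1)^-1).
        exact: inv_s_step.
      rewrite normrM normrN; have -> : -1 - eta = (1 - eta) + (-1) + (-1) by ring.
      rewrite (s_powRD (1 - eta + -1) (-1)) (s_powRD (1 - eta) (-1)).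
      rewrite powR_inv1 ?(ltW sn0)//.
      rewrite (@ger0_norm _ ((s n)^-1 * _)) ?mulr_ge0 ?invr_ge0 ?(ltW sn0) ?(ltW sm0)//.
      have e1 : `|J n.+1| * (s n.+1)^-1 <= C * (s n `^ (1 - eta) * (s n)^-1).
        rewrite -!(powR_inv1 (ltW _))// -s_powRD.
        have -> : 1 - eta + -1 = - eta by ring.
        apply: (@le_trans _ _ (C * s n.+1 `^ (- eta))).
          have -> : - eta = (1 - eta) + -1 by ring.
          by rewrite s_powRD mulrA ler_wpM2r ?powR_ge0.
        rewrite ler_wpM2l// !powRN lef_pV2 ?posrE ?s_powR_gt0//.
        by apply: s_powR_nondecr; [exact: ltW|].
      have -> : `|J n.+1| * ((s n)^-1 * (s n.+1)^-1) = `|J n.+1| * (s n.+1)^-1 * (s n)^-1.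
        by rewrite mulrCA mulrC.
      apply: le_trans (ler_wpM2r _ e1) _; first by rewrite invr_ge0 ltW.
      have i0 : 0 <= (s n)^-1 by rewrite invr_ge0 ltW.
      move: (powR_ge0 (s n) (1 - eta)) i0; move: (s n `^ (1 - eta)) (s n)^-1 => A i A0 i0.
      have : 0 <= C * (A * i * i) by rewrite !mulr_ge0.
      by move=> ?; lra.
    move=> /abs_summable_bounded/(bounded_seqZ (-1)) [C hC]; exists C => n.
    by rewrite -mulN1r.
  have h4 : bounded_seq (fun n : nat => - ((s 0)^-1 * J 0%N)).
    by exists `|- ((s 0)^-1 * J 0%N)|.
  exact: bounded_seqD (bounded_seqD h2 h4) h3.
have -> : dd = dd * 1 + 0 by rewrite mulr1 addr0.
apply: (@eq_asymp _ (fun n => dd * (\sum_(k < n) (s k)^-1) +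
    \sum_(k < n) (s k)^-1 * (J k.+1 - J k))).
  move=> n; rewrite mulr_sumr -big_split; apply: eq_bigr => k _ /=.
  by rewrite (rp_JS rp); ring.
by apply: asympD; [apply: asympZ; exact: asymp_harmonic|exact: asymp_bounded].
Qed.

End stage_conclusion.

(** * From one power of the energy to the next *)

Section stage_step.
Context {R : realType}.
Local Notation s := (@s R).
Local Notation L := (@L R).
Variables (dd eta : R) (Q e f b x V f' b' x' V' h J : nat -> R).
Hypothesis rp : regular_path dd eta Q e f b x V f' b' x' V' h J.
Variables (a g r : R) (m : nat).
Hypothesis m0 : (0 < m)%N.
Hypothesis ma : (2 * m)%:R <= a.
Hypothesis r1 : 1 < r.
Hypothesis mV : mild V.

Let Q1 := rp_Q1 rp.
Let Q0 n : 0 <= Q n. Proof. exact: le_trans ler01 (Q1 n). Qed.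
Let QS := rp_QS rp.
Let f0 n : 0 <= f n. Proof. by have /andP[] := rp_f01 rp n. Qed.
Let f1 n : f n <= 1. Proof. by have /andP[] := rp_f01 rp n. Qed.
Let x0 := rp_x0 rp.
Let xV := rp_xV rp.
Let V0 n : 0 <= V n. Proof. exact: le_trans (x0 n) (xV n). Qed.
Let f'0 := rp_f'0 rp.
Let f'decay : decay f'.
Proof. by exists eta; split; [exact: rp_eta rp|exact: rp_f'd rp]. Qed.
Let mx : mild x.
Proof.
by apply: mild_bigO mV _ => //; exists 1 => n; rewrite mul1r ger0_norm.
Qed.
Let mV' := mild_V' rp mV.
Let mx' := mild_x' rp mV.
Let fdecay := rp_fdecay rp.
Let fwmild := rp_fwmild rp.
Let x'ge0 := x'0 rp.

(** The weight that summation by parts puts on the increments of V^m. In the model [J n.+1] involves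
    only the regressors up to time n, so this weight is known before the noise [e n] that it
    multiplies. *)
Definition drift n : R := J n.+1 / s n.+1.

Lemma drift_decay : decay drift.
Proof.
exists eta; split; first exact: rp_eta rp.
have [C [C0 hC]] := bigO_ge0 (fun n => powR_ge0 _ _) (rp_J rp).
exists C => n; have sm0 : 0 < s n.+1 := s_gt0 n.+1.
rewrite /drift normrM (@ger0_norm _ (s n.+1)^-1) ?invr_ge0 ?(ltW sm0)//.
apply: (@le_trans _ _ (C * s n.+1 `^ (- eta))).
  have -> : - eta = (1 - eta) + -1 by ring.
  by rewrite s_powRD powR_inv1 ?(ltW sm0)// mulrA ler_wpM2r ?invr_ge0 ?(ltW sm0).
rewrite ler_wpM2l// !powRN lef_pV2 ?posrE ?s_powR_gt0//.
by apply: s_powR_nondecr; [exact: ltW (rp_eta rp)|].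
Qed.

Section generic.
Variables (z b1 g1 : nat -> R).
Hypothesis z0 : forall n, 0 <= z n.
Hypothesis g0 : forall n, 0 <= g1 n.
Hypothesis bz : forall n, b1 n ^+ 2 <= g1 n * z n.
Hypothesis mz : mild z.
Hypothesis wg : wmild Q g1.
Hypothesis dg : decay g1.

Let so n := second_order (z n) (b1 n) (g1 n) m.

Let so_le n : `|so n| <= `|g1 n * ((2 * m ^ 2)%:R * z n ^+ m.-1)|.
Proof.
rewrite ger0_norm ?second_order_ge0// (le_trans _ (ler_norm _))//.
by rewrite mulrCA mulrA; exact: second_order_le.
Qed.

Let mzm : mild (fun n => (2 * m ^ 2)%:R * z n ^+ m.-1).
Proof. by apply: mildM; [exact: mild_cst|exact: mildX]. Qed.

Lemma second_order_powR_summable : abs_summable (fun n => `|so n| `^ r).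
Proof.
apply: (negl_summable Q1 QS); apply: wmild_powR_negl => //.
  exact: (wmild_le so_le (wmild_mild Q1 wg mzm)).
exact: (decay_le so_le (decay_mild dg mzm)).
Qed.

Lemma remainder_summable :
  abs_summable (fun n => g1 n * Num.sqrt (g1 n) * (1 + z n) ^+ m).
Proof.
apply: (negl_summable Q1 QS).
apply: negl_mild => //; last first.
  by apply: mildX; apply: mildD => //; exact: mild_cst.
by apply: wmild_decay => //; exact: decay_sqrt.
Qed.

(** First-order Taylor formula for powers: v - z is nearly of size Q/n and decays, so its square is
    negligible. Each induction step adds one error made of v - z and the difference of k-th
    powers. *)
Lemma power_drop_negl (v : nat -> R) k : mild v ->
  wmild Q (fun n => v n - z n) -> decay (fun n => v n - z n) ->
  negl Q (fun n => v n ^+ k - z n ^+ k - k%:R * ((v n - z n) * v n ^+ k.-1)).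
Proof.
move=> mv wD dD; elim: k => [|k IH].
  exists 1; split => //; exists 0 => n.
  by rewrite !expr0 subrr mul0r subrr normr0 mul0r.
have dz : decay (fun n => z n - v n).
  by apply: decay_le dD => n; rewrite -normrN opprB.
have := neglD Q1 (negl_mild Q1 IH mv) (wmild_decay Q1 wD (decayX_sub mv dz k)).
apply: negl_le => n; rewrite le_eqVlt; apply/orP; left; apply/eqP; congr (`|_|).
have -> : (v n ^+ k - z n ^+ k - k%:R * ((v n - z n) * v n ^+ k.-1)) * v n =
    (v n ^+ k - z n ^+ k) * v n - k%:R * ((v n - z n) * v n ^+ k).
  by case: k {IH} => [|k]; rewrite ?mul0r ?subr0//= [v n ^+ k.+1]exprS; ring.
by rewrite /= !exprS -natr1; ring.
Qed.

End generic.

Lemma drift_martingale_summable :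
  abs_summable (fun n => (drift n * (b n * x n ^+ m.-1)) ^+ 2).
Proof.
apply: (negl_summable Q1 QS).
have h1 : negl Q (fun n => f n * (drift n * drift n) * (x n * (x n ^+ m.-1) ^+ 2)).
  apply: negl_mild => //; last by apply: mildM => //; do 2!apply: mildX.
  by apply: wmild_decay => //; apply: decayM; exact: drift_decay.
apply: negl_le h1 => n; rewrite ger0_norm ?sqr_ge0// (le_trans _ (ler_norm _))//.
have -> : (drift n * (b n * x n ^+ m.-1)) ^+ 2 =
    drift n ^+ 2 * (b n ^+ 2 * (x n ^+ m.-1) ^+ 2) by ring.
have -> : f n * (drift n * drift n) * (x n * (x n ^+ m.-1) ^+ 2) =
    drift n ^+ 2 * (f n * x n * (x n ^+ m.-1) ^+ 2) by ring.
by rewrite ler_wpM2l ?sqr_ge0// ler_wpM2r ?sqr_ge0// (rp_bfx rp).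
Qed.

Lemma drift_remainder_summable :
  abs_summable (fun n => drift n * (f n * (1 + x n) ^+ m)).
Proof.
apply: (negl_summable Q1 QS).
have h1 : negl Q (fun n => f n * drift n * (1 + x n) ^+ m).
  apply: negl_mild => //; last by apply: mildX; apply: mildD => //; exact: mild_cst.
  by apply: wmild_decay => //; exact: drift_decay.
by apply: negl_le h1 => n; rewrite mulrCA mulrA.
Qed.

Section martingale_premises.
Hypothesis g0 : 0 < g.
Hypothesis g1 : g <= 1.
Hypothesis slopeS :
  abs_summable (fun n => b n ^+ 2 * V n ^+ (2 * m.-1) / L n `^ (1 - g) ^+ 2).

Lemma slope_martingale_summable :
  abs_summable (fun n => (b n * x n ^+ m.-1 / L n `^ (1 - g)) ^+ 2).
Proof.
apply: abs_summable_le slopeS _ => n.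
rewrite ger0_norm ?sqr_ge0// (le_trans _ (ler_norm _))//.
rewrite expr_div_n ler_wpM2r ?invr_ge0 ?sqr_ge0// exprMn ler_wpM2l ?sqr_ge0//.
by rewrite -exprM mulnC lerXn2r ?nnegrE.
Qed.

(** b'^2 is b^2 plus a negligible term and x' is at most a constant times V, so the summability
    known for the slopes carries over. *)
Lemma slope'_martingale_summable :
  abs_summable (fun n => (b' n * x' n ^+ m.-1 / L n `^ (1 - g)) ^+ 2).
Proof.
have [C [C0 hC]] := V'_le rp.
have h1 : negl Q (fun n => (b' n ^+ 2 - b n ^+ 2) * (x' n ^+ m.-1) ^+ 2).
  by apply: negl_mild => //; [exact: negl_slope' rp mV|do 2!apply: mildX].
have h1' := negl_summable Q1 QS h1.
have h2 := abs_summableZ (C ^+ (2 * m.-1)) slopeS.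
have h1a : abs_summable (fun n => `|(b' n ^+ 2 - b n ^+ 2) * (x' n ^+ m.-1) ^+ 2|).
  by apply: abs_summable_le h1' _ => n; rewrite normr_id.
apply: abs_summable_le (abs_summableD h1a h2) _ => n.
have La : 1 <= L n `^ (1 - g).
  rewrite -[leLHS](powRr0 (L n)); apply: ler_powR; first exact: L_ge1.
  by rewrite subr_ge0.
have La0 : 0 < L n `^ (1 - g) := lt_le_trans ltr01 La.
have La2 : 0 < L n `^ (1 - g) ^+ 2 by rewrite exprn_gt0.
rewrite ger0_norm ?sqr_ge0// (le_trans _ (ler_norm _))//.
rewrite expr_div_n exprMn -{1}[b' n ^+ 2](subrK (b n ^+ 2)) mulrDl mulrDl lerD//.
  rewrite ler_pdivrMr// (le_trans (ler_norm _))// ler_peMr//.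
  by rewrite exprn_ege1.
have hx : (x' n ^+ m.-1) ^+ 2 <= C ^+ (2 * m.-1) * V n ^+ (2 * m.-1).
  rewrite -exprMn -exprM mulnC lerXn2r ?nnegrE ?mulr_ge0//.
  exact: le_trans (x'_le rp n) (hC n).
rewrite [leRHS](_ : _ = b n ^+ 2 * (C ^+ (2 * m.-1) * V n ^+ (2 * m.-1)) /
    L n `^ (1 - g) ^+ 2); last by rewrite [b n ^+ 2 * (C ^+ _ * _)]mulrCA mulrA.
by rewrite ler_wpM2r ?invr_ge0 ?(ltW La2)// ler_wpM2l ?sqr_ge0.
Qed.

Variables (sig l0 : R).
Let env n := 1 + `|e n| `^ a.
Hypothesis sum_leverage : asymp (fun n => \sum_(k < n) f k * V k ^+ m.-1) (dd * l0).
Hypothesis sum_slope : (1 < m)%N ->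
  asymp (fun n => \sum_(k < n) b k ^+ 2 * V k ^+ m.-2) l0.
Hypothesis M1 : bounded_seq (fun n =>
  \sum_(k < n) b k * x k ^+ m.-1 / L k `^ (1 - g) * e k).
Hypothesis M1' : bounded_seq (fun n =>
  \sum_(k < n) b' k * x' k ^+ m.-1 / L k `^ (1 - g) * e k).
Hypothesis M2 : bounded_seq (fun n => \sum_(k < n)
    second_order (x k) (b k) (f k) m * (e k ^+ 2 - sig)).
Hypothesis M2' : bounded_seq (fun n => \sum_(k < n)
    second_order (x' k) (b' k) (f' k) m * (e k ^+ 2 - sig)).
Hypothesis M3 : abs_summable (fun k =>
  f k * Num.sqrt (f k) * (1 + x k) ^+ m * env k).
Hypothesis M3' : abs_summable (fun k =>
  f' k * Num.sqrt (f' k) * (1 + x' k) ^+ m * env k).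
Hypothesis M4 : bounded_seq (fun n =>
  \sum_(k < n) drift k * (b k * x k ^+ m.-1) * e k).
Hypothesis M5 : abs_summable (fun k => drift k * (f k * (1 + x k) ^+ m) * env k).

(** [c1] is the coefficient of log n in the sum of the second-order terms, from [sum_leverage] and
    [sum_slope]; dividing [sig * c1] by m, as the linear recursion does, gives the next limit
    [lm]. *)
Let c1 := m%:R * (dd * l0) + (2 * m * m.-1)%:R * l0.
Let lm := sig * (dd + 2 * m.-1%:R) * l0.

Let c1E : sig * c1 / m%:R = lm.
Proof.
have mn0 : m%:R != 0 :> R by rewrite pnatr_eq0 -lt0n.
by rewrite /c1 /lm !natrM; field.
Qed.

Let asymp_so : asymp (fun n => \sum_(k < n)
  (m%:R * (f k * V k ^+ m.-1) + (2 * m * m.-1)%:R * (b k ^+ 2 * V k ^+ m.-2))) c1.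
Proof.
apply: (@eq_asymp _ (fun n => m%:R * (\sum_(k < n) f k * V k ^+ m.-1) +
   (2 * m * m.-1)%:R * (\sum_(k < n) b k ^+ 2 * V k ^+ m.-2))).
  by move=> n; rewrite big_split !mulr_sumr.
apply: asympD; first exact: asympZ.
have [m1|m1] := ltnP 1 m; first by apply: asympZ; exact: sum_slope.
have -> : m.-1 = 0%N by case: m m0 m1 => [|[|k]].
rewrite muln0 mul0r; under [X in asymp X]eq_fun do rewrite mul0r.
by apply: asymp_bounded; exists 0 => n; rewrite normr0.
Qed.

Let negl_0 (y : nat -> R) : negl Q (fun n => y n - y n).
Proof. by exists 1; split => //; exists 0 => n; rewrite subrr normr0 mul0r. Qed.

Let power_energy : asymp (fun n => V n ^+ m - \sum_(k < n) (x k ^+ m - V k ^+ m))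
  (sig * c1).
Proof.
apply: (@expansion_sum _ a g sig c1 m e V x b f) => //.
- by exists 1 => n; rewrite ger0_norm.
- exact: rp_bfx rp.
- exact: rp_rec rp.
apply: (asymp_sum_close (y := fun k => second_order (x k) (b k) (f k) m) asymp_so).
apply: (negl_summable Q1 QS).
apply: (second_order_negl rp) => //.
exact: decay_xV rp mV.
Qed.

Let power_energy' : asymp (fun n => V' n ^+ m - \sum_(k < n) (x' k ^+ m - V' k ^+ m))
  (sig * c1).
Proof.
apply: (@expansion_sum _ a g sig c1 m e V' x' b' f') => //.
- have [eta1 [eta0 [C hC]]] := f'decay; exists `|C| => n.
  rewrite (le_trans (hC n))// (le_trans (ler_wpM2r (powR_ge0 _ _) (ler_norm C)))//.
  rewrite ler_piMr// -[leRHS](powRr0 (s n)) s_powR_le// oppr_le0 ltW//.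
- exact: rp_bfx' rp.
- exact: rp_rec' rp.
apply: (asymp_sum_close (y := fun k => second_order (x' k) (b' k) (f' k) m) asymp_so).
apply: (negl_summable Q1 QS).
apply: (second_order_negl rp) => //.
- exact: decay_x'V rp mV.
- exact: rp_ffnegl rp.
- exact: negl_slope' rp mV.
Qed.

(** The drop of V' is exactly V'/s(k+1), so the expansion of V'^m becomes a closed equation between
    V'^m and the sum of V'^m/s, to which [asymp_linear_recursion] applies. *)
Lemma stage_energy' : asymp (fun n => \sum_(k < n) V' k ^+ m / s k) lm /\
  asymp (fun n => V' n ^+ m) 0.
Proof.
rewrite -c1E.
have E k : V' k - x' k = V' k * (s k.+1)^-1.
  have sm0 : 0 < s k.+1 := s_gt0 k.+1.
  have Es : s k = s k.+1 - 1 by rewrite sS addrK.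
  rewrite (rp_x' rp) Es mulrBl divff ?gt_eqF// mul1r mulrBr mulr1.
  by rewrite opprB addrC subrK.
have inv_le k : (s k.+1)^-1 <= (s k)^-1.
  by rewrite lef_pV2 ?posrE ?s_gt0// s_nondecr.
have isge0 k : 0 <= (s k)^-1 by rewrite invr_ge0 (ltW (s_gt0 k)).
have le1 k : `|V' k - x' k| <= `|(s k)^-1 * V' k|.
  by rewrite E !normrM mulrC ler_wpM2r// !ger0_norm.
have wD : wmild Q (fun k => V' k - x' k).
  exact: (wmild_le le1 (wmild_mild Q1 (wmild_inv_s Q1) mV')).
have dD : decay (fun k => V' k - x' k).
  exact: (decay_le le1 (decay_mild (@decay_inv_s R) mV')).
have h1 := @power_drop_negl x' V' m mV' wD dD.
have h2 : negl Q (fun k => m%:R * ((V' k - x' k) * V' k ^+ m.-1) - m%:R * (V' k ^+ m / s k)).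
  have := neglZ m%:R (negl_mild Q1
    (wmild_decay Q1 (wmild_inv_s Q1) (@decay_inv_s R)) (mildX m mV')).
  apply: negl_le => k; rewrite E -mulrBr !normrM ler_wpM2l//.
  have -> : V' k * (s k.+1)^-1 * V' k ^+ m.-1 - V' k ^+ m / s k =
      - ((s k)^-1 * (s k.+1)^-1 * V' k ^+ m).
    have -> : V' k * (s k.+1)^-1 * V' k ^+ m.-1 = V' k ^+ m * (s k.+1)^-1.
      by rewrite mulrAC -exprS prednK.
    by rewrite -mulrBr inv_s_step; ring.
  rewrite normrN normrM ler_wpM2r// !ger0_norm ?mulr_ge0// ler_wpM2l//.
have h3 := negl_summable Q1 QS (neglD Q1 h1 h2).
have sumE n : V' n ^+ m + m%:R * (\sum_(k < n) V' k ^+ m / s k) =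
    (V' n ^+ m - \sum_(k < n) (x' k ^+ m - V' k ^+ m)) +
    (- 1) * \sum_(k < n) ((V' k ^+ m - x' k ^+ m - m%:R * ((V' k - x' k) * V' k ^+ m.-1))
     + (m%:R * ((V' k - x' k) * V' k ^+ m.-1) - m%:R * (V' k ^+ m / s k))).
  elim: n => [|n IH]; first by rewrite !big_ord0 !mulr0 addr0 subr0 addr0.
  rewrite !big_ord_recr /= mulrDr.
  have -> : V' n.+1 ^+ m + (m%:R * (\sum_(k < n) V' k ^+ m / s k) + m%:R * (V' n ^+ m / s n)) =
      V' n ^+ m + m%:R * (\sum_(k < n) V' k ^+ m / s k) +
      (V' n.+1 ^+ m - V' n ^+ m + m%:R * (V' n ^+ m / s n)) by ring.
  by rewrite IH; ring.
have aE : asymp (fun n => (V' n ^+ m - \sum_(k < n) (x' k ^+ m - V' k ^+ m)) +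
    (- 1) * \sum_(k < n) ((V' k ^+ m - x' k ^+ m - m%:R * ((V' k - x' k) * V' k ^+ m.-1))
     + (m%:R * ((V' k - x' k) * V' k ^+ m.-1) - m%:R * (V' k ^+ m / s k)))) (sig * c1).
  have -> : sig * c1 = sig * c1 + (- 1) * 0 by rewrite mulr0 addr0.
  apply: asympD; first exact: power_energy'.
  by apply: asympZ; apply: asymp_bounded; exact: (abs_summable_bounded h3).
by apply: (asymp_linear_recursion (y := fun n => V' n ^+ m) _ aE sumE); rewrite ler1n.
Qed.

Let wD : wmild Q (fun k => V k - x k).
Proof.
have := wmild_mild Q1 fwmild (mildM (mild_cst 2) mV).
apply: wmild_le => n; rewrite ger0_norm ?subr_ge0// (le_trans (drop_le rp n))//.
by rewrite mulrCA ler_norm.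
Qed.

Let dD : decay (fun k => V k - x k).
Proof. by apply: decay_le (decay_xV rp mV) => n; rewrite -normrN opprB. Qed.

(** V^m is o(log n) because V'^m is and their difference is bounded. The expansion of V^m then gives
    the sum of the drops of V^m, and a drop is m b^2 V^(m-1) up to a negligible term since b^2 = (1
    - f)(V - x). *)
Lemma stage_slope : asymp (fun n => \sum_(k < n) b k ^+ 2 * V k ^+ m.-1) lm.
Proof.
have [_ V'0_] := stage_energy'.
have aV : asymp (fun n => V n ^+ m) 0.
  have dV : decay (fun n => V' n ^+ m - V n ^+ m).
    exact: decayX_sub mV (decay_V'V rp mV) m.
  have bd : bounded_seq (fun n => V' n ^+ m - V n ^+ m).
    have [eta1 [eta0 [C hC]]] := dV; exists `|C| => n.
    rewrite (le_trans (hC n))// (le_trans (ler_wpM2r (powR_ge0 _ _) (ler_norm C)))//.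
    rewrite ler_piMr// -[leRHS](powRr0 (s n)) s_powR_le// oppr_le0 ltW//.
  have := asympD V'0_ (asympZ (- 1) (asymp_bounded bd)).
  rewrite mulr0 addr0; apply: eq_asymp => n; ring.
have a1 : asymp (fun n => \sum_(k < n) (V k ^+ m - x k ^+ m)) (sig * c1).
  have := asympD power_energy (asympZ (- 1) aV); rewrite mulr0 addr0.
  apply: eq_asymp => n; rewrite addrAC mulN1r subrr add0r -sumrN.
  by apply: eq_bigr => k _; rewrite opprB.
have a2 : asymp (fun n => \sum_(k < n) m%:R * (b k ^+ 2 * V k ^+ m.-1)) (sig * c1).
  apply: (asymp_sum_close (x := fun k => V k ^+ m - x k ^+ m)
    (y := fun k => m%:R * (b k ^+ 2 * V k ^+ m.-1)) a1); apply: (negl_summable Q1 QS).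
  have h1 := @power_drop_negl x V m mV wD dD.
  have h2 : negl Q (fun k => m%:R * (f k * (V k - x k) * V k ^+ m.-1)).
    apply: neglZ; apply: negl_mild => //; last exact: mildX.
    exact: wmild_decay.
  have := neglN (neglD Q1 h1 h2); apply: negl_le => k.
  rewrite le_eqVlt; apply/orP; left; apply/eqP; congr (`|_|).
  rewrite (rp_b rp); ring.
have := asympZ (m%:R^-1) a2; rewrite -c1E [m%:R^-1 * _]mulrC.
apply: eq_asymp => n; rewrite -mulr_sumr mulrA mulVf ?mul1r//.
by rewrite pnatr_eq0 -lt0n.
Qed.

(** The known sum has weights 1/s. Passing to f brings in the fluctuations of h; summation by parts
    moves the difference onto V^m/s, whose increments contain the noise. They are expanded once
    more, each piece carrying the decaying weight [drift]. *)
Lemma stage_leverage : asymp (fun n => \sum_(k < n) f k * V k ^+ m) (dd * lm).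
Proof.
have [aV' _] := stage_energy'.
have aV : asymp (fun n => \sum_(k < n) V k ^+ m / s k) lm.
  apply: (asymp_sum_close (x := fun k => V' k ^+ m / s k)
    (y := fun k => V k ^+ m / s k) aV'); apply: (negl_summable Q1 QS).
  have := wmild_decay Q1 (wmild_inv_s Q1) (decayX_sub mV (decay_V'V rp mV) m).
  by apply: negl_le => k; rewrite -mulrBl mulrC -normrN -mulrN opprB.
have hh : negl Q (fun k => h k / s k - f k).
  by exists eta; split; [exact: rp_eta rp|exact: rp_hf rp].
apply: (asymp_sum_close (x := fun k => h k / s k * V k ^+ m)
  (y := fun k => f k * V k ^+ m)); last first.
  apply: (negl_summable Q1 QS).
  have := negl_mild Q1 hh (mildX m mV); apply: negl_le => k.
  by rewrite -mulrBl -[leLHS]normrN -mulNr opprB.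
pose c k := V k ^+ m / s k.
have Vm0 k : 0 <= V k ^+ m by rewrite exprn_ge0.
have main : bounded_seq (fun n => \sum_(k < n) c k * (J k.+1 - J k)).
  have -> : (fun n => \sum_(k < n) c k * (J k.+1 - J k)) = (fun n =>
      c n * J n + - (c 0%N * J 0%N) + (- 1) * \sum_(k < n) J k.+1 * (c k.+1 - c k)).
    by apply/funext => n; rewrite summation_by_parts mulN1r.
  apply: bounded_seqD.
    apply: bounded_seqD; last by exists `|- (c 0%N * J 0%N)|.
    have : decay (fun n => ((s n)^-1 * J n) * V n ^+ m).
      apply: decay_mild; last exact: mildX.
      exists eta; split; first exact: rp_eta rp.
      have := polyOM (@polyO_powR R (-1)) (rp_J rp).
      have -> : -1 + (1 - eta) = - eta by ring.
      by apply: bigO_le => n; rewrite powR_inv1 ?(ltW (s_gt0 n)).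
    move=> [eta1 [eta0 [C hC]]]; exists `|C| => n.
    rewrite /c mulrC mulrA mulrAC [J n / _]mulrC.
    rewrite (le_trans (hC n))// (le_trans (ler_wpM2r (powR_ge0 _ _) (ler_norm C)))//.
    rewrite ler_piMr// -[leRHS](powRr0 (s n)) s_powR_le// oppr_le0 ltW//.
  apply: bounded_seqZ.
  have E k : J k.+1 * (c k.+1 - c k) = drift k * (V k.+1 ^+ m - V k ^+ m) +
      (- 1) * ((s k)^-1 * drift k * V k ^+ m).
    rewrite /c /drift.
    have -> : J k.+1 * (V k.+1 ^+ m / s k.+1 - V k ^+ m / s k) =
        J k.+1 / s k.+1 * (V k.+1 ^+ m - V k ^+ m) +
        J k.+1 * V k ^+ m * ((s k.+1)^-1 - (s k)^-1) by ring.
    by rewrite inv_s_step; ring.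
  have [|C [C0 _ hC]] := @expansion_envelope R m a 1 ma; first by [].
  pose Rm k := V k.+1 ^+ m - expansion (x k) (b k) (f k) (e k) m.
  (* With the extra decay of [drift], the second-order part is summable in absolute value along with
     the remainder, both dominated through [M5]; only the first-order part is treated as a
     martingale. *)
  pose rest k := e k ^+ 2 * second_order (x k) (b k) (f k) m + Rm k.
  have restS : abs_summable (fun k => drift k * rest k).
    apply: abs_summable_bigO M5 _; exists ((2 * m ^ 2)%:R + C) => k.
    have env1 : 1 <= env k by rewrite lerDl powR_ge0.
    have x1m : 1 <= (1 + x k) ^+ m by rewrite exprn_ege1// lerDl.
    have y0 : 0 <= f k * (1 + x k) ^+ m by rewrite mulr_ge0// (le_trans ler01 x1m).
    rewrite [leLHS]normrM.
    rewrite [leRHS](_ : _ = `|drift k| * (((2 * m ^ 2)%:R + C) *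
      (`|f k| * `|(1 + x k) ^+ m| * `|env k|))); last first.
      rewrite [`|drift k * _ * _|]normrM [`|drift k * _|]normrM [`|f k * _|]normrM.
      by move: `|drift k| `|env k| `|f k| => *; ring.
    rewrite ler_wpM2l//.
    have env0 : 0 <= env k := le_trans ler01 env1.
    rewrite (ger0_norm env0) (ger0_norm (f0 k)) (ger0_norm (le_trans ler01 x1m)).
    have so_le : second_order (x k) (b k) (f k) m <=
        (2 * m ^ 2)%:R * (f k * (1 + x k) ^+ m).
      apply: le_trans (second_order_le _ (x0 k) (f0 k) (rp_bfx rp k)) _.
      rewrite -mulrA ler_wpM2l// ler_wpM2l//.
      apply: (@le_trans _ _ ((1 + x k) ^+ m.-1)).
        by rewrite lerXn2r ?nnegrE ?addr_ge0// lerDr.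
      by apply: ler_weXn2l; [rewrite lerDl|exact: leq_pred].
    have e2_le : e k ^+ 2 <= env k.
      rewrite -real_normK ?num_real// -powR_mulrn//; apply: powR_le1D => //.
      rewrite ler0n /= (le_trans _ ma)// ler_nat; exact: leq_pmulr.
    have h1 : `|e k ^+ 2 * second_order (x k) (b k) (f k) m| <=
        (2 * m ^ 2)%:R * (f k * (1 + x k) ^+ m * env k).
      have so0 := second_order_ge0 (b k) m (x0 k) (f0 k).
      rewrite (ger0_norm (mulr_ge0 (sqr_ge0 _) so0)) mulrA mulrC.
      by apply: ler_pM => //; exact: sqr_ge0.
    have h2 : `|Rm k| <= C * (f k * (1 + x k) ^+ m * env k).
      rewrite /Rm (rp_rec rp); have fk1 : 0 <= f k <= 1 by rewrite f0 f1.
      apply: le_trans (hC _ _ _ (e k) (x0 k) fk1 (rp_bfx rp k)) _.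
      rewrite -mulrA ler_wpM2l// ler_wpM2r// ler_wpM2r ?(le_trans ler01 x1m)//.
      by rewrite ler_piMr// -(sqrtr1 R) ler_sqrt.
    rewrite mulrDl; exact: le_trans (ler_normD _ _) (lerD h1 h2).
  have dropS : abs_summable (fun k => drift k * (V k ^+ m - x k ^+ m)).
    apply: (negl_summable Q1 QS).
    have w1 : wmild Q (fun k => V k ^+ m - x k ^+ m).
      have := wmild_mild Q1 wD (mildX m.-1 mV) => w2 e1 e10.
      have h1 := @power_drop_negl x V m mV wD dD.
      have := bigOD (negl_is_wmild rp h1 e10) (bigOZ m%:R (w2 e1 e10)).
      by apply: bigO_le => k; rewrite subrK.
    have := wmild_decay Q1 w1 drift_decay.
    by apply: negl_le => k; rewrite mulrC.
  have smallS : abs_summable (fun k => (s k)^-1 * drift k * V k ^+ m).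
    apply: (negl_summable Q1 QS).
    have h9 := wmild_decay Q1 (wmild_inv_s Q1) drift_decay.
    exact (negl_mild Q1 h9 (mildX m mV)).
  have sumE n : \sum_(k < n) J k.+1 * (c k.+1 - c k) =
      (2 * m%:R) * (\sum_(k < n) drift k * (b k * x k ^+ m.-1) * e k) +
      (\sum_(k < n) drift k * rest k + ((- 1) * (\sum_(k < n) drift k * (V k ^+ m - x k ^+ m)) +
       (- 1) * \sum_(k < n) (s k)^-1 * drift k * V k ^+ m)).
    elim: n => [|n IH]; first by rewrite !big_ord0 !(mulr0, addr0).
    rewrite !big_ord_recr /= IH E /rest /Rm /expansion; ring.
  have -> : (fun n => \sum_(k < n) J k.+1 * (c k.+1 - c k)) = (fun n =>
      (2 * m%:R) * (\sum_(k < n) drift k * (b k * x k ^+ m.-1) * e k) +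
      (\sum_(k < n) drift k * rest k + ((- 1) * (\sum_(k < n) drift k * (V k ^+ m - x k ^+ m)) +
       (- 1) * \sum_(k < n) (s k)^-1 * drift k * V k ^+ m))).
    by apply/funext => n; exact: sumE.
  apply: bounded_seqD; first exact: bounded_seqZ.
  apply: bounded_seqD; first exact: (abs_summable_bounded restS).
  apply: bounded_seqD; apply: bounded_seqZ.
    exact: (abs_summable_bounded dropS).
  exact: (abs_summable_bounded smallS).
rewrite -[dd * lm]addr0.
apply: (@eq_asymp _ (fun n => dd * (\sum_(k < n) V k ^+ m / s k) +
    \sum_(k < n) c k * (J k.+1 - J k))).
  move=> n; rewrite mulr_sumr -big_split; apply: eq_bigr => k _ /=.
  by rewrite (rp_JS rp) /c; ring.
by apply: asympD; [exact: asympZ|exact: asymp_bounded].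
Qed.

End martingale_premises.
End stage_step.

(** * Regularity of autoregressive trajectories *)

Section regularity.
Context {R : realType} {d : nat}.
Local Notation s := (@s R).
Local Notation L := (@L R).
Variables (theta : 'cV[R]_d.+1) (sigma : R) (S : 'M[R]_d.+1).
Let C := companion theta.
Hypothesis C_decaying : decaying C.
Hypothesis S_posdef : sym_posdef S.
Hypothesis sigma_neq0 : sigma != 0.
Let Lc := limit_cov C sigma.
Let Li := invmx Lc.
Variables (Phi : nat -> 'cV[R]_d.+1) (e : nat -> R).
Hypothesis Phi_S : forall n, Phi n.+1 = C *m Phi n + e n *: delta_mx 0 0.
Variables (b del : R).
Hypothesis del0 : 0 < del.
Hypothesis del1 : del <= 1.
Hypothesis b0 : 0 <= b.
Hypothesis bdel : b *+ 2 + del <= 1.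
Hypothesis e_growth : polyO b e.
Hypothesis cross_rate :
  forall i, polyO (1 - del) (fun n => \sum_(k < n) Phi k i 0 * e k).
Hypothesis square_rate :
  polyO (1 - del) (fun n => \sum_(k < n) (e k ^+ 2 - sigma ^+ 2)).

Let Nn := score S theta Phi e.
Let Q n := 1 + nrm (Phi n) ^+ 2.

Let sn0 n : 0 < s n := s_gt0 n.
Let isn0 n : 0 < (s n)^-1. Proof. by rewrite invr_gt0. Qed.
Let isnle n : (s n.+1)^-1 <= (s n)^-1.
Proof. by rewrite lef_pV2 ?posrE// s_nondecr. Qed.

Lemma s_powR_pred n (t : R) : s n `^ (-1 - t) = (s n)^-1 * s n `^ (- t).
Proof. by rewrite s_powRD powR_inv1// ltW. Qed.

Lemma s_powR_noninc n (t : R) : 0 <= t -> s n.+1 `^ (- t) <= s n `^ (- t).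
Proof.
move=> t0; rewrite !powRN lef_pV2 ?posrE ?s_powR_gt0//.
exact: s_powR_nondecr.
Qed.

Let pL := limit_cov_posdef C_decaying sigma_neq0.
Let Li_sym : Li^T = Li.
Proof. by have [] := posdef_inv pL. Qed.

Let Phi_growth : polyO b (fun n => nrm (Phi n)).
Proof. exact (regressor_growth C_decaying Phi_S b0 e_growth). Qed.

Let hG : polyO (- del) (fun n => nrm ((s n)^-1 *: gramS S Phi n - Lc)).
Proof.
exact (gram_rate S C_decaying Phi_S del0 del1 b0 bdel Phi_growth cross_rate square_rate).
Qed.

Let gram_le : exists K, 0 <= K /\ forall n, nrm (gramS S Phi n) <= K * s n.
Proof.
have [K [K0 hK]] := bigO_ge0 (fun n => powR_ge0 _ _) hG.
exists (K + nrm Lc); split; first by rewrite addr_ge0 ?nrm_ge0.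
move=> n; rewrite -ler_pdivrMr// mulrC.
have -> : (s n)^-1 * nrm (gramS S Phi n) = nrm ((s n)^-1 *: gramS S Phi n).
  by rewrite nrmZ ger0_norm// ltW.
rewrite -[(s n)^-1 *: _](subrK Lc) (le_trans (nrmD _ _))// lerD2r.
have := hK n; rewrite ger0_norm ?nrm_ge0// => /le_trans -> //.
rewrite ler_piMr// -[leRHS](powRr0 (s n)) s_powR_le// oppr_le0; exact: ltW.
Qed.

Let gain_le : exists K, 0 <= K /\ forall n, nrm (gain S Phi n) <= K * (s n)^-1.
Proof.
have [h _] := gain_rate C_decaying S_posdef sigma_neq0 del0 hG.
have [K [K0 hK]] := bigO_ge0 (fun n => powR_ge0 _ _) h.
exists K; split => // n; have := hK n; rewrite powRr0 mulr1 ger0_norm ?nrm_ge0//.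
by rewrite nrmZ (ger0_norm (ltW (sn0 n))) mulrC ler_pdivlMr.
Qed.

Let gain_close : exists K, 0 <= K /\
  forall n, nrm ((s n)^-1 *: Li - gain S Phi n) <= K * ((s n)^-1 * s n `^ (- del)).
Proof.
have [_ h] := gain_rate C_decaying S_posdef sigma_neq0 del0 hG.
have [K [K0 hK]] := bigO_ge0 (fun n => powR_ge0 _ _) h.
exists K; split => // n; have := hK n; rewrite ger0_norm ?nrm_ge0//.
have -> : s n *: gain S Phi n - Li = (- s n) *: ((s n)^-1 *: Li - gain S Phi n).
  by rewrite scalerBr scalerA mulNr divff ?gt_eqF// !scaleNr scale1r opprK addrC.
rewrite nrmZ normrN (ger0_norm (ltW (sn0 n))) => hh.
by rewrite mulrCA -ler_pdivrMl ?invrK// mulrC.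
Qed.

Let Q1 n : 1 <= Q n. Proof. by rewrite lerDl sqr_ge0. Qed.
Let Phi2Q n : nrm (Phi n) ^+ 2 <= Q n. Proof. by rewrite lerDr. Qed.

(** The squares of coordinate i of the regressors add up to a diagonal entry of the Gram matrix
    minus [S], and that matrix is O(n). *)
Let Q_sum : exists K, forall n, \sum_(k < n.+1) Q k <= K * s n.
Proof.
have [K [K0 hK]] := gram_le.
pose D : R := d.+1%:R * (2 * K + nrm S).
exists (1 + d.+1%:R * D) => n; rewrite big_split /= sumr_const card_ord.
rewrite mulrDl mul1r lerD2l.
apply: (@le_trans _ _ (\sum_(k < n.+1) d.+1%:R * \sum_i Phi k i 0 ^+ 2)).
  by apply: ler_sum => k _; exact: nrm_sqr_le.
rewrite -mulr_sumr -mulrA ler_wpM2l// exchange_big /=.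
have hi (i : 'I_d.+1) : \sum_(k < n.+1) Phi k i 0 ^+ 2 <= (2 * K + nrm S) * s n.
  have -> : \sum_(k < n.+1) Phi k i 0 ^+ 2 = (gramS S Phi n.+1 - S) i i.
    rewrite /gramS addrK summxE; apply: eq_bigr => k _.
    by rewrite !mxE big_ord1 !mxE.
  rewrite (le_trans (ler_norm _))// (le_trans (entry_le_nrm _ _ _))//.
  rewrite (le_trans (nrmB _ _))// mulrDl lerD//.
    by rewrite (le_trans (hK _))// [2 * K]mulrC -mulrA ler_wpM2l// s_double.
  by rewrite ler_peMr ?nrm_ge0// s_ge1.
apply: le_trans (ler_sum _ (fun i _ => hi i)) _.
by rewrite sumr_const card_ord /D -[leRHS]mulrA [leRHS]mulr_natl.
Qed.

Let leverage_le : exists K, 0 <= K /\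
  forall n, leverage S Phi n <= K * ((s n)^-1 * nrm (Phi n) ^+ 2).
Proof.
have [K [K0 hK]] := gain_le; exists K; split => // n.
rewrite (le_trans (ler_norm _))// (le_trans (quad_form_le_nrm _ _))// [leRHS]mulrA.
by rewrite ler_wpM2r ?sqr_ge0// (le_trans (hK _))// ler_wpM2l.
Qed.

Let score_sqr_le : exists K, 0 <= K /\
  forall n, nrm (Nn n) ^+ 2 <= K * (s n * energy S theta Phi e n).
Proof.
have [K [K0 hK]] := gram_le; exists (d.+1%:R ^+ 2 * K); split.
  by rewrite mulr_ge0 ?exprn_ge0.
move=> n; rewrite (le_trans (score_le _ S_posdef _ _ _))// mulrA.
rewrite ler_wpM2r ?energy_ge0// -mulrA ler_wpM2l ?exprn_ge0//.
Qed.

Lemma autoregressive_regular_path :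
  regular_path d.+1%:R del Q e (leverage S Phi) (slope S theta Phi e)
    (energy_after S theta Phi e) (energy S theta Phi e)
    (fun n => quad_form Li (Phi n) / s n.+1)
    (fun n => bil_form Li (Phi n) (Nn n) / s n.+1)
    (fun n => quad_form Li (Nn n) / s n.+1)
    (fun n => quad_form Li (Nn n) / s n)
    (fun n => quad_form Li (Phi n))
    (fun n => \sum_(k < n) (quad_form Li (Phi k) - d.+1%:R)).
Proof.
have pLi : sym_posdef Li := posdef_inv pL.
have hQ0 n : 0 <= Q n := le_trans ler01 (Q1 n).
have [Kf [Kf0 hKf]] := leverage_le.
have [Kc [Kc0 hKc]] := gain_close.
have [Ks [Ks0 hKs]] := score_sqr_le.
have [Kg [Kg0 hKg]] := gain_le.
have V0 n : 0 <= energy S theta Phi e n := energy_ge0 theta S_posdef Phi e n.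
have [Kp [Kp0 hKp]] := bigO_ge0 (fun n => powR_ge0 _ _) Phi_growth.
have ipd n : 0 <= s n `^ (- del) by exact: powR_ge0.
have Phi2 n : (s n)^-1 * nrm (Phi n) ^+ 2 <= Kp ^+ 2 * s n `^ (- del).
  have h1 : nrm (Phi n) ^+ 2 <= Kp ^+ 2 * s n `^ (b *+ 2).
    have -> : s n `^ (b *+ 2) = s n `^ b ^+ 2 by rewrite mulr2n s_powRD expr2.
    rewrite -exprMn lerXn2r ?nnegrE ?nrm_ge0 ?mulr_ge0 ?powR_ge0//.
    by have := hKp n; rewrite ger0_norm ?nrm_ge0.
  rewrite (le_trans (ler_wpM2l (ltW (isn0 n)) h1))// mulrCA ler_wpM2l ?sqr_ge0//.
  rewrite -powR_inv1 ?(ltW (sn0 n))// -s_powRD s_powR_le//.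
  by move: bdel; rewrite mulr2n; lra.
have ff n : `|quad_form Li (Phi n) / s n.+1 - leverage S Phi n| <=
    Kc * ((s n)^-1 * s n `^ (- del) * nrm (Phi n) ^+ 2).
  have -> : quad_form Li (Phi n) / s n.+1 - leverage S Phi n =
      quad_form ((s n.+1)^-1 *: Li - gain S Phi n.+1) (Phi n).
    by rewrite quad_formB quad_formZ mulrC.
  rewrite (le_trans (quad_form_le_nrm _ _))// [leRHS]mulrA ler_wpM2r ?sqr_ge0//.
  rewrite (le_trans (hKc _))// ler_wpM2l//.
  by apply: ler_pM; rewrite ?(ltW (isn0 _))// s_powR_noninc// ltW.
split.
- exact: del0.
- exact: Q1.
- exact: Q_sum.
- by move=> n; rewrite leverage_ge0//= ltW// leverage_lt1.
- exists Kf => n; rewrite ger0_norm ?leverage_ge0// (le_trans (hKf n))//.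
  by rewrite powR_inv1 ?(ltW (sn0 n))// ler_wpM2l// mulrC ler_wpM2r ?(ltW (isn0 n)).
- exists (Kf * Kp ^+ 2) => n; rewrite ger0_norm ?leverage_ge0// (le_trans (hKf n))//.
  by rewrite -mulrA ler_wpM2l.
- by move=> n; exact: energy_after_ge0.
- by move=> n; exact: energy_after_le.
- by move=> n; exact: slope_sqr.
- by move=> n; exact: slope_sqr_le.
- by move=> n; exact: energy_S.
- by move=> n; rewrite divr_ge0 ?(ltW (sn0 _))// quad_form_ge0.
- by move=> n; rewrite divr_ge0 ?(ltW (sn0 _))// quad_form_ge0.
- by move=> n; rewrite mulrA mulfVK// gt_eqF.
- move=> n; rewrite expr_div_n.
  have -> : quad_form Li (Phi n) / s n.+1 * (quad_form Li (Nn n) / s n.+1) =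
      quad_form Li (Phi n) * quad_form Li (Nn n) / s n.+1 ^+ 2.
    by rewrite mulrACA -invfM -expr2.
  by rewrite ler_wpM2r ?invr_ge0 ?sqr_ge0// bil_form_CS.
- move=> n; rewrite /Nn score_S quad_formD//; by ring.
- exists (Kc * Ks) => n.
  have -> : quad_form Li (Nn n) / s n - energy S theta Phi e n =
      quad_form ((s n)^-1 *: Li - gain S Phi n) (Nn n).
    by rewrite quad_formB quad_formZ mulrC.
  rewrite (le_trans (quad_form_le_nrm _ _))//.
  apply: (@le_trans _ _ (Kc * ((s n)^-1 * s n `^ (- del)) *
      (Ks * (s n * energy S theta Phi e n)))).
    by apply: ler_pM; rewrite ?nrm_ge0 ?sqr_ge0.
  rewrite le_eqVlt; apply/orP; left; apply/eqP.
  have := gt_eqF (sn0 n); move: (s n `^ (- del)) (energy _ _ _ _ n) (s n) => u v t t0.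
  by field; rewrite t0.
- exists (Kf * Kp ^+ 2 + Kc * Kp ^+ 2) => n.
  have h1 : quad_form Li (Phi n) / s n.+1 <= leverage S Phi n +
      Kc * ((s n)^-1 * s n `^ (- del) * nrm (Phi n) ^+ 2).
    by rewrite -lerBlDl (le_trans (ler_norm _))// ff.
  rewrite ger0_norm ?divr_ge0 ?(ltW (sn0 _)) ?quad_form_ge0// (le_trans h1)//.
  rewrite mulrDl lerD//.
    by rewrite (le_trans (hKf n))// -mulrA ler_wpM2l.
  rewrite -[leRHS]mulrA ler_wpM2l// [leLHS]mulrAC.
  rewrite (le_trans (ler_wpM2r (ipd n) (Phi2 n)))//.
  rewrite -[leLHS]mulrA ler_wpM2l ?sqr_ge0// ler_piMr//.
  rewrite -[leRHS](powRr0 (s n)) s_powR_le// oppr_le0; exact: ltW.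
- exists Kc => n; rewrite (le_trans (ff n))// ler_wpM2l// s_powR_pred.
  by rewrite mulrC ler_wpM2r// mulr_ge0// ltW.
- pose D := nrm Li + Kg.
  have D0 : 0 <= D by rewrite addr_ge0 ?nrm_ge0.
  exists (Kc * D * Ks) => n; rewrite s_powR_pred.
  set bn := slope _ _ _ _ n; set b' := _ / _.
  (* The first factor carries the rate of the gain, the second its size 1/s; the squared norm of the
     score is at most a multiple of s times the energy, which cancels one power of s. *)
  have -> : b' ^+ 2 - bn ^+ 2 = (b' - bn) * (b' + bn) by ring.
  have h1 : `|b' - bn| <= Kc * ((s n)^-1 * s n `^ (- del)) * (nrm (Phi n) * nrm (Nn n)).
    have -> : b' - bn = bil_form ((s n.+1)^-1 *: Li - gain S Phi n.+1) (Phi n) (Nn n).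
      by rewrite bil_formB bil_formZ mulrC.
    rewrite (le_trans (bil_form_le_nrm _ _ _))// ler_wpM2r ?mulr_ge0 ?nrm_ge0//.
    rewrite (le_trans (hKc _))// ler_wpM2l//.
    by apply: ler_pM; rewrite ?(ltW (isn0 _))// s_powR_noninc// ltW.
  have h2 : `|b' + bn| <= D * (s n)^-1 * (nrm (Phi n) * nrm (Nn n)).
    rewrite (le_trans (ler_normD _ _))// /D !mulrDl lerD//.
      rewrite normrM (@ger0_norm _ (s n.+1)^-1) ?(ltW (isn0 _))//.
      rewrite [leRHS]mulrAC; apply: ler_pM => //; first exact: ltW.
      exact: bil_form_le_nrm.
    rewrite (le_trans (bil_form_le_nrm _ _ _))// ler_wpM2r ?mulr_ge0 ?nrm_ge0//.
    by rewrite (le_trans (hKg _))// ler_wpM2l.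
  rewrite normrM.
  apply: (@le_trans _ _ (Kc * ((s n)^-1 * s n `^ (- del)) * (nrm (Phi n) * nrm (Nn n)) *
     (D * (s n)^-1 * (nrm (Phi n) * nrm (Nn n))))).
    by apply: ler_pM.
  have -> : Kc * ((s n)^-1 * s n `^ (- del)) * (nrm (Phi n) * nrm (Nn n)) *
     (D * (s n)^-1 * (nrm (Phi n) * nrm (Nn n))) =
     (Kc * D * ((s n)^-1 * s n `^ (- del)) * (s n)^-1) * (nrm (Phi n) ^+ 2 * nrm (Nn n) ^+ 2).
    by ring.
  have -> : Kc * D * Ks * (Q n * ((s n)^-1 * s n `^ (- del)) * energy S theta Phi e n) =
     (Kc * D * ((s n)^-1 * s n `^ (- del)) * (s n)^-1) *
     (Q n * (Ks * (s n * energy S theta Phi e n))).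
    have := gt_eqF (sn0 n); move: (s n `^ (- del)) (energy _ _ _ _ n) (s n) => u v t t0.
    by field; rewrite t0.
  rewrite ler_wpM2l//; last by apply: ler_pM; rewrite ?sqr_ge0.
  by rewrite !mulr_ge0// ltW.
- exists (nrm Li + Kc) => n; rewrite s_powR_pred.
  have -> : quad_form Li (Phi n) / s n - leverage S Phi n =
     quad_form Li (Phi n) * ((s n)^-1 * (s n.+1)^-1) +
     (quad_form Li (Phi n) / s n.+1 - leverage S Phi n).
    have t0 := gt_eqF (sn0 n); have t1 := gt_eqF (sn0 n.+1).
    by move: t0 t1; rewrite sS; move: (s n) => u t0 t1; field; rewrite t0 t1.
  rewrite (le_trans (ler_normD _ _))// mulrDl lerD//; last first.
    rewrite (le_trans (ff n))// ler_wpM2l//.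
    by rewrite mulrC ler_wpM2r// mulr_ge0// ltW.
  rewrite normrM (le_trans (ler_wpM2r _ (quad_form_le_nrm _ _)))//.
  rewrite -mulrA ler_wpM2l ?nrm_ge0// ger0_norm ?mulr_ge0 ?(ltW (isn0 _))//.
  apply: ler_pM; rewrite ?sqr_ge0 ?mulr_ge0 ?(ltW (isn0 _))//.
  apply: ler_pM; rewrite ?(ltW (isn0 _))// (le_trans (isnle n))//.
  by rewrite -powR_inv1 ?(ltW (sn0 n))// s_powR_le// lerN2.
(* The mean of h is identified by traces: the trace of L^(-1) L is the dimension, and the
   fluctuation is s times a trace that is small by the convergence rate of the Gram matrix. *)
- have E n : \sum_(k < n) (quad_form Li (Phi k) - d.+1%:R) =
      s n * \tr (Li *m ((s n)^-1 *: gramS S Phi n - Lc)) + (\tr (Li *m Lc) - \tr (Li *m S)).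
    have h k : quad_form Li (Phi k) = \tr (Li *m (Phi k *m (Phi k)^T)).
      by rewrite mulmxA mxtrace_mulC /quad_form mulmxA /mxtrace big_ord1.
    rewrite sumrB sumr_const card_ord.
    have -> : \sum_(k < n) quad_form Li (Phi k) = \tr (Li *m (gramS S Phi n - S)).
      rewrite /gramS addrK mulmx_sumr raddf_sum; apply: eq_bigr => k _; exact: h.
    have -> : \tr (Li *m Lc) = d.+1%:R by rewrite mulVmx ?posdef_unit// mxtrace1.
    rewrite mulmxBr raddfB /= mulmxBr raddfB /= -scalemxAr mxtraceZ.
    rewrite mulVmx ?posdef_unit// mxtrace1 mulrBr mulrA divff ?gt_eqF// mul1r.
    by rewrite -mulr_natl /s -natr1; ring.
  have hs : polyO (1 - del) (fun n => s n * nrm ((s n)^-1 *: gramS S Phi n - Lc)).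
    have hs1 : polyO 1 s.
      by have := @polyO_powR R 1; apply: bigO_le => n; rewrite powRr1 ?(ltW (sn0 n)).
    exact: polyOM hs1 hG.
  have trle (M : 'M[R]_d.+1) : `|\tr M| <= nrm M.
    rewrite (le_trans (ler_norm_sum _ _ _))// /nrm; apply: ler_sum => i _.
    by rewrite (bigD1 i)//= lerDl sumr_ge0.
  have h1 : polyO (1 - del) (fun n => s n * \tr (Li *m ((s n)^-1 *: gramS S Phi n - Lc))).
    apply: bigO_le (bigOZ (nrm Li) hs) => n; rewrite !normrM mulrCA.
    rewrite ler_wpM2l// (le_trans (trle _))// (le_trans (nrmM _ _))//.
    by rewrite !(ger0_norm (nrm_ge0 _)).
  have h2 : polyO (1 - del) (fun=> \tr (Li *m Lc) - \tr (Li *m S)).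
    by apply: polyO_le (@polyO_cst R _); rewrite subr_ge0.
  by have := bigOD h1 h2; apply: bigO_le => n; rewrite E.
- by move=> n; rewrite big_ord_recr.
Qed.

(** With B the gain, B L B - L^(-1)/s^2 is expressed through L^(-1)/s - B, so s times the quadratic
    form of the estimation error inherits the rate of the gain and can be replaced by the limiting
    energy. *)
Lemma estimation_error_close :
  bigO (fun n => s n `^ (- del) * energy S theta Phi e n)
    (fun n => s n * quad_form Lc (gain S Phi n *m Nn n) - quad_form Li (Nn n) / s n).
Proof.
have [Kc [Kc0 hKc]] := gain_close.
have [Ks [Ks0 hKs]] := score_sqr_le.
have [Kg [Kg0 hKg]] := gain_le.
pose D := nrm Lc * Kg + 1 * nrm (Li *m Lc).
have D0 : 0 <= D by rewrite addr_ge0 ?mulr_ge0 ?nrm_ge0.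
have uL := posdef_unit pL.
exists (Kc * D * Ks) => n; set B := gain S Phi n.
have BT : B^T = B := gain_sym S_posdef Phi n.
pose M := B *m Lc *m B - (s n ^- 2) *: Li.
have -> : s n * quad_form Lc (B *m Nn n) - quad_form Li (Nn n) / s n =
    s n * quad_form M (Nn n).
  have -> : quad_form Lc (B *m Nn n) = quad_form (B *m Lc *m B) (Nn n).
    by rewrite /quad_form trmx_mul BT !mulmxA.
  rewrite quad_formB quad_formZ mulrBr; congr (_ - _).
  have t0 := gt_eqF (sn0 n); move: (quad_form _ _) (s n) t0 => u t t0.
  by field; rewrite t0.
have ME : M = - (((s n)^-1 *: Li - B) *m Lc *m B + (s n)^-1 *: (Li *m Lc *m ((s n)^-1 *: Li - B))).
  rewrite !mulmxBl !mulmxBr -!scalemxAl -!scalemxAr.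
  rewrite (mulVmx uL) !mul1mx scalerBr scalerA -invfM -expr2.
  by rewrite opprD !opprB addrA subrK.
have nM : nrm M <= Kc * D * (s n ^- 2 * s n `^ (- del)).
  rewrite ME nrmN (le_trans (nrmD _ _))//.
  have h1 : nrm (((s n)^-1 *: Li - B) *m Lc *m B) <=
      Kc * ((s n)^-1 * s n `^ (- del)) * nrm Lc * (Kg * (s n)^-1).
    apply: le_trans (nrmM3 _ _ _) _.
    apply: ler_pM; [by rewrite mulr_ge0 ?nrm_ge0|exact: nrm_ge0| |exact: hKg].
    by apply: ler_pM; [exact: nrm_ge0|exact: nrm_ge0|exact: hKc|exact: lexx].
  have h2 : nrm ((s n)^-1 *: (Li *m Lc *m ((s n)^-1 *: Li - B))) <=
      (s n)^-1 * (nrm (Li *m Lc) * (Kc * ((s n)^-1 * s n `^ (- del)))).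
    rewrite nrmZ (ger0_norm (ltW (isn0 n))) ler_wpM2l ?(ltW (isn0 n))//.
    by apply: le_trans (nrmM _ _) _; rewrite ler_wpM2l ?nrm_ge0//; exact: hKc.
  rewrite (le_trans (lerD h1 h2))// le_eqVlt; apply/orP; left; apply/eqP.
  rewrite /D -exprVn; ring.
rewrite normrM (ger0_norm (ltW (sn0 n))).
rewrite (le_trans (ler_wpM2l (ltW (sn0 n)) (quad_form_le_nrm _ _)))//.
apply: (@le_trans _ _ (s n * (Kc * D * (s n ^- 2 * s n `^ (- del)) *
    (Ks * (s n * energy S theta Phi e n))))).
  rewrite ler_wpM2l ?(ltW (sn0 n))//; apply: ler_pM; rewrite ?nrm_ge0 ?sqr_ge0//.
rewrite le_eqVlt; apply/orP; left; apply/eqP.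
have := gt_eqF (sn0 n); move: (s n `^ (- del)) (energy _ _ _ _ n) (s n) => u v t t0.
by field; rewrite t0.
Qed.

End regularity.

Section recursive_form.
Context {disp : measure_display} {T : measurableType disp} {R : realType} {d : nat}.
Variables (F : nat -> set (set T)) (theta : 'cV[R]_d.+1).
Variables (eps : nat -> T -> R) (X : int -> T -> R) (S : 'M[R]_d.+1).
Hypothesis X_ar : autoregressive F theta eps X.
Hypothesis S_posdef : sym_posdef S.
Variable w : T.
Let Phi n : 'cV[R]_d.+1 := regressor X n w.
Let e n := eps n.+1 w.

Lemma regressor_step n : Phi n.+1 = companion theta *m Phi n + e n *: delta_mx 0 0.
Proof.
have [_ hX] := X_ar; apply/matrixP => i j; rewrite (ord1 j) !mxE.
under eq_bigr do rewrite !mxE.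
have [i0|i0] := eqVneq (i : nat) 0%N.
  have -> : i = ord0 by apply: val_inj.
  by rewrite subr0 hX eqxx !mulr1.
have iE : i == ord0 = false by apply/negbTE; rewrite -val_eqE.
rewrite iE /= mulr0 addr0.
have ip : (i.-1 < d.+1)%N by rewrite (leq_ltn_trans (leq_pred _))//.
rewrite (bigD1 (Ordinal ip))//= big1 ?addr0 => [|k kn]; last first.
  have -> : (i == k.+1 :> nat) = false; last by rewrite mul0r.
  apply/negbTE; apply: contra kn => /eqP ik; apply/eqP/val_inj.
  by rewrite /= ik.
rewrite prednK ?lt0n// eqxx mul1r; congr (X _ w).
by move: i0; clear; case: i => -[|m] h //= _; lia.
Qed.

Lemma response n : X n.+1%:Z w = (theta^T *m Phi n) 0 0 + e n.
Proof.
have [_ ->] := X_ar; congr (_ + _); rewrite mxE.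
by apply: eq_bigr => k _; rewrite !mxE.
Qed.

Lemma gram_gramS n : gram S X n w = gramS S Phi n.+1.
Proof. by rewrite /gram big_mkord. Qed.

Lemma lse_error n : lse S X n w - theta = gain S Phi n *m score S theta Phi e n.
Proof.
have uA k : gramS S Phi k \in unitmx := posdef_unit (gramS_posdef S_posdef Phi k).
case: n => [|n].
  (* At n = 0 the estimator is 0 by convention and the score is -S theta, so the formula holds there
     too. *)
  rewrite /lse /gain /score /gramS !big_ord0 !add0r mulmxN mulmxA mulVmx ?mul1mx//.
  exact: posdef_unit.
have -> : lse S X n.+1 w = gain S Phi n.+1 *m (\sum_(k < n.+1) X k.+1%:Z w *: Phi k).
  rewrite /lse gram_gramS; congr (_ *m _).
  by rewrite big_add1 /= big_mkord.
have -> : \sum_(k < n.+1) X k.+1%:Z w *: Phi k =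
    gramS S Phi n.+1 *m theta + score S theta Phi e n.+1.
  rewrite /gramS mulmxDl /score addrACA subrr addr0 mulmx_suml -big_split /=.
  apply: eq_bigr => k _; rewrite response scalerDl; congr (_ + _).
  have -> : theta^T *m Phi k = (Phi k)^T *m theta.
    by rewrite [LHS]mx11_scalar [RHS]mx11_scalar; congr (_%:M);
       rewrite !mxE; apply: eq_bigr => i _; rewrite !mxE mulrC.
  rewrite -mulmxA; set t := (Phi k)^T *m theta.
  by rewrite [t in RHS]mx11_scalar mul_mx_scalar.
by rewrite mulmxDr mulmxA mulVmx// mul1mx addrC addKr.
Qed.

Lemma prediction_residual n :
  X n.+1%:Z w - ((lse S X n w)^T *m Phi n) 0 0 =
  e n - pred_error S theta Phi e n.
Proof.
rewrite response -[lse S X n w](subrK theta) lse_error [(_ + theta)^T]linearD /=.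
have e11 (A B : 'M[R]_1) : (A + B) 0 0 = A 0 0 + B 0 0 by rewrite mxE.
rewrite mulmxDl e11; set t := (theta^T *m _) 0 0; set u := (_ *m _) 0 0.
have -> : t + e n - (u + t) = e n - u by ring.
congr (_ - _); rewrite /u.
rewrite trmx_mul gain_sym//.
by rewrite /pred_error (bil_form_sym (Phi n) _ (gain_sym S_posdef _ _)).
Qed.

End recursive_form.

(** * Induction on the moments *)

Section stages.
Context {disp : measure_display} {T : measurableType disp} {R : realType}.
Variable P : probability T R.
Variable F : nat -> set (set T).
Hypothesis F_filtration : filtration F.
Variable eps : nat -> T -> R.
Hypothesis eps_md : martingale_difference P F eps.
Variable a : R.
Hypothesis a2 : 2 < a.
Hypothesis eps_moment : exists M : nat -> T -> \bar R,
  (forall n : nat,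
    is_cond_expectation P (F n) (fun w => (`|eps n.+1 w| `^ a)%:E) (M n)) /\
  {ae P, forall w, (ereal_sup (range (fun n : nat => M n w)) < +oo)%E}.
Variable sig : R.
Hypothesis eps_var : forall n : nat,
  is_cond_expectation P (F n) (fun w => (eps n.+1 w ^+ 2)%:E) (cst sig%:E).
Local Notation s := (@s R).
Local Notation L := (@L R).
Local Notation adapted := (fun Y : nat -> T -> R => forall n, measurable_wrt (F n) (Y n)).
Let e n w := eps n.+1 w.
Variables (dd eta : R) (Q f b x V f' b' x' V' h J : nat -> T -> R).
Hypothesis rp : {ae P, forall w, regular_path dd eta (Q ^~ w) (e ^~ w)
  (f ^~ w) (b ^~ w) (x ^~ w) (V ^~ w) (f' ^~ w) (b' ^~ w) (x' ^~ w) (V' ^~ w)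
  (h ^~ w) (J ^~ w)}.
Hypothesis f_adapted : adapted f.
Hypothesis b_adapted : adapted b.
Hypothesis x_adapted : adapted x.
Hypothesis V_adapted : adapted V.
Hypothesis f'_adapted : adapted f'.
Hypothesis b'_adapted : adapted b'.
Hypothesis x'_adapted : adapted x'.
Hypothesis J_predictable : forall n, measurable_wrt (F n) (J n.+1).
Hypothesis f01 : forall n w, 0 <= f n w <= 1.
Hypothesis x_ge0 : forall n w, 0 <= x n w.
Hypothesis xV : forall n w, x n w <= V n w.
Hypothesis bfx : forall n w, b n w ^+ 2 <= f n w * x n w.
Hypothesis V_rec : forall n w,
  V n.+1 w = x n w + 2 * e n w * b n w + e n w ^+ 2 * f n w.

Let V_ge0 n w : 0 <= V n w := le_trans (x_ge0 n w) (xV n w).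
Let f0 n w : 0 <= f n w. Proof. by have /andP[] := f01 n w. Qed.
Let a0 : 0 <= a. Proof. by rewrite (le_trans _ (ltW a2)). Qed.
Let env n w := 1 + `|e n w| `^ a.

Lemma measurable_wrt_second_order (m n : nat) (z c g : nat -> T -> R) :
  adapted z -> adapted c -> adapted g ->
  measurable_wrt (F n) (fun w => second_order (z n w) (c n w) (g n w) m).
Proof.
move=> mz mc mg; apply: measurable_funD; apply: measurable_funM.
- by apply: measurable_funM; [exact: measurable_cst|exact: mg].
- by apply: measurable_funX; exact: mz.
- apply: measurable_funM; first exact: measurable_cst.
  by apply: measurable_funX; exact: mc.
- by apply: measurable_funX; exact: mz.
Qed.

Lemma measurable_wrt_sqrt (G : set (set T)) (Y : T -> R) :
  measurable_wrt G Y -> measurable_wrt G (fun w => Num.sqrt (Y w)).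
Proof.
move=> mY; apply: measurableT_comp mY; apply: continuous_measurable_fun.
exact: sqrt_continuous.
Qed.

Lemma measurable_wrt_remainder (m n : nat) (z g : nat -> T -> R) :
  adapted z -> adapted g ->
  measurable_wrt (F n) (fun w => g n w * Num.sqrt (g n w) * (1 + z n w) ^+ m).
Proof.
move=> mz mg; apply: measurable_funM.
  by apply: measurable_funM; [exact: mg|apply: measurable_wrt_sqrt; exact: mg].
apply: measurable_funX; apply: measurable_funD; first exact: measurable_cst.
exact: mz.
Qed.

Lemma envelope_sqr_le n w : e n w ^+ 2 <= env n w.
Proof.
rewrite -real_normK ?num_real// -powR_mulrn//; apply: powR_le1D => //.
by rewrite ler0n ltW.
Qed.

Variable p : nat.
Hypothesis p0 : (0 < p)%N.
Hypothesis pa : (2 * p)%:R <= a.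

(** Small enough that (1+g)(2 - 1/m) <= 2 - 2g for all 1 <= m <= p, the condition of
    [slope_power_summable]: it amounts to 4 g <= (1+g)/m. *)
Let g : R := (4 * p%:R)^-1.
Let pR : (0 : R) < p%:R. Proof. by rewrite ltr0n. Qed.
Let g0 : 0 < g. Proof. by rewrite invr_gt0 mulr_gt0. Qed.
Let g1 : g <= 1.
Proof.
rewrite invf_le1 ?mulr_gt0//; have : (1 : R) <= p%:R by rewrite ler1n.
by lra.
Qed.

(** An exponent above 1, because a > 2, for which e^2 still has conditional moments of order [r]. *)
Let r : R := Num.min 2 (a / 2).
Let r1 : 1 < r. Proof. by rewrite lt_min ltr1n /= ltr_pdivlMr// mul1r. Qed.
Let r2 : r <= 2. Proof. by rewrite ge_min lexx. Qed.
Let ra : (2 * 1)%:R * r <= a.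
Proof.
rewrite muln1; apply: (@le_trans _ _ (2 * (a / 2))).
  by rewrite ler_wpM2l// ge_min lexx orbT.
by rewrite mulrCA divff// mulr1.
Qed.

Let LP t n : 0 < L n `^ t. Proof. by rewrite powR_gt0// L_gt0. Qed.
Let iLP t n : 0 <= (L n `^ t)^-1. Proof. by rewrite invr_ge0 ltW. Qed.

(* At level [m = 1] no a priori bound on [V] is available, but none is needed,
   because the expansion of [V] is then exact. *)
Lemma power_energy_bounded m : (0 < m)%N -> (m <= p)%N ->
  {ae P, forall w, bigO L (fun n => \sum_(k < n) f k w * V k w ^+ m.-1)} ->
  ((1 < m)%N -> {ae P, forall w, mild (V ^~ w)}) ->
  {ae P, forall w, bounded_seq (fun n => V n w ^+ m / L n `^ (1 + g)) /\
    abs_summable (fun n => (V n w ^+ m - x n w ^+ m) / L n `^ (1 + g))}.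
Proof.
move=> m0 mp lev mildV.
have ma : (2 * m)%:R <= a.
  by rewrite (le_trans _ pa)// ler_nat leq_mul2l mp orbT.
have [C [C0 Cm hC]] := @expansion_envelope R m a 1 ma (lexx 1).
pose drop k w := (V k w ^+ m - x k w ^+ m) / L k `^ (1 + g).
have drop0 k w : 0 <= drop k w.
  by rewrite divr_ge0 ?(ltW (LP _ _))// subr_ge0 lerXn2r ?nnegrE.
(* Keeping the normalized drops inside the process yields, from one boundedness statement, both the
   growth of V^m and the summability of the drops. *)
pose Y n w := V n w ^+ m / L n `^ (1 + g) + \sum_(k < n) drop k w.
pose u n w := 2 * m%:R * (b n w * x n w ^+ m.-1) / L n `^ (1 + g).
pose so n w := second_order (x n w) (b n w) (f n w) m.
pose rem n w := f n w * Num.sqrt (f n w) * (1 + x n w) ^+ m.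
pose v n w := (so n w + C * rem n w) / L n `^ (1 + g).
have so0 n w : 0 <= so n w by exact: second_order_ge0.
have rem0 n w : 0 <= rem n w.
  by rewrite !mulr_ge0 ?sqrtr_ge0// exprn_ge0// addr_ge0.
have v0 n w : 0 <= v n w by rewrite mulr_ge0// addr_ge0// mulr_ge0.
have mVm n : measurable_wrt (F n) (fun w => V n w ^+ m / L n `^ (1 + g)).
  apply: measurable_funM; last exact: measurable_cst.
  by apply: measurable_funX; exact: V_adapted.
have mdrop n : measurable_wrt (F n) (drop n).
  apply: measurable_funM; last exact: measurable_cst.
  by apply: measurable_funB; apply: measurable_funX; [exact: V_adapted|exact: x_adapted].
have Ystep n w : Y n.+1 w <= Y n w + u n w * e n w + v n w * env n w.
  have h1 : V n.+1 w ^+ m <= x n w ^+ m + 2 * m%:R * (b n w * x n w ^+ m.-1) * e n w +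
      (so n w + C * rem n w) * env n w.
    have := le_trans (ler_norm _) (hC _ _ _ (e n w) (x_ge0 n w) (f01 n w) (bfx n w)).
    rewrite -V_rec /expansion -/(rem n w) -/(env n w) -/(so n w) lerBlDr => h1.
    have h2 : e n w ^+ 2 * so n w <= so n w * env n w.
      by rewrite mulrC ler_wpM2l// envelope_sqr_le.
    apply: le_trans h1 _; rewrite [(so n w + _) * _]mulrDl.
    have -> : 2 * m%:R * e n w * b n w * x n w ^+ m.-1 =
      2 * m%:R * (b n w * x n w ^+ m.-1) * e n w by ring.
    move: (2 * m%:R * _ * e n w) (C * rem n w * env n w) h2.
    by move: (so n w * env n w) (e n w ^+ 2 * so n w) (x n w ^+ m) => *; lra.
  have h2 : V n.+1 w ^+ m / L n.+1 `^ (1 + g) <= V n.+1 w ^+ m / L n `^ (1 + g).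
    rewrite ler_wpM2l ?exprn_ge0// lef_pV2 ?posrE ?LP//.
    apply: ge0_ler_powR; rewrite ?nnegrE ?(ltW (L_gt0 _))//.
      by rewrite addr_ge0// ltW.
    exact: L_nondecr.
  have h3 := le_trans h2 (ler_wpM2r (iLP (1 + g) n) h1).
  rewrite /Y big_ord_recr /= /drop /u /v.
  have -> : V n w ^+ m / L n `^ (1 + g) +
      \sum_(k < n) (V k w ^+ m - x k w ^+ m) / L k `^ (1 + g) +
      2 * m%:R * (b n w * x n w ^+ m.-1) / L n `^ (1 + g) * e n w +
      (so n w + C * rem n w) / L n `^ (1 + g) * env n w =
      \sum_(k < n) (V k w ^+ m - x k w ^+ m) / L k `^ (1 + g) +
      (V n w ^+ m - x n w ^+ m) / L n `^ (1 + g) +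
      (x n w ^+ m + 2 * m%:R * (b n w * x n w ^+ m.-1) * e n w +
      (so n w + C * rem n w) * env n w) / L n `^ (1 + g) by ring.
  by rewrite [leLHS]addrC lerD2l.
have Ybnd : {ae P, forall w, abs_summable (v ^~ w) -> bounded_seq (Y ^~ w)}.
  apply: (noise_supermartingale_bounded F_filtration eps_md eps_moment
    (zeta := e) (u := u)) => //.
  - move=> n; have [_ _ ce] := eps_md n.
    have [h1 h2] := centred_cond_expectation F_filtration ce.
    have E : (fun w => eps n.+1 w - 0) = e n by apply/funext => w; rewrite subr0.
    by split; rewrite -E.
  - move=> n; apply: measurable_funD; first exact: mVm.
    apply: measurable_sum => k; apply: (measurable_wrt_mono F_filtration _ (mdrop k)).
    exact: ltnW.
  - move=> n; apply: measurable_funM; last exact: measurable_cst.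
    apply: measurable_funM; first exact: measurable_cst.
    apply: measurable_funM; first exact: b_adapted.
    by apply: measurable_funX; exact: x_adapted.
  - move=> n; apply: measurable_funM; last exact: measurable_cst.
    apply: measurable_funD; first exact: measurable_wrt_second_order.
    apply: measurable_funM; first exact: measurable_cst.
    exact: measurable_wrt_remainder.
  - by move=> n w; rewrite addr_ge0 ?sumr_ge0// mulr_ge0 ?exprn_ge0.
(* The second-order part is at most a multiple of f V^(m-1), whose partial sums are O(L), so
   division by L^(1+g) makes it summable. The remainder is summable when V is mild, and its
   coefficient [C] is zero at m = 1. *)
have vS : {ae P, forall w, abs_summable (v ^~ w)}.
  have mild_rem : {ae P, forall w, (1 < m)%N -> mild (V ^~ w)}.
    have [m1|m1] := ltnP 1 m; last by apply: aeW.
    by apply: filterS (mildV m1).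
  move: lev mild_rem rp; apply: filterS3 => w levw mildw rpw.
  have h1 : abs_summable (fun n => f n w * V n w ^+ m.-1 * L n `^ (- (1 + g))).
    apply: (summable_of_psum_le g0 (@L_gt0 R)); last first.
      by exists 1; split => // n; exact: L_ge1.
    have [K [K0 hK]] := bigO_ge0 (fun n => ltW (L_gt0 n)) levw.
    exists (K * 2) => n; rewrite -mulrA.
    under eq_bigr do rewrite ger0_norm ?mulr_ge0 ?exprn_ge0//.
    rewrite (le_trans (ler_norm _))// (le_trans (hK _))// ler_wpM2l//.
    exact: L_double.
  have h2 : abs_summable (fun n => C * rem n w).
    have [m1|m1] := ltnP 1 m; last first.
      by exists 0 => n; rewrite big1// => k _; rewrite Cm// mul0r normr0.
    have mV := mildw m1; apply: abs_summableZ.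
    have mx : mild (x ^~ w).
      apply: mild_bigO mV _ => //; exists 1 => n.
      by rewrite mul1r ger0_norm.
    exact (remainder_summable rpw m (f0 ^~ w) mx (rp_fwmild rpw) (rp_fdecay rpw)).
  have h3 := abs_summableD (abs_summableZ (2 * m ^ 2)%:R h1) h2.
  apply: abs_summable_le h3 _ => n; rewrite (ger0_norm (v0 n w)) (le_trans _ (ler_norm _))//.
  rewrite /v mulrDl lerD//.
    rewrite powRN mulrA ler_wpM2r// (le_trans (second_order_le _ _ _ _))//.
    by rewrite -mulrA ler_wpM2l// ler_wpM2l// lerXn2r ?nnegrE.
  rewrite ler_piMr ?(mulr_ge0 C0 (rem0 n w))// invf_le1 ?LP//.
  rewrite -[leLHS](powRr0 (L n)); apply: ler_powR; first exact: L_ge1.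
  by rewrite addr_ge0// ltW.
move: Ybnd vS; apply: filterS2 => w Yw vw; have [K hK] := Yw vw.
have Y1 n : V n w ^+ m / L n `^ (1 + g) + \sum_(k < n) drop k w <= K.
  exact: le_trans (ler_norm _) (hK n).
split; exists K => n.
  rewrite ger0_norm ?mulr_ge0 ?exprn_ge0// (le_trans _ (Y1 n))// lerDl.
  exact: sumr_ge0.
under eq_bigr do rewrite (ger0_norm (drop0 _ _)).
by rewrite (le_trans _ (Y1 n))// lerDr mulr_ge0 ?exprn_ge0.
Qed.

Lemma aeI (A B : T -> Prop) : {ae P, forall w, A w} -> {ae P, forall w, B w} ->
  {ae P, forall w, A w /\ B w}.
Proof. by apply: filterS2. Qed.

Definition stage_limit m : R := \prod_(j < m) (sig * (dd + 2 * j%:R)).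

Lemma stage_limitS m :
  stage_limit m.+1 = sig * (dd + 2 * m%:R) * stage_limit m.
Proof. by rewrite /stage_limit big_ord_recr /= mulrC. Qed.

Lemma measurable_wrt_scaled_slope (k : nat -> R) m n (z c : nat -> T -> R) :
  adapted z -> adapted c ->
  measurable_wrt (F n) (fun w => c n w * z n w ^+ m / k n).
Proof.
move=> mz mc; apply: measurable_funM; last exact: measurable_cst.
by apply: measurable_funM; [exact: mc|apply: measurable_funX; exact: mz].
Qed.

(** The sums of f V^m and b^2 V^(m-1) are carried together because they are the two parts of the
    second-order term at order m+1; the sum for V' is the output wanted at m = p. *)
Theorem stage m : (m <= p)%N -> {ae P, forall w,
  [/\ (0 < m)%N -> mild (V ^~ w),
      asymp (fun n => \sum_(k < n) f k w * V k w ^+ m) (dd * stage_limit m),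
      (0 < m)%N ->
        asymp (fun n => \sum_(k < n) b k w ^+ 2 * V k w ^+ m.-1) (stage_limit m) &
      (0 < m)%N ->
        asymp (fun n => \sum_(k < n) V' k w ^+ m / s k) (stage_limit m)]}.
Proof.
elim: m => [|m IH] mp.
  apply: filterS rp => w rpw; split => //.
  rewrite /stage_limit big_ord0 mulr1; have := leverage_asymp rpw.
  by apply: eq_asymp => n; apply: eq_bigr => k _; rewrite expr0 mulr1.
have {}IH := IH (ltnW mp).
have ma : (2 * m.+1)%:R <= a.
  by rewrite (le_trans _ pa)// ler_nat leq_mul2l mp orbT.
have PB : {ae P, forall w, bounded_seq (fun n => V n w ^+ m.+1 / L n `^ (1 + g)) /\
    abs_summable (fun n => (V n w ^+ m.+1 - x n w ^+ m.+1) / L n `^ (1 + g))}.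
  apply: power_energy_bounded => //.
    by apply: filterS IH => w [_ h1 _ _]; exact: asymp_bigO_L h1.
  by move=> m1; apply: filterS IH => w [h1 _ _ _]; exact: h1.
have gm : (1 + g) * (2 - m.+1%:R^-1) <= 2 - 2 * g.
  have mR : (0 : R) < m.+1%:R by rewrite ltr0n.
  have h1 : 4 * g <= m.+1%:R^-1.
    rewrite /g invfM mulrA divff ?mul1r ?pnatr_eq0// lef_pV2 ?posrE//.
    by rewrite ler_nat.
  have h2 : 0 <= g * m.+1%:R^-1 by rewrite mulr_ge0 ?invr_ge0// ltW.
  by move: (m.+1%:R^-1) h1 h2 => t; lra.
have base : {ae P, forall w, mild (V ^~ w) /\ abs_summable (fun n =>
    b n w ^+ 2 * V n w ^+ (2 * m) / L n `^ (1 - g) ^+ 2)}.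
  move: rp PB; apply: filterS2 => w rpw [h1 h2]; split.
    exact (mild_of_power rpw (ltn0Sn m) h1).
  exact (slope_power_summable rpw (ltn0Sn m) g0 g1 gm h1 h2).
pose u1 k w := b k w * x k w ^+ m / L k `^ (1 - g).
pose u1' k w := b' k w * x' k w ^+ m / L k `^ (1 - g).
pose u2 k w := second_order (x k w) (b k w) (f k w) m.+1.
pose u2' k w := second_order (x' k w) (b' k w) (f' k w) m.+1.
pose u3 k w := f k w * Num.sqrt (f k w) * (1 + x k w) ^+ m.+1.
pose u3' k w := f' k w * Num.sqrt (f' k w) * (1 + x' k w) ^+ m.+1.
pose u4 k w := drift (J ^~ w) k * (b k w * x k w ^+ m).
pose u5 k w := drift (J ^~ w) k * (f k w * (1 + x k w) ^+ m.+1).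
have mdrift n : measurable_wrt (F n) (fun w => drift (J ^~ w) n).
  by apply: measurable_funM; [exact: J_predictable|exact: measurable_cst].
have a2' : 2 <= a := ltW a2.
have r12 : 1 <= r <= 2 by rewrite (ltW r1).
have N1 : {ae P, forall w, abs_summable (fun k => u1 k w ^+ 2) ->
    bounded_seq (fun n => \sum_(k < n) u1 k w * eps k.+1 w)}.
  apply: (noise_martingale_bounded F_filtration eps_md eps_moment) => // n.
  exact (measurable_wrt_scaled_slope (fun k => L k `^ (1 - g)) m x_adapted b_adapted).
have N1' : {ae P, forall w, abs_summable (fun k => u1' k w ^+ 2) ->
    bounded_seq (fun n => \sum_(k < n) u1' k w * eps k.+1 w)}.
  apply: (noise_martingale_bounded F_filtration eps_md eps_moment) => // n.
  exact (measurable_wrt_scaled_slope (fun k => L k `^ (1 - g)) m x'_adapted b'_adapted).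
have N4 : {ae P, forall w, abs_summable (fun k => u4 k w ^+ 2) ->
    bounded_seq (fun n => \sum_(k < n) u4 k w * eps k.+1 w)}.
  apply: (noise_martingale_bounded F_filtration eps_md eps_moment) => // n.
  apply: measurable_funM; first exact: mdrift.
  by apply: measurable_funM; [exact: b_adapted|apply: measurable_funX; exact: x_adapted].
have N2 : {ae P, forall w, abs_summable (fun k => `|u2 k w| `^ r) ->
    bounded_seq (fun n => \sum_(k < n) u2 k w * (eps k.+1 w ^+ (2 * 1) - sig))}.
  apply: (noise_even_moment_bounded F_filtration eps_md eps_moment r12 ra eps_var) => n.
  exact: measurable_wrt_second_order.
have N2' : {ae P, forall w, abs_summable (fun k => `|u2' k w| `^ r) ->
    bounded_seq (fun n => \sum_(k < n) u2' k w * (eps k.+1 w ^+ (2 * 1) - sig))}.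
  apply: (noise_even_moment_bounded F_filtration eps_md eps_moment r12 ra eps_var) => n.
  exact: measurable_wrt_second_order.
have N3 : {ae P, forall w, abs_summable (u3 ^~ w) ->
    abs_summable (fun k => u3 k w * env k w)}.
  apply: (noise_summable F_filtration eps_md eps_moment) => n.
  exact: measurable_wrt_remainder.
have N3' : {ae P, forall w, abs_summable (u3' ^~ w) ->
    abs_summable (fun k => u3' k w * env k w)}.
  apply: (noise_summable F_filtration eps_md eps_moment) => n.
  exact: measurable_wrt_remainder.
have N5 : {ae P, forall w, abs_summable (u5 ^~ w) ->
    abs_summable (fun k => u5 k w * env k w)}.
  apply: (noise_summable F_filtration eps_md eps_moment) => n.
  apply: measurable_funM; first exact: mdrift.
  apply: measurable_funM; first exact: f_adapted.
  by apply: measurable_funX; apply: measurable_funD; [exact: measurable_cst|exact: x_adapted].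
(* Finitely many almost sure events are intersected here; the rest is a deterministic argument on a
   fixed path. *)
have all1 := aeI rp (aeI IH base).
have all2 := aeI (aeI N1 N1') (aeI N4 (aeI N2 N2')).
have all3 := aeI N3 (aeI N3' N5).
apply: filterS (aeI all1 (aeI all2 all3)) => w.
move=> [[rpw [[_ sl ss _] [mV slopeS]]] [[[n1 n1'] [n4 [n2 n2']]] [n3 [n3' n5]]]].
have x0w := rp_x0 rpw; have f'0w := rp_f'0 rpw; have x'0w := x'0 rpw.
have mx : mild (x ^~ w).
  by apply: mild_bigO mV _ => //; exists 1 => n; rewrite mul1r ger0_norm.
have mx' := mild_x' rpw mV.
have f'd : decay (f' ^~ w).
  by exists eta; split; [exact: rp_eta rpw|exact: rp_f'd rpw].
have {}n1 := n1 (slope_martingale_summable (m := m.+1) rpw slopeS).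
have {}n1' := n1' (slope'_martingale_summable (m := m.+1) rpw mV g1 slopeS).
have {}n4 := n4 (drift_martingale_summable rpw m.+1 mV).
have {}n2 := n2 (second_order_powR_summable rpw m.+1 r1 x0w (f0 ^~ w)
  (rp_bfx rpw) mx (rp_fwmild rpw) (rp_fdecay rpw)).
have {}n2' := n2' (second_order_powR_summable rpw m.+1 r1 x'0w f'0w
  (rp_bfx' rpw) mx' (rp_f'wmild rpw) f'd).
have {}n3 := n3 (remainder_summable rpw m.+1 (f0 ^~ w) mx
  (rp_fwmild rpw) (rp_fdecay rpw)).
have {}n3' := n3' (remainder_summable rpw m.+1 f'0w mx' (rp_f'wmild rpw) f'd).
have {}n5 := n5 (drift_remainder_summable rpw m.+1 mV).
have ss' : (1 < m.+1)%N ->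
    asymp (fun n => \sum_(k < n) b k w ^+ 2 * V k w ^+ m.-1) (stage_limit m).
  exact: ss.
rewrite stage_limitS; split => //.
- exact (stage_leverage rpw (ltn0Sn m) ma mV g0 g1 sl ss' n1' n2' n3' n4 n5).
- by move=> _; exact (stage_slope rpw (ltn0Sn m) ma mV g0 g1 sl ss' n1 n1' n2 n2' n3 n3').
- move=> _.
  by have [] := stage_energy' rpw (ltn0Sn m) ma mV g0 g1 sl ss' n1' n2' n3'.
Qed.

End stages.

Section measurable_matrices.
Context {disp : measure_display} {T : measurableType disp} {R : realType}.
Variable G : set (set T).

(* Only the entries are required to be measurable: no sigma-algebra is put on
   spaces of matrices. *)
Definition mx_measurable m n (A : T -> 'M[R]_(m, n)) :=
  forall i j, measurable_wrt G (fun w => A w i j).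

Lemma mx_measurable_cst m n (A : 'M[R]_(m, n)) : mx_measurable (fun=> A).
Proof. by move=> i j; exact: measurable_cst. Qed.

Lemma mx_measurableM m n q (A : T -> 'M[R]_(m, n)) (B : T -> 'M[R]_(n, q)) :
  mx_measurable A -> mx_measurable B -> mx_measurable (fun w => A w *m B w).
Proof.
move=> mA mB i j; under eq_fun do rewrite mxE.
by apply: measurable_sum => k; apply: measurable_funM; [exact: mA|exact: mB].
Qed.

Lemma mx_measurableD m n (A B : T -> 'M[R]_(m, n)) :
  mx_measurable A -> mx_measurable B -> mx_measurable (fun w => A w + B w).
Proof.
move=> mA mB i j; under eq_fun do rewrite mxE.
by apply: measurable_funD; [exact: mA|exact: mB].
Qed.

Lemma mx_measurableZ m n (c : T -> R) (A : T -> 'M[R]_(m, n)) :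
  measurable_wrt G c -> mx_measurable A -> mx_measurable (fun w => c w *: A w).
Proof.
move=> mc mA i j; under eq_fun do rewrite mxE.
by apply: measurable_funM; [exact: mc|exact: mA].
Qed.

Lemma mx_measurable_tr m n (A : T -> 'M[R]_(m, n)) :
  mx_measurable A -> mx_measurable (fun w => (A w)^T).
Proof. by move=> mA i j; under eq_fun do rewrite mxE; exact: mA. Qed.

Lemma mx_measurable_sum m n N (A : nat -> T -> 'M[R]_(m, n)) :
  (forall k, (k < N)%N -> mx_measurable (A k)) ->
  mx_measurable (fun w => \sum_(k < N) A k w).
Proof.
move=> mA i j; under eq_fun do rewrite summxE.
by apply: measurable_sum => k; apply: mA.
Qed.

Lemma measurable_det n (A : T -> 'M[R]_n) :
  mx_measurable A -> measurable_wrt G (fun w => \det (A w)).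
Proof.
move=> mA; apply: measurable_sum => s; apply: measurable_funM.
  exact: measurable_cst.
elim: (index_enum _) => [|i r IH].
  by under eq_fun do rewrite big_nil; exact: measurable_cst.
under eq_fun do rewrite big_cons.
by apply: measurable_funM; [exact: mA|exact: IH].
Qed.

(** The cofactor formula expresses each entry through determinants, which are polynomials in the
    entries. *)
Lemma mx_measurable_inv n (A : T -> 'M[R]_n) : mx_measurable A ->
  (forall w, A w \in unitmx) -> mx_measurable (fun w => invmx (A w)).
Proof.
move=> mA uA i j.
have -> : (fun w => invmx (A w) i j) =
    (fun w => (\det (A w))^-1 * ((-1) ^+ (j + i) * \det (row' j (col' i (A w))))).
  by apply/funext => w; rewrite /invmx uA !mxE.
apply: measurable_funM.
  by apply: measurableT_comp (measurable_det mA); exact: measurable_invr.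
apply: measurable_funM; first exact: measurable_cst.
apply: measurable_det => k l; under eq_fun do rewrite !mxE.
exact: mA.
Qed.

Lemma measurable_bil_form n (D : T -> 'M[R]_n) (u v : T -> 'cV[R]_n) :
  mx_measurable D -> mx_measurable u -> mx_measurable v ->
  measurable_wrt G (fun w => bil_form (D w) (u w) (v w)).
Proof.
move=> mD mu mv.
exact: (mx_measurableM (mx_measurableM (mx_measurable_tr mu) mD) mv).
Qed.

Lemma measurable_quad_form n (D : T -> 'M[R]_n) (u : T -> 'cV[R]_n) :
  mx_measurable D -> mx_measurable u ->
  measurable_wrt G (fun w => quad_form (D w) (u w)).
Proof. by move=> mD mu; exact: (measurable_bil_form mD mu mu). Qed.

End measurable_matrices.

Section adapted_processes.
Context {disp : measure_display} {T : measurableType disp} {R : realType} {d : nat}.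
Variable F : nat -> set (set T).
Hypothesis F_filtration : filtration F.
Variables (theta : 'cV[R]_d.+1).
Variables (eps : nat -> T -> R) (X : int -> T -> R) (S : 'M[R]_d.+1).
Hypothesis X_ar : autoregressive F theta eps X.
Hypothesis S_posdef : sym_posdef S.
Hypothesis eps_adapted : forall n, measurable_wrt (F n.+1) (eps n.+1).
Let Phi n w : 'cV[R]_d.+1 := regressor X n w.
Let e n w := eps n.+1 w.

Lemma mx_measurable_mono m n k l (A : T -> 'M[R]_(k, l)) : (m <= n)%N ->
  mx_measurable (F m) A -> mx_measurable (F n) A.
Proof. by move=> mn mA i j; apply: (measurable_wrt_mono F_filtration mn); exact: mA. Qed.

Lemma regressor_adapted n : mx_measurable (F n) (Phi n).
Proof.
elim: n => [|n IH].
  move=> i j; have [h _] := X_ar.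
  have -> : (fun w => Phi 0 w i j) = X (- i%:Z).
    by apply/funext => w; rewrite mxE sub0r.
  exact: h.
have -> : Phi n.+1 = (fun w => companion theta *m Phi n w + e n w *: delta_mx 0 0).
  by apply/funext => w; exact: (regressor_step X_ar).
apply: mx_measurableD.
  apply: mx_measurableM; first exact: mx_measurable_cst.
  exact: mx_measurable_mono IH.
by apply: mx_measurableZ; [exact: eps_adapted|exact: mx_measurable_cst].
Qed.

(** The Gram matrix of index n+1 stops at the regressor of time n. Hence the updated gain, and with
    it the leverage, the slope and the energy after the update, is known before the noise of the
    next step. *)
Lemma gramS_predictable n : mx_measurable (F n) (fun w => gramS S (Phi ^~ w) n.+1).
Proof.
apply: mx_measurableD; last exact: mx_measurable_cst.
apply: (mx_measurable_sum (A := fun k w => Phi k w *m (Phi k w)^T)) => k kn.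
have mk : mx_measurable (F n) (Phi k).
  by apply: mx_measurable_mono (@regressor_adapted k); rewrite -ltnS.
by apply: mx_measurableM => //; exact: mx_measurable_tr.
Qed.

Lemma gain_predictable n : mx_measurable (F n) (fun w => gain S (Phi ^~ w) n.+1).
Proof.
apply: mx_measurable_inv; first exact: gramS_predictable.
by move=> w; apply: posdef_unit; exact: gramS_posdef.
Qed.

Lemma gain_adapted n : mx_measurable (F n) (fun w => gain S (Phi ^~ w) n).
Proof.
case: n => [|n]; last exact: mx_measurable_mono (@gain_predictable n).
have -> : (fun w => gain S (Phi ^~ w) 0) = (fun=> invmx S).
  by apply/funext => w; rewrite /gain /gramS big_ord0 add0r.
exact: mx_measurable_cst.
Qed.

Lemma score_adapted n : mx_measurable (F n) (fun w => score S theta (Phi ^~ w) (e ^~ w) n).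
Proof.
apply: mx_measurableD; last exact: mx_measurable_cst.
apply: (mx_measurable_sum (A := fun k w => e k w *: Phi k w)) => k kn.
apply: mx_measurableZ.
  exact: (measurable_wrt_mono F_filtration kn).
by apply: mx_measurable_mono (@regressor_adapted k); exact: ltnW.
Qed.

End adapted_processes.

(** * Almost sure growth rates of the noise and of its sums *)

Section noise_rates.
Context {disp : measure_display} {T : measurableType disp} {R : realType}.
Variable P : probability T R.
Variable F : nat -> set (set T).
Hypothesis F_filtration : filtration F.
Variable eps : nat -> T -> R.
Hypothesis eps_md : martingale_difference P F eps.
Variable a : R.
Hypothesis a2 : 2 < a.
Hypothesis eps_moment : exists M : nat -> T -> \bar R,
  (forall n : nat,
    is_cond_expectation P (F n) (fun w => (`|eps n.+1 w| `^ a)%:E) (M n)) /\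
  {ae P, forall w, (ereal_sup (range (fun n : nat => M n w)) < +oo)%E}.
Local Notation s := (@s R).
Let e n w := eps n.+1 w.

(** The midpoint b of 1/a and 1/2: b > 1/a makes the noise O(n^b), and b < 1/2 makes the squared
    regressors o(n). *)
Definition noise_exponent : R := 4^-1 + (2 * a)^-1.
(** A quarter of 1 - 2b, for b the noise exponent: this leaves room both for 2 b + del <= 1 and for
    the summability condition 2 (b - 1 + del) < -1 behind [cross_term_rate]. *)
Definition gram_exponent : R := (1 - 2 * noise_exponent) / 4.

Lemma noise_exponentE : noise_exponent * a = a / 4 + 2^-1.
Proof. by rewrite /noise_exponent; field; rewrite gt_eqF// (lt_trans _ a2). Qed.

Let ia : 0 < (2 * a)^-1 < 4^-1.
Proof.
have a0 : 0 < a by rewrite (lt_trans _ a2).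
rewrite invr_gt0 mulr_gt0//= ltf_pV2 ?posrE ?mulr_gt0//.
by move: a2 => h; lra.
Qed.

Lemma noise_exponent_ge0 : 0 <= noise_exponent.
Proof. by move: ia; rewrite /noise_exponent; move: ((2 * a)^-1) => t; lra. Qed.

Lemma gram_exponent_bounds : 0 < gram_exponent <= 8^-1.
Proof.
by move: ia; rewrite /gram_exponent /noise_exponent; move: ((2 * a)^-1) => t; lra.
Qed.

(** With b the noise exponent, b a = a/4 + 1/2 exceeds 1 because a > 2. The series of s^(-b a) |e|^a
    then has almost surely bounded partial sums, and so each of its terms is bounded. *)
Lemma noise_growth : {ae P, forall w, polyO noise_exponent (e ^~ w)}.
Proof.
pose u n (w : T) := s n `^ (- (noise_exponent * a)).
have a0 : 0 < a by rewrite (lt_trans _ a2).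
have mu n : measurable_wrt (F n) (u n) by exact: measurable_cst.
have := noise_summable F_filtration eps_md eps_moment mu.
apply: filterS => w h.
have [|C hC] := h.
  apply: (@polyO_summable _ (- (noise_exponent * a))); last exact: polyO_powR.
  by rewrite noise_exponentE; move: a2; lra.
have C0 : 0 <= C by rewrite (le_trans _ (hC 0%N))// big_ord0.
exists (C `^ a^-1) => n.
have ea : `|e n w| `^ a <= C * s n `^ (noise_exponent * a).
  have := hC n.+1; rewrite big_ord_recr /= => h1.
  have h2 : `|u n w * envelope eps a n w| <= C.
    by rewrite (le_trans _ h1)// lerDr sumr_ge0.
  rewrite -ler_pdivrMr ?s_powR_gt0// -powRN mulrC (le_trans _ h2)//.
  rewrite (le_trans _ (ler_norm _))// ler_wpM2l ?powR_ge0// /envelope.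
  by rewrite lerDr.
have -> : `|e n w| = (`|e n w| `^ a) `^ a^-1.
  by rewrite -powRrM divff ?gt_eqF// powRr1.
have -> : C `^ a^-1 * s n `^ noise_exponent = (C * s n `^ (noise_exponent * a)) `^ a^-1.
  by rewrite powRM ?powR_ge0// -powRrM mulfK// gt_eqF.
apply: ge0_ler_powR ea; rewrite ?nnegrE ?powR_ge0//.
  by rewrite invr_ge0 ltW.
by rewrite mulr_ge0// powR_ge0.
Qed.

Let psum_polyO (y : nat -> R) t : 0 <= t ->
  bounded_seq (fun n => \sum_(k < n) s k `^ (- t) * y k) ->
  polyO t (fun n => \sum_(k < n) y k).
Proof.
move=> t0 [C hC]; exists (2 * C) => n.
apply: (psum_le_of_weighted (x := y) (w := fun k => s k `^ t)) => //.
- by move=> k; exact: s_powR_gt0.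
- exact: s_powR_nondecr.
- move=> k; rewrite (le_trans _ (hC k))// le_eqVlt; apply/orP; left; apply/eqP.
  by congr (`|_|); apply: eq_bigr => i _; rewrite powRN mulrC.
Qed.

Lemma even_moment_rate (j : nat) (sj r t : R) :
  1 <= r <= 2 -> (2 * j)%:R * r <= a -> 0 <= t -> 1 < t * r ->
  (forall n, is_cond_expectation P (F n)
    (fun w => (eps n.+1 w ^+ (2 * j))%:E) (cst sj%:E)) ->
  {ae P, forall w, polyO t (fun n => \sum_(k < n) (e k w ^+ (2 * j) - sj))}.
Proof.
move=> r12 jr t0 tr ce.
pose u n (w : T) := s n `^ (- t).
have mu n : measurable_wrt (F n) (u n) by exact: measurable_cst.
have := noise_even_moment_bounded F_filtration eps_md eps_moment r12 jr ce mu.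
apply: filterS => w h.
apply: (@psum_polyO (fun k => e k w ^+ (2 * j) - sj) t t0); apply: h.
have /andP[r1 _] := r12.
apply: (@polyO_summable _ (- t * r)).
  by move: tr; rewrite mulNr => h1; lra.
by apply: polyO_norm_powR; [exact: le_trans ler01 r1|exact: polyO_powR].
Qed.

Lemma cross_term_rate (u : nat -> T -> R) :
  (forall n, measurable_wrt (F n) (u n)) ->
  {ae P, forall w, polyO noise_exponent (u ^~ w)} ->
  {ae P, forall w, polyO (1 - gram_exponent) (fun n => \sum_(k < n) u k w * e k w)}.
Proof.
move=> mu hu; pose t := 1 - gram_exponent.
have /andP[d0 d1] := gram_exponent_bounds.
pose v n w := s n `^ (- t) * u n w.
have mv n : measurable_wrt (F n) (v n).
  by apply: measurable_funM; [exact: measurable_cst|exact: mu].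
have := noise_martingale_bounded F_filtration eps_md eps_moment (ltW a2) mv.
move: hu; apply: filterS2 => w hu h.
apply: (@psum_polyO (fun k => u k w * e k w) t).
  by rewrite subr_ge0 (le_trans d1)//; lra.
have [|C hC] := h.
  apply: (@polyO_summable _ ((- t + noise_exponent) * 2%:R)); last first.
    by apply: polyOX; apply: polyOM hu; exact: polyO_powR.
  move: ia; rewrite /t /gram_exponent /noise_exponent.
  by move: ((2 * a)^-1) => z; lra.
exists C => n; rewrite (le_trans _ (hC n))// le_eqVlt; apply/orP; left; apply/eqP.
by congr (`|_|); apply: eq_bigr => i _; rewrite /v mulrA.
Qed.

End noise_rates.

Section autoregression_path.
Context {disp : measure_display} {T : measurableType disp} {R : realType} {d : nat}.
Variable P : probability T R.
Variable F : nat -> set (set T).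
Hypothesis F_filtration : filtration F.
Variable eps : nat -> T -> R.
Hypothesis eps_md : martingale_difference P F eps.
Variable a : R.
Hypothesis a2 : 2 < a.
Hypothesis eps_moment : exists M : nat -> T -> \bar R,
  (forall n : nat,
    is_cond_expectation P (F n) (fun w => (`|eps n.+1 w| `^ a)%:E) (M n)) /\
  {ae P, forall w, (ereal_sup (range (fun n : nat => M n w)) < +oo)%E}.
Variable sigma : R.
Hypothesis eps_var : forall n : nat,
  is_cond_expectation P (F n) (fun w => (eps n.+1 w ^+ 2)%:E) (cst (sigma ^+ 2)%:E).
Variables (theta : 'cV[R]_d.+1) (X : int -> T -> R) (S : 'M[R]_d.+1).
Hypothesis X_ar : autoregressive F theta eps X.
Hypothesis C_decaying : decaying (companion theta).
Hypothesis S_posdef : sym_posdef S.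
Hypothesis sigma_neq0 : sigma != 0.
Local Notation s := (@s R).
Local Notation L := (@L R).
Let e n w := eps n.+1 w.
Let Phi n w : 'cV[R]_d.+1 := regressor X n w.
Let Lc := limit_cov (companion theta) sigma.
Let Li := invmx Lc.
Let N n w := score S theta (Phi ^~ w) (e ^~ w) n.
Let del := gram_exponent a.
Let V n w := energy S theta (Phi ^~ w) (e ^~ w) n.

Let eps_adapted n : measurable_wrt (F n.+1) (eps n.+1).
Proof. by case: (eps_md n). Qed.

Lemma autoregression_rates : {ae P, forall w,
  [/\ polyO (noise_exponent a) (e ^~ w),
      forall i, polyO (1 - del) (fun n => \sum_(k < n) Phi k w i 0 * e k w) &
      polyO (1 - del) (fun n => \sum_(k < n) (e k w ^+ 2 - sigma ^+ 2))]}.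
Proof.
have growth := noise_growth F_filtration eps_md a2 eps_moment.
have /andP[d0 d1] := gram_exponent_bounds a2.
have b0 := noise_exponent_ge0 a2.
have cross : {ae P, forall w, forall i : 'I_d.+1,
    polyO (1 - del) (fun n => \sum_(k < n) Phi k w i 0 * e k w)}.
  apply: filter_forall => i.
  apply: (cross_term_rate F_filtration eps_md a2 eps_moment (u := fun n w => Phi n w i 0)).
    by move=> n; exact: (regressor_adapted F_filtration X_ar eps_adapted).
  apply: filterS growth => w gw.
  have := regressor_growth C_decaying (regressor_step X_ar w) b0 gw.
  by apply: bigO_le => n; rewrite (ger0_norm (nrm_ge0 _)); exact: entry_le_nrm.
have square : {ae P, forall w,
    polyO (1 - del) (fun n => \sum_(k < n) (e k w ^+ (2 * 1) - sigma ^+ 2))}.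
  apply: (even_moment_rate F_filtration eps_md eps_moment
    (r := Num.min 2 (a / 2))) => //.
  - rewrite ge_min lexx andbT le_min ler1n /= ler_pdivlMr// mul1r; exact: ltW.
  - rewrite muln1; apply: (@le_trans _ _ (2 * (a / 2))).
      by rewrite ler_wpM2l// ge_min lexx orbT.
    by rewrite mulrCA divff// mulr1.
  - by rewrite subr_ge0 (le_trans d1)//; lra.
  - rewrite minr_pMr; last by rewrite subr_ge0 (le_trans d1)//; lra.
    rewrite lt_min; apply/andP; split; first by move: d1; rewrite -/del; lra.
    have a0 : 0 < a by rewrite (lt_trans _ a2).
    have -> : (1 - del) * (a / 2) = 1 + (a - 2) * 7 / 16.
      by rewrite /del /gram_exponent /noise_exponent; field; rewrite gt_eqF.
    by move: a2; lra.
move: growth cross square; apply: filterS3 => w h1 h2 h3; split => //.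
Qed.

Lemma autoregression_regular : {ae P, forall w,
  regular_path d.+1%:R del (fun n => 1 + nrm (Phi n w) ^+ 2) (e ^~ w)
    (leverage S (Phi ^~ w)) (slope S theta (Phi ^~ w) (e ^~ w))
    (energy_after S theta (Phi ^~ w) (e ^~ w)) (energy S theta (Phi ^~ w) (e ^~ w))
    (fun n => quad_form Li (Phi n w) / s n.+1)
    (fun n => bil_form Li (Phi n w) (N n w) / s n.+1)
    (fun n => quad_form Li (N n w) / s n.+1)
    (fun n => quad_form Li (N n w) / s n)
    (fun n => quad_form Li (Phi n w))
    (fun n => \sum_(k < n) (quad_form Li (Phi k w) - d.+1%:R)) /\
  bigO (fun n => s n `^ (- del) * V n w)
    (fun n => s n * quad_form Lc (lse S X n w - theta) - quad_form Li (N n w) / s n)}.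
Proof.
have /andP[d0 d1] := gram_exponent_bounds a2.
have b0 := noise_exponent_ge0 a2.
have d1' : del <= 1 by rewrite (le_trans d1)//; lra.
have bd : noise_exponent a *+ 2 + del <= 1.
  rewrite -mulr_natl; move: d0; rewrite /del /gram_exponent.
  by move: (noise_exponent a) => z; lra.
apply: filterS autoregression_rates => w [h1 h2 h3].
have st := regressor_step X_ar w.
split.
  exact (autoregressive_regular_path C_decaying S_posdef sigma_neq0 st d0 d1' b0 bd h1 h2 h3).
have [K hK] := estimation_error_close C_decaying S_posdef sigma_neq0 st d0 d1' b0 bd h1 h2 h3.
by exists K => n; rewrite (lse_error X_ar S_posdef).
Qed.

Section with_moments.
Variable p : nat.
Hypothesis p0 : (0 < p)%N.
Hypothesis pa : (2 * p)%:R < a.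

Lemma autoregression_stage m : (m <= p)%N -> {ae P, forall w,
  [/\ (0 < m)%N -> mild (V ^~ w),
      asymp (fun n => \sum_(k < n) leverage S (Phi ^~ w) k * V k w ^+ m)
        (d.+1%:R * stage_limit (sigma ^+ 2) d.+1%:R m),
      (0 < m)%N ->
        asymp (fun n => \sum_(k < n)
          slope S theta (Phi ^~ w) (e ^~ w) k ^+ 2 * V k w ^+ m.-1)
          (stage_limit (sigma ^+ 2) d.+1%:R m) &
      (0 < m)%N ->
        asymp (fun n => \sum_(k < n) (quad_form Li (N k w) / s k) ^+ m / s k)
          (stage_limit (sigma ^+ 2) d.+1%:R m)]}.
Proof.
move=> mp.
have mPhi := regressor_adapted F_filtration X_ar eps_adapted.
have mN := score_adapted F_filtration S X_ar eps_adapted.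
have mG := gain_predictable F_filtration X_ar S_posdef eps_adapted.
have mG0 := gain_adapted F_filtration X_ar S_posdef eps_adapted.
have mLi n : mx_measurable (F n) (fun=> Li) by exact: mx_measurable_cst.
have scaled n (c : R) (Y : T -> R) : measurable_wrt (F n) Y ->
    measurable_wrt (F n) (fun w => Y w / c).
  by move=> mY; apply: measurable_funM => //; exact: measurable_cst.
apply: (stage F_filtration eps_md a2 eps_moment eps_var
  (Q := fun n w => 1 + nrm (Phi n w) ^+ 2)
  (f := fun n w => leverage S (Phi ^~ w) n)
  (b := fun n w => slope S theta (Phi ^~ w) (e ^~ w) n)
  (x := fun n w => energy_after S theta (Phi ^~ w) (e ^~ w) n)
  (f' := fun n w => quad_form Li (Phi n w) / s n.+1)
  (b' := fun n w => bil_form Li (Phi n w) (N n w) / s n.+1)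
  (x' := fun n w => quad_form Li (N n w) / s n.+1)
  (V' := fun n w => quad_form Li (N n w) / s n)
  (h := fun n w => quad_form Li (Phi n w))
  (J := fun n w => \sum_(k < n) (quad_form Li (Phi k w) - d.+1%:R))
  _ _ _ _ _ _ _ _ _ _ _ _ _ _ p0 (ltW pa) mp).
- by apply: filterS autoregression_regular => w [h _]; exact: h.
- by move=> n; apply: measurable_quad_form; [exact: mG|exact: mPhi].
- by move=> n; apply: measurable_bil_form; [exact: mG|exact: mPhi|exact: mN].
- by move=> n; apply: measurable_quad_form; [exact: mG|exact: mN].
- by move=> n; apply: measurable_quad_form; [exact: mG0|exact: mN].
- by move=> n; apply: scaled; apply: measurable_quad_form; [exact: mLi|exact: mPhi].
- by move=> n; apply: scaled; apply: measurable_bil_form; [exact: mLi|exact: mPhi|exact: mN].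
- by move=> n; apply: scaled; apply: measurable_quad_form; [exact: mLi|exact: mN].
- move=> n; apply: measurable_sum => k; apply: measurable_funB; last exact: measurable_cst.
  apply: (measurable_wrt_mono F_filtration (m := k)); first by rewrite -ltnS.
  by apply: measurable_quad_form; [exact: mLi|exact: mPhi].
- by move=> n w; rewrite leverage_ge0//= ltW// leverage_lt1.
- by move=> n w; exact: energy_after_ge0.
- by move=> n w; exact: energy_after_le.
- by move=> n w; exact: slope_sqr_le.
- by move=> n w; exact: energy_S.
Qed.

End with_moments.
End autoregression_path.

(** * Estimation and prediction errors *)

Section estimation_error_powers.
Context {disp : measure_display} {T : measurableType disp} {R : realType} {d : nat}.
Local Notation s := (@s R).
Local Notation L := (@L R).

Lemma stage_limit_ell (sigma : R) p : (0 < p)%N ->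
  stage_limit (sigma ^+ 2) d.+1%:R p = ell d.+1 sigma p.
Proof.
case: p => // p _; rewrite /stage_limit /ell big_split /= prodr_const card_ord.
rewrite big_ord_recl /= mulr0 addr0 exprM -mulrA mulrCA; congr (_ * (_ * _)).
by rewrite big_add1 /= big_mkord; apply: eq_bigr => i _; rewrite natrD natrM.
Qed.

Lemma sum_power_close (y : nat -> R) c : asymp (fun n => \sum_(k < n) y k) c ->
  (fun n : nat => (ln n%:R)^-1 * \sum_(1 <= k < n.+1) y k) @ \oo --> c.
Proof.
move=> h; apply: asymp_cvg.
have h1 : asymp (fun n => \sum_(k < n.+1) y k) c.
  exact: (asymp_shift h).
have := asympD h1 (asymp_bounded (_ : bounded_seq (fun=> - y 0%N))).
rewrite addr0 => h2; apply: eq_asymp (h2 _); last by exists `|- y 0%N|.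
by move=> n; rewrite big_add1 /= big_mkord big_ord_recl /= addrAC subrr add0r.
Qed.

(** k^m u^(m+1) is (k/s)^m times (s u)^(m+1)/s. Both k/s - 1 and s u - V' decay polynomially, so the
    replacement costs a summable series. *)
Lemma scaled_power_asymp (Q u V' : nat -> R) m c :
  (forall n, 1 <= Q n) -> (exists C, forall n, \sum_(k < n.+1) Q k <= C * s n) ->
  mild V' -> decay (fun k => s k * u k - V' k) ->
  asymp (fun n => \sum_(k < n) V' k ^+ m.+1 / s k) c ->
  asymp (fun n => \sum_(k < n) k%:R ^+ m * u k ^+ m.+1) c.
Proof.
move=> Q1 QS mV' dU hV'.
pose U k := s k * u k.
have mU : mild U.
  have := mildD mV' (decay_is_mild dU); rewrite (_ : (fun n => _) = U)//.
  by apply/funext => n; rewrite addrC subrK.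
have d1 : decay (fun k => (k%:R / s k) ^+ m - 1 ^+ m).
  apply: (@decayX_sub R (fun=> 1)); first exact: mild_cst.
  apply: decay_le (@decay_inv_s R) => k.
  have -> : k%:R = s k - 1 by rewrite /s -natr1 addrK.
  by rewrite mulrBl divff ?gt_eqF ?s_gt0// mul1r addrAC subrr add0r normrN.
have d2 := decayD (decay_mild d1 (mildX m.+1 mU)) (decayX_sub mV' dU m.+1).
apply: (asymp_sum_close (x := fun k => V' k ^+ m.+1 / s k)
  (y := fun k => k%:R ^+ m * u k ^+ m.+1) hV').
apply: (negl_summable Q1 QS).
have := wmild_decay Q1 (wmild_inv_s Q1) d2; apply: negl_le => k.
rewrite le_eqVlt; apply/orP; left; apply/eqP; congr (`|_|).
have tn0 : s k != 0 by rewrite gt_eqF// s_gt0.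
have zn0 : s k ^+ m != 0 by rewrite expf_neq0.
rewrite /U expr1n !exprMn exprVn (exprS (s k)).
move: (k%:R ^+ m) (V' k ^+ m.+1) (u k ^+ m.+1) (s k ^+ m) zn0 => A B D z zn0.
by move: (s k) tn0 => t tn0; field; rewrite tn0 zn0.
Qed.

End estimation_error_powers.

(** * Empirical moments of the residuals *)

Section residual_moments.
Context {R : realType}.
Local Notation s := (@s R).
Local Notation L := (@L R).

Lemma sum_CS n (u v : nat -> R) :
  (\sum_(k < n) u k * v k) ^+ 2 <= (\sum_(k < n) u k ^+ 2) * (\sum_(k < n) v k ^+ 2).
Proof.
have quadE (w : nat -> R) : quad_form 1%:M (\col_(k < n) w k) = \sum_(k < n) w k ^+ 2.
  by rewrite /quad_form mulmx1 mxE; apply: eq_bigr => k _; rewrite !mxE expr2.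
have p1 : sym_posdef (1%:M : 'M[R]_n).
  split; first exact: trmx1.
  move=> w wn0; rewrite /quad_form mulmx1 mxE lt_def.
  have q0 : 0 <= \sum_j w^T 0 j * w j 0.
    by apply: sumr_ge0 => j _; rewrite mxE -expr2 sqr_ge0.
  rewrite q0 andbT; apply: contra wn0 => /eqP h.
  apply/eqP/matrixP => i j; rewrite (ord1 j) mxE; apply/eqP.
  have h1 : w^T 0 i * w i 0 = 0.
    by apply: (psumr_eq0P _ h) => // k _; rewrite mxE -expr2 sqr_ge0.
  by move: h1; rewrite mxE -expr2 => /eqP; rewrite sqrf_eq0.
have := bil_form_CS (\col_(k < n) u k) (\col_(k < n) v k) p1.
rewrite !quadE; congr (_ <= _); congr (_ ^+ 2).
by rewrite /bil_form mulmx1 mxE; apply: eq_bigr => k _; rewrite !mxE.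
Qed.

Lemma exprD_le m (u v : R) : 0 <= u -> 0 <= v ->
  (u + v) ^+ m <= 2 ^+ m * (u ^+ m + v ^+ m).
Proof.
move=> u0 v0; wlog uv : u v u0 v0 / u <= v.
  move=> h; have [uv|/ltW vu] := leP u v; first exact: h.
  by rewrite addrC [u ^+ m + _]addrC; exact: h.
apply: (@le_trans _ _ ((2 * v) ^+ m)).
  by rewrite lerXn2r ?nnegrE ?addr_ge0 ?mulr_ge0//; lra.
by rewrite exprMn ler_wpM2l ?exprn_ge0// lerDr exprn_ge0.
Qed.

(** Factoring the difference of powers takes out y, and every remaining factor is at most |x| +
    |y|. *)
Lemma shifted_power_close m : exists C, 0 <= C /\ forall x y : R,
  `|(x - y) ^+ m.+1 - x ^+ m.+1| <= C * (`|y| * `|x| ^+ m + `|y| ^+ m.+1).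
Proof.
exists (m.+1%:R * 2 ^+ m); split; first by rewrite mulr_ge0 ?exprn_ge0.
move=> x y; rewrite subrXX addrAC subrr add0r normrM normrN.
rewrite [`|y| ^+ m.+1]exprS -mulrDr mulrCA ler_wpM2l//.
rewrite (le_trans (ler_norm_sum _ _ _))//.
apply: (@le_trans _ _ (\sum_(i < m.+1) (`|x| + `|y|) ^+ m)).
  apply: ler_sum => i _; have im : (i <= m)%N by rewrite -ltnS.
  rewrite normrM !normrX.
  have -> : (`|x| + `|y|) ^+ m = (`|x| + `|y|) ^+ (m - i) * (`|x| + `|y|) ^+ i.
    by rewrite -exprD subnK.
  apply: ler_pM; rewrite ?exprn_ge0//.
    by rewrite lerXn2r ?nnegrE ?addr_ge0// (le_trans (ler_normB _ _)).
  by rewrite lerXn2r ?nnegrE ?addr_ge0// lerDl.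
rewrite sumr_const card_ord -[leLHS]mulr_natl -mulrA ler_wpM2l//.
exact: exprD_le.
Qed.

Variables (q : nat) (s2q t : R) (e pe : nat -> R).
Hypothesis q0 : (0 < q)%N.
Hypothesis t1 : t < 1.
Hypothesis pe_square : bigO L (fun n => \sum_(k < n) pe k ^+ 2).
Hypothesis pe_bounded : bounded_seq pe.
Hypothesis pe_noise :
  bounded_seq (fun n => \sum_(k < n) pe k ^+ 2 * (e k ^+ (2 * q) - s2q)).
Hypothesis noise_rate : polyO t (fun n => \sum_(k < n) (e k ^+ (2 * q) - s2q)).

Let D n := \sum_(k < n) ((e k - pe k) ^+ (2 * q) - e k ^+ (2 * q)).

Lemma L_le_s n : L n <= s n.
Proof.
have h : ln (1 + n%:R) <= n%:R :> R by apply: le_ln1Dx; rewrite (lt_le_trans (ltrN10 _)).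
by rewrite /L /s -natr1 addrC lerD2r addrC.
Qed.

(** The dominant term |pe| |e|^(2q-1) is split as (|pe| |e|^(q-1)) |e|^q. By Cauchy-Schwarz it is
    controlled by the sum of pe^2 e^(2q-2), which is O(log n) by e^(2q-2) <= 1 + e^(2q) and
    [pe_noise], and by the sum of e^(2q), which is O(n). The term |pe|^(2q) sums to O(log n) because
    [pe] is bounded. *)
Lemma residual_moment_sqr : exists K, 0 <= K /\ forall n, D n ^+ 2 <= K * (s n * L n).
Proof.
have [q' qE] : exists q', q = q'.+1 by exists q.-1; rewrite prednK.
have noise := pe_noise; have rate := noise_rate; rewrite qE in noise rate.
have L0 n : 0 <= L n := ltW (L_gt0 n).
have s0 n : 0 <= s n := ltW (s_gt0 n).
have [C [C0 hC]] := shifted_power_close (2 * q').+1.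
have [K1 [K10 hK1]] := bigO_ge0 L0 pe_square.
have [B hB] := pe_bounded.
have B0 : 0 <= B := le_trans (normr_ge0 _) (hB 0%N).
have [K3 hK3] := noise.
have K30 : 0 <= K3 := le_trans (normr_ge0 _) (hK3 0%N).
have [K4 [K40 hK4]] := bigO_ge0 (fun n => powR_ge0 _ _) rate.
have sumpe n : \sum_(k < n) pe k ^+ 2 <= K1 * L n.
  exact: le_trans (ler_norm _) (hK1 n).
have A n : \sum_(k < n) (`|pe k| * `|e k| ^+ q') ^+ 2 <= (`|1 + s2q| * K1 + K3) * L n.
  apply: (@le_trans _ _ (\sum_(k < n) ((1 + s2q) * pe k ^+ 2 +
      pe k ^+ 2 * (e k ^+ (2 * q'.+1) - s2q)))).
    apply: ler_sum => k _.
    have -> : (1 + s2q) * pe k ^+ 2 + pe k ^+ 2 * (e k ^+ (2 * q'.+1) - s2q) =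
      pe k ^+ 2 * (1 + e k ^+ (2 * q'.+1)) by ring.
    rewrite exprMn real_normK ?num_real// ler_wpM2l ?sqr_ge0//.
    rewrite exprM -[e k ^+ 2]real_normK ?num_real// -!exprM.
    have [e1|e1] := leP `|e k| 1.
      rewrite (@le_trans _ _ 1)//; first exact: exprn_ile1.
      by rewrite lerDl exprn_ge0.
    rewrite (@le_trans _ _ (`|e k| ^+ (2 * q'.+1)))// ?lerDr//.
    apply: ler_weXn2l; first exact: ltW.
    by rewrite mulnC leq_mul2l leqnSn.
  rewrite big_split /= -mulr_sumr [leRHS]mulrDl lerD//.
    rewrite -mulrA (le_trans (ler_norm _))// normrM ler_wpM2l//.
    exact: hK1.
  rewrite (le_trans (ler_norm _))// (le_trans (hK3 n))// ler_peMr//.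
  exact: L_ge1.
have Bn n : \sum_(k < n) (`|e k| ^+ q'.+1) ^+ 2 <= (`|s2q| + K4) * s n.
  have -> : \sum_(k < n) (`|e k| ^+ q'.+1) ^+ 2 =
      n%:R * s2q + \sum_(k < n) (e k ^+ (2 * q'.+1) - s2q).
    rewrite sumrB sumr_const card_ord mulr_natl [RHS]addrC subrK.
    by apply: eq_bigr => k _; rewrite -exprM mulnC !exprM real_normK ?num_real.
  rewrite [leRHS]mulrDl lerD//.
    rewrite mulrC (le_trans (ler_wpM2r _ (ler_norm _)))// ler_wpM2l//.
    by rewrite /s ler_nat.
  rewrite (le_trans (ler_norm _))// (le_trans (hK4 n))// ler_wpM2l//.
  rewrite -[leRHS](powRr1 (s0 n)); apply: s_powR_le; exact: ltW.
have E n : `|\sum_(k < n) `|pe k| ^+ (2 * q').+2| <= B ^+ (2 * q') * K1 * L n.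
  rewrite ger0_norm; last by apply: sumr_ge0 => k _; rewrite exprn_ge0.
  rewrite -mulrA (le_trans _ (ler_wpM2l _ (sumpe n))) ?exprn_ge0// mulr_sumr.
  apply: ler_sum => k _; rewrite -addn2 exprD real_normK ?num_real//.
  by rewrite ler_wpM2r ?sqr_ge0// lerXn2r ?nnegrE.
have Dle n : `|D n| <= C * (\sum_(k < n) (`|pe k| * `|e k| ^+ q') * `|e k| ^+ q'.+1 +
    \sum_(k < n) `|pe k| ^+ (2 * q').+2).
  rewrite -big_split mulr_sumr (le_trans (ler_norm_sum _ _ _))//.
  apply: ler_sum => k _; rewrite qE; have -> : (2 * q'.+1 = (2 * q').+2)%N by rewrite mulnS.
  rewrite (le_trans (hC _ _))// ler_wpM2l// lerD2r -mulrA -exprD.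
  by rewrite addnS addnn -mul2n.
set a1 := fun n => \sum_(k < n) (`|pe k| * `|e k| ^+ q') * `|e k| ^+ q'.+1 in Dle.
set b1 := fun n => \sum_(k < n) `|pe k| ^+ (2 * q').+2 in Dle E.
pose KA := (`|1 + s2q| * K1 + K3) * (`|s2q| + K4).
pose KB := (B ^+ (2 * q') * K1) ^+ 2.
have KA0 : 0 <= KA by rewrite mulr_ge0 ?addr_ge0 ?mulr_ge0.
exists (2 * C ^+ 2 * (KA + KB)); split.
  by rewrite !mulr_ge0 ?sqr_ge0// addr_ge0 ?sqr_ge0.
move=> n; have h1 : a1 n ^+ 2 <= KA * (s n * L n).
  apply: le_trans (@sum_CS n (fun k => `|pe k| * `|e k| ^+ q')
    (fun k => `|e k| ^+ q'.+1)) _.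
  apply: (@le_trans _ _ ((`|1 + s2q| * K1 + K3) * L n * ((`|s2q| + K4) * s n))).
    by apply: ler_pM => //; apply: sumr_ge0 => k _; exact: sqr_ge0.
  by rewrite /KA le_eqVlt; apply/orP; left; apply/eqP; ring.
have h2 : b1 n ^+ 2 <= KB * (s n * L n).
  rewrite -real_normK ?num_real//.
  apply: (@le_trans _ _ ((B ^+ (2 * q') * K1 * L n) ^+ 2)).
    by rewrite lerXn2r ?nnegrE// (le_trans _ (E n)).
  rewrite exprMn ler_wpM2l ?sqr_ge0// expr2 ler_wpM2r//.
  exact: L_le_s.
rewrite -real_normK ?num_real//.
apply: (@le_trans _ _ ((C * (a1 n + b1 n)) ^+ 2)).
  by rewrite lerXn2r ?nnegrE// (le_trans _ (Dle n)).
apply: (@le_trans _ _ (2 * C ^+ 2 * (a1 n ^+ 2 + b1 n ^+ 2))).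
  have -> : 2 * C ^+ 2 * (a1 n ^+ 2 + b1 n ^+ 2) =
    C ^+ 2 * (2 * (a1 n ^+ 2 + b1 n ^+ 2)) by ring.
  rewrite exprMn ler_wpM2l ?sqr_ge0//.
  have := sqr_ge0 (a1 n - b1 n); rewrite sqrrB sqrrD.
  by move: (a1 n * b1 n) (a1 n ^+ 2) (b1 n ^+ 2) => *; lra.
rewrite -[leRHS]mulrA ler_wpM2l ?mulr_ge0 ?sqr_ge0//.
by rewrite [leRHS]mulrDl lerD.
Qed.

Lemma mean_cvg0 (y : nat -> R) (t' : R) : t' < 1 -> polyO t' y ->
  (fun n : nat => n%:R^-1 * y n) @ \oo --> (0 : R).
Proof.
move=> t'1 /bigO_ge0-/(_ (fun n => powR_ge0 _ _))[C [C0 hC]].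
apply/cvgrPdist_le => /= r r0.
have [||N hN] := @s_powR_small R (1 - t') (r / (2 * C + 1)).
- by rewrite subr_gt0.
- by rewrite divr_gt0// ltr_pwDr// mulr_ge0.
exists N.+1 => // n /= Nn; rewrite sub0r normrN normrM.
have n0 : (0 < n)%N by exact: leq_ltn_trans Nn.
have nR : (0 : R) < n%:R by rewrite ltr0n.
rewrite ger0_norm ?invr_ge0 ?(ltW nR)// ler_pdivrMl//.
rewrite (le_trans (hC n))//.
have sn : s n <= 2 * n%:R.
  rewrite /s -natr1 -[2]/(1 + 1) mulrDl mul1r lerD2l ler1n //.
have -> : s n `^ t' = s n * s n `^ (- (1 - t')).
  rewrite -[X in X * _]powRr1 ?(ltW (s_gt0 n))// -s_powRD; congr (_ `^ _); ring.
have h1 : s n `^ (- (1 - t')) <= r / (2 * C + 1) by apply: hN; exact: ltnW.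
apply: (@le_trans _ _ (C * (2 * n%:R * (r / (2 * C + 1))))).
  by rewrite ler_wpM2l//; apply: ler_pM => //; rewrite ?powR_ge0 ?(ltW (s_gt0 n)).
have -> : C * (2 * n%:R * (r / (2 * C + 1))) = n%:R * r * (2 * C / (2 * C + 1)) by ring.
rewrite ler_piMr ?mulr_ge0 ?(ltW nR) ?(ltW r0)// ler_pdivrMr ?mul1r ?lerDl//.
by rewrite ltr_pwDr// mulr_ge0.
Qed.

Lemma residual_moment_bigO :
  (fun n : nat => (n%:R^-1 * D n) ^+ 2) =O_\oo (fun n : nat => ln n%:R / n%:R).
Proof.
have [K [K0 hK]] := residual_moment_sqr.
have [N hN] := @ln_unbounded R 2.
apply/eqOP; near=> k; near=> n.
have n0 : (0 < n)%N by near: n; exists 1%N.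
have nR : (0 : R) < n%:R by rewrite ltr0n.
have l2 : 2 <= ln n%:R :> R by apply: hN; near: n; exists N.
have l0 : 0 <= ln n%:R :> R by apply: le_trans l2.
rewrite (ger0_norm (sqr_ge0 _)) ger0_norm ?divr_ge0 ?(ltW nR)//.
(* The factor 4 comes from s n <= 2 n and L n <= 2 ln n, the latter once ln n >= 2. *)
apply: (@le_trans _ _ (4 * K * (ln n%:R / n%:R))); last first.
  by rewrite ler_wpM2r ?divr_ge0 ?(ltW nR)//; near: k; apply: nbhs_pinfty_ge; rewrite num_real.
rewrite exprMn exprVn mulrC ler_pdivrMr ?exprn_gt0// (le_trans (hK n))//.
have sn : s n <= 2 * n%:R.
  by rewrite /s -natr1 -[2]/(1 + 1) mulrDl mul1r lerD2l ler1n.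
have Ln : L n <= 2 * ln n%:R.
  have : ln (s n) <= 1 + ln n%:R.
    rewrite (@le_trans _ _ (ln (2 * n%:R)))//.
      by rewrite ler_ln ?posrE ?s_gt0// mulr_gt0.
    rewrite lnM ?posrE// lerD2r.
    have := @le_ln1Dx R 1 _; rewrite -[1 + 1]/2; apply.
    by rewrite (lt_trans (ltrN10 _)).
  by rewrite /L; move: (ln (s n)) (ln n%:R) l2 => u v; lra.
have -> : 4 * K * (ln n%:R / n%:R) * n%:R ^+ 2 = K * (2 * n%:R * (2 * ln n%:R)).
  by field; rewrite gt_eqF.
rewrite ler_wpM2l//; by apply: ler_pM => //; rewrite ?(ltW (s_gt0 n)) ?(ltW (L_gt0 n)).
Unshelve. all: by end_near. Qed.

Lemma residual_moment_cvg :
  (fun n : nat => n%:R^-1 * \sum_(k < n) (e k - pe k) ^+ (2 * q)) @ \oo --> s2q.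
Proof.
have [K [K0 hK]] := residual_moment_sqr.
(* D^2 is O(n log n), and bounding the logarithm by n^(1/2) gives the exponent 3/4, below the 1
   needed for the averages. *)
have hD : polyO (3 / 4) D.
  have h1 : polyO (4^-1 * 2%:R) L.
    by apply: mild_L; rewrite mulr_gt0// invr_gt0.
  have [C [C0 hC]] := bigO_ge0 (fun n => powR_ge0 _ _) h1.
  exists (K * C + 1) => n.
  have p0 : 0 <= s n `^ (3 / 4) by exact: powR_ge0.
  rewrite -(@ler_pXn2r _ 2) ?nnegrE ?mulr_ge0 ?addr_ge0 ?mulr_ge0//.
  rewrite real_normK ?num_real// (le_trans (hK n))// exprMn.
  have -> : s n `^ (3 / 4) ^+ 2 = s n * s n `^ (4^-1 * 2%:R).
    rewrite -powR_mulrn ?powR_ge0// -powRrM -[X in _ = X * _]powRr1 ?(ltW (s_gt0 n))//.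
    by rewrite -s_powRD; congr (_ `^ _); field.
  have h2 : L n <= C * s n `^ (4^-1 * 2%:R) by exact: le_trans (ler_norm _) (hC n).
  apply: (@le_trans _ _ (K * C * (s n * s n `^ (4^-1 * 2%:R)))).
    rewrite -mulrA ler_wpM2l// mulrCA ler_wpM2l// ltW// s_gt0.
  rewrite ler_wpM2r ?mulr_ge0 ?powR_ge0 ?(ltW (s_gt0 n))//.
  have KC : 0 <= K * C by rewrite mulr_ge0.
  by move: (K * C) KC => z z0; nra.
have h1 : (fun n : nat => n%:R^-1 * (D n + \sum_(k < n) (e k ^+ (2 * q) - s2q)))
    @ \oo --> (0 : R).
  apply: (@mean_cvg0 _ (Num.max (3 / 4) t)).
    by rewrite gt_max t1 andbT; lra.
  apply: bigOD; first by apply: polyO_le hD; rewrite le_max lexx.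
  by apply: polyO_le noise_rate; rewrite le_max lexx orbT.
have h2 : (fun n : nat => n%:R^-1 * (D n + \sum_(k < n) (e k ^+ (2 * q) - s2q)) + s2q)
    @ \oo --> s2q.
  by rewrite -[X in _ --> X]add0r; apply: cvgD => //; exact: cvg_cst.
apply: cvg_trans h2; apply: near_eq_cvg; near=> n.
have n0 : (0 < n)%N by near: n; exists 1%N.
rewrite /D -big_split /=.
have -> : \sum_(k < n) ((e k - pe k) ^+ (2 * q) - e k ^+ (2 * q) +
    (e k ^+ (2 * q) - s2q)) = \sum_(k < n) (e k - pe k) ^+ (2 * q) - n%:R * s2q.
  rewrite mulr_natl -[X in s2q *+ X]card_ord -sumr_const -sumrB.
  by apply: eq_bigr => k _; rewrite addrA subrK.
rewrite mulrBr mulrA mulVf ?mul1r ?subrK// pnatr_eq0 -lt0n //.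
Unshelve. all: by end_near. Qed.

End residual_moments.

(** * Prediction errors with and without noise *)

Section prediction_errors.
Context {R : realType}.
Local Notation s := (@s R).
Local Notation L := (@L R).

Lemma decay_eventually (y : nat -> R) (r : R) : decay y -> 0 < r ->
  exists N, forall n, (N <= n)%N -> `|y n| <= r.
Proof.
move=> [eta [eta0 /bigO_ge0-/(_ (fun n => powR_ge0 _ _))[C [C0 hC]]]] r0.
have [|N hN] := @s_powR_small R eta (r / (C + 1)) eta0.
  by rewrite divr_gt0// ltr_pwDr.
exists N => n Nn; rewrite (le_trans (hC n))// (le_trans (ler_wpM2l C0 (hN n Nn)))//.
rewrite mulrCA ler_piMr ?(ltW r0)// ler_pdivrMr ?mul1r ?lerDl//.
by rewrite ltr_pwDr.
Qed.

Variables (dd eta : R) (Q e f b x V f' b' x' V' h J pe : nat -> R).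
Hypothesis rp : regular_path dd eta Q e f b x V f' b' x' V' h J.
Hypothesis f_lt1 : forall n, f n < 1.
Hypothesis b_pe : forall n, b n = (1 - f n) * pe n.
Hypothesis mV : mild V.

(** As the leverage tends to 0, 1/(1 - f) is at most 2 from some index on; before it, f < 1 leaves
    finitely many finite values. *)
Lemma pred_error_sqr_le : exists K, 0 <= K /\ forall n, pe n ^+ 2 <= K * b n ^+ 2.
Proof.
have [|N hN] := @decay_eventually f 2^-1 (rp_fdecay rp); first by rewrite invr_gt0.
have [|C hC] := @bigO_eventually R (fun=> 1) (fun n => (1 - f n)^-1) N 2 (fun=> ltr01).
  move=> n Nn; have := hN n Nn; have := f_lt1 n; have /andP[f0 _] := rp_f01 rp n.
  rewrite (ger0_norm f0) => f1 f2; have q0 : 0 < 1 - f n by lra.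
  rewrite ger0_norm ?invr_ge0 ?(ltW q0)// mulr1 -[leRHS]invrK lef_pV2 ?posrE ?invr_gt0//.
  by lra.
exists (C ^+ 2); split; first exact: sqr_ge0.
move=> n; have q0 : 1 - f n != 0 by rewrite gt_eqF// subr_gt0.
have -> : pe n = (1 - f n)^-1 * b n by rewrite b_pe mulrA mulVf// mul1r.
have C0 : 0 <= C by have := le_trans (normr_ge0 _) (hC 0%N); rewrite mulr1.
have Cn : `|(1 - f n)^-1| <= C by have := hC n; rewrite mulr1.
by rewrite exprMn ler_wpM2r ?sqr_ge0// -real_normK ?num_real// lerXn2r ?nnegrE.
Qed.

Let bdecay : decay (fun n => b n ^+ 2).
Proof.
have mx : mild x.
  apply: mild_bigO mV _ => [n|]; first exact: le_trans (rp_x0 rp n) (rp_xV rp n).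
  by exists 1 => n; rewrite mul1r ger0_norm ?(rp_x0 rp)// (rp_xV rp).
apply: decay_le (decay_mild (rp_fdecay rp) mx) => n.
by rewrite ger0_norm ?sqr_ge0// (le_trans (rp_bfx rp n))// ler_norm.
Qed.

Lemma pred_error_bounded : bounded_seq pe.
Proof.
have [K [K0 hK]] := pred_error_sqr_le.
have [et [et0 /bigO_ge0-/(_ (fun n => powR_ge0 _ _))[C [C0 hC]]]] := bdecay.
exists (K * C + 1) => n.
have KC : 0 <= K * C by rewrite mulr_ge0.
rewrite -(@ler_pXn2r _ 2) ?nnegrE ?addr_ge0// real_normK ?num_real//.
rewrite (le_trans (hK n))// (@le_trans _ _ (K * C))//.
  rewrite ler_wpM2l// (le_trans (ler_norm _))// (le_trans (hC n))// ler_piMr//.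
  rewrite -[leRHS](powRr0 (s n)) s_powR_le// oppr_le0; exact: ltW.
by move: (K * C) KC => z z0; nra.
Qed.

Lemma pred_error_powR_summable (r : R) : 1 < r ->
  abs_summable (fun n => `|pe n ^+ 2| `^ r).
Proof.
move=> r1; have [K [K0 hK]] := pred_error_sqr_le.
have h1 := wmild_powR_negl (rp_Q1 rp) r1 (wmild_slope rp mV) bdecay.
have h2 := negl_summable (rp_Q1 rp) (rp_QS rp) h1.
apply: abs_summable_bigO h2 _; exists (K `^ r) => n.
rewrite !ger0_norm ?powR_ge0 ?sqr_ge0// -powRM ?sqr_ge0//.
apply: ge0_ler_powR (hK n); rewrite ?nnegrE ?sqr_ge0//.
  by rewrite (le_trans ler01)// ltW.
exact: mulr_ge0 K0 (sqr_ge0 _).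
Qed.

Lemma pred_error_square_bigO :
  bigO L (fun n => \sum_(k < n) b k ^+ 2) -> bigO L (fun n => \sum_(k < n) pe k ^+ 2).
Proof.
move=> [C hC]; have [K [K0 hK]] := pred_error_sqr_le; exists (K * C) => n.
rewrite ger0_norm; last by apply: sumr_ge0 => k _; exact: sqr_ge0.
apply: (@le_trans _ _ (\sum_(k < n) K * b k ^+ 2)); first exact: ler_sum.
by rewrite -mulr_sumr -mulrA ler_wpM2l// (le_trans (ler_norm _)).
Qed.

End prediction_errors.

Section noiseless.
Context {R : realType} {d : nat}.
Local Notation s := (@s R).
Local Notation L := (@L R).
Variables (theta : 'cV[R]_d.+1) (S : 'M[R]_d.+1).
Hypothesis C_decaying : decaying (companion theta).
Hypothesis S_posdef : sym_posdef S.
Variables (Phi : nat -> 'cV[R]_d.+1) (e : nat -> R).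
Hypothesis Phi_S : forall n, Phi n.+1 = companion theta *m Phi n + e n *: delta_mx 0 0.
Hypothesis e0 : forall n, e n = 0.
Let pe := pred_error S theta Phi e.

(* With zero noise the score is constant, and every vector is the score of some
   parameter: the monotonicity of the energy is that of the gain. *)
Lemma gain_noninc u n : quad_form (gain S Phi n) u <= quad_form (gain S Phi 0) u.
Proof.
pose th := - (invmx S *m u).
have scoreE k : score S th Phi (fun=> 0) k = u.
  rewrite /score big1 ?add0r => [|i _]; last by rewrite scale0r.
  by rewrite /th mulmxN opprK mulmxA mulmxV ?posdef_unit// mul1mx.
have E k : energy S th Phi (fun=> 0) k = quad_form (gain S Phi k) u.
  by rewrite /energy scoreE.
rewrite -!E; elim: n => // n IH; apply: le_trans IH.
rewrite energy_S// mulr0 mul0r addr0 expr0n /= mul0r addr0.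
exact: energy_after_le.
Qed.

Let Phi_bounded : exists K, 0 <= K /\ forall n, nrm (Phi n) <= K.
Proof.
have h : polyO 0 e by exists 0 => n; rewrite e0 normr0 mul0r.
have [K [K0 hK]] := bigO_ge0 (fun n => powR_ge0 _ _)
  (regressor_growth C_decaying Phi_S (lexx 0) h).
by exists K; split => // n; have := hK n; rewrite powRr0 mulr1 ger0_norm ?nrm_ge0.
Qed.

Let energy_step n : energy S theta Phi e n.+1 = energy_after S theta Phi e n.
Proof. by rewrite energy_S// e0 mulr0 mul0r addr0 expr0n /= mul0r addr0. Qed.

Let gain_Phi_le : exists K, 0 <= K /\ forall n, quad_form (gain S Phi n) (Phi n) <= K.
Proof.
have [K [K0 hK]] := Phi_bounded.
exists (nrm (gain S Phi 0) * K ^+ 2); split.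
  by rewrite mulr_ge0 ?nrm_ge0// sqr_ge0.
move=> n; rewrite (le_trans (gain_noninc _ _))// (le_trans (ler_norm _))//.
rewrite (le_trans (quad_form_le_nrm _ _))// ler_wpM2l ?nrm_ge0//.
by rewrite lerXn2r ?nnegrE ?nrm_ge0.
Qed.

Lemma noiseless_pred_error_bounded : bounded_seq pe.
Proof.
have [K [K0 hK]] := gain_Phi_le; pose V0 := energy S theta Phi e 0.
have V0_ge0 : 0 <= V0 by exact: energy_ge0.
have Vle n : energy S theta Phi e n <= V0.
  elim: n => // n IH; rewrite energy_step; apply: le_trans IH.
  exact: energy_after_le.
exists (K * V0 + 1) => n; have KV : 0 <= K * V0 by rewrite mulr_ge0.
rewrite -(@ler_pXn2r _ 2) ?nnegrE ?addr_ge0// real_normK ?num_real//.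
apply: (@le_trans _ _ (K * V0)).
  apply: le_trans (bil_form_CS _ _ (gain_posdef S_posdef Phi n)) _.
  by apply: ler_pM => //; [apply: quad_form_ge0; exact: gain_posdef|exact: energy_ge0|exact: Vle].
by move: (K * V0) KV => z z0; nra.
Qed.

(** The drop of the energy is (1 - f) pe^2, and 1/(1 - f) = 1 + g, where g is the value of the gain
    at the regressor, bounded because the gain decreases and the regressors are bounded. With zero
    noise the drops telescope to at most the initial energy. *)
Lemma noiseless_pred_error_square_le : exists K, 0 <= K /\
  forall n, \sum_(k < n) pe k ^+ 2 <= K.
Proof.
have [K [K0 hK]] := gain_Phi_le; pose V0 := energy S theta Phi e 0.
have V0_ge0 : 0 <= V0 by exact: energy_ge0.
have pele k : pe k ^+ 2 <= (1 + K) * (energy S theta Phi e k - energy S theta Phi e k.+1).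
  rewrite energy_step energy_drop//; set f := leverage S Phi k.
  have f1 : f < 1 := leverage_lt1 S_posdef Phi k.
  have h : quad_form (gain S Phi k) (Phi k) = f + f * quad_form (gain S Phi k) (Phi k).
    exact: leverage_gain.
  have hk := hK k; have p2 := sqr_ge0 (pe k); rewrite -/(pe k).
  rewrite mulrA ler_peMl//; move: h hk; move: (quad_form _ _) => z h hk; nra.
exists ((1 + K) * V0); split; first by rewrite mulr_ge0// addr_ge0.
move=> n; apply: (@le_trans _ _ ((1 + K) * (V0 - energy S theta Phi e n))).
  elim: n => [|n IH]; first by rewrite big_ord0 subrr mulr0.
  rewrite big_ord_recr /=; have := lerD IH (pele n); rewrite -mulrDr.
  by rewrite addrA subrK.
by rewrite ler_wpM2l ?addr_ge0// gerDl oppr_le0; exact: energy_ge0.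
Qed.

End noiseless.

Section consistency.
Context {disp : measure_display} {T : measurableType disp} {R : realType} {d : nat}.
Variable P : probability T R.
Variable F : nat -> set (set T).
Hypothesis F_filtration : filtration F.
Variable eps : nat -> T -> R.
Hypothesis eps_md : martingale_difference P F eps.
Variable sigma : R.
Hypothesis eps_var : forall n : nat,
  is_cond_expectation P (F n) (fun w => (eps n.+1 w ^+ 2)%:E) (cst (sigma ^+ 2)%:E).
Variables (p : nat) (a : R).
Hypothesis p_gt0 : (0 < p)%N.
Hypothesis a_gt : (2 * p)%:R < a.
Hypothesis eps_moment : exists M : nat -> T -> \bar R,
  (forall n : nat,
    is_cond_expectation P (F n) (fun w => (`|eps n.+1 w| `^ a)%:E) (M n)) /\
  {ae P, forall w, (ereal_sup (range (fun n : nat => M n w)) < +oo)%E}.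
Variables (theta : 'cV[R]_d.+1) (X : int -> T -> R) (S : 'M[R]_d.+1).
Hypothesis X_ar : autoregressive F theta eps X.
Hypothesis C_decaying : decaying (companion theta).
Hypothesis S_posdef : sym_posdef S.
Variables (q : nat) (sigma2q : R).
Hypothesis q_gt0 : (0 < q)%N.
Hypothesis q_le_p : (q <= p)%N.
Hypothesis eps_2q : forall n : nat,
  is_cond_expectation P (F n) (fun w => (eps n.+1 w ^+ (2 * q))%:E)
    (cst sigma2q%:E).
Local Notation s := (@s R).
Local Notation L := (@L R).
Let e n w := eps n.+1 w.
Let Phi n w : 'cV[R]_d.+1 := regressor X n w.
Let pe n w := pred_error S theta (Phi ^~ w) (e ^~ w) n.

Let a2 : 2 < a.
Proof.
by rewrite (le_lt_trans _ a_gt)// -[2]/(2%:R) ler_nat -{1}[2%N]muln1 leq_mul2l p_gt0.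
Qed.

Let eps_adapted n : measurable_wrt (F n.+1) (eps n.+1).
Proof. by case: (eps_md n). Qed.

Lemma zero_noise : sigma = 0 -> {ae P, forall w, forall n, e n w = 0}.
Proof.
move=> s0; apply: ae_foralln => n.
have [mY _ _ YA] := eps_var n; have [sF _ _] := F_filtration.
have FT : F n setT by have [h1 h2 _] := sF n; rewrite -(setD0 setT); exact: h2.
have := YA _ FT; rewrite s0 expr0n /= integral0 => h.
have : (\int[P]_(w in setT) `|(eps n.+1 w ^+ 2)%:E| = 0)%E.
  rewrite [RHS]h; apply: eq_integral => w _.
  by rewrite gee0_abs// lee_fin sqr_ge0.
move/(ae_eq_integral_abs P measurableT mY); apply: filterS => w /(_ I)[/eqP].
by rewrite sqrf_eq0 => /eqP.
Qed.

(** [rq] exceeds 1 because 2 q <= 2 p < a. [tq] lies halfway between 1/rq and 1, so that [tq * rq] >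
    1 as [even_moment_rate] asks, while [tq] < 1 makes the averages converge. *)
Let rq : R := Num.min 2 (a / (2 * q)%:R).
Let tq : R := (1 + rq^-1) / 2.
Let qR : (0 : R) < (2 * q)%:R. Proof. by rewrite ltr0n muln_gt0. Qed.
Let rq1 : 1 < rq.
Proof.
rewrite lt_min ltr1n /= ltr_pdivlMr// mul1r (le_lt_trans _ a_gt)//.
by rewrite ler_nat leq_mul2l q_le_p orbT.
Qed.
Let rq2 : 1 <= rq <= 2. Proof. by rewrite (ltW rq1) ge_min lexx. Qed.
Let rqa : (2 * q)%:R * rq <= a.
Proof. by rewrite -ler_pdivlMl// mulrC ge_min lexx orbT. Qed.
Let rq0 : 0 < rq. Proof. exact: lt_trans rq1. Qed.
Let tq1 : tq < 1.
Proof.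
have : rq^-1 < 1 by rewrite invf_lt1.
by rewrite /tq; move: (rq^-1) => z; lra.
Qed.

Let noise_rate : {ae P, forall w,
  polyO tq (fun n => \sum_(k < n) (e k w ^+ (2 * q) - sigma2q))}.
Proof.
apply: (even_moment_rate F_filtration eps_md eps_moment rq2 rqa _ _ eps_2q).
  by rewrite divr_ge0// addr_ge0// invr_ge0 ltW.
rewrite /tq mulrAC mulrDl mul1r mulVf ?gt_eqF//; move: rq1.
by move: rq => z; lra.
Qed.

Lemma pred_error_control : {ae P, forall w,
  [/\ bigO L (fun n => \sum_(k < n) pe k w ^+ 2), bounded_seq (pe ^~ w) &
    bounded_seq (fun n =>
      \sum_(k < n) pe k w ^+ 2 * (e k w ^+ (2 * q) - sigma2q))]}.
Proof.
(* For sigma = 0 the matrix [limit_cov] is null and has no inverse, so the noiseless estimates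
   replace the regular trajectory. *)
have [s0|s0] := eqVneq sigma 0.
  apply: filterS (zero_noise s0) => w e0.
  have st := regressor_step X_ar w.
  have [K [K0 hK]] := noiseless_pred_error_square_le C_decaying S_posdef st e0.
  split.
  - exists K => n; rewrite ger0_norm; last by apply: sumr_ge0 => k _; exact: sqr_ge0.
    by rewrite (le_trans (hK n))// ler_peMr// L_ge1.
  - exact: (noiseless_pred_error_bounded C_decaying S_posdef st e0).
  - exists (K * `|sigma2q|) => n.
    under eq_bigr do rewrite e0 expr0n muln_eq0 /= (negbTE (_ : q != 0%N)) -?lt0n// sub0r.
    rewrite -mulr_suml normrM normrN ler_wpM2r//.
    by rewrite ger0_norm ?sumr_ge0// => k _; exact: sqr_ge0.
have reg := autoregression_regular F_filtration eps_md a2 eps_moment eps_var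
  X_ar C_decaying S_posdef s0.
have st := autoregression_stage F_filtration eps_md a2 eps_moment eps_var
  X_ar C_decaying S_posdef s0 p_gt0 a_gt (m := 1) p_gt0.
have mpe n : measurable_wrt (F n) (fun w => pe n w ^+ 2).
  apply: measurable_funX; apply: measurable_bil_form.
  - exact: (gain_adapted F_filtration X_ar S_posdef eps_adapted).
  - exact: (regressor_adapted F_filtration X_ar eps_adapted).
  - exact: (score_adapted F_filtration S X_ar eps_adapted).
have noise := noise_even_moment_bounded F_filtration eps_md eps_moment rq2 rqa eps_2q mpe.
move: reg st noise; apply: filterS3 => w [rp _] [mV _ sl _] noise.
have {}mV := mV isT.
have f1 n := leverage_lt1 S_posdef (Phi ^~ w) n.
have bp n := slope_pred_error theta S_posdef (Phi ^~ w) (e ^~ w) n.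
split.
- apply: (pred_error_square_bigO rp f1 bp).
  have := asymp_bigO_L (sl isT); congr (bigO _ _); apply/funext => n.
  by apply: eq_bigr => k _; rewrite expr0 mulr1.
- exact (pred_error_bounded rp f1 bp mV).
- exact: noise (pred_error_powR_summable rp f1 bp mV rq1).
Qed.

Lemma Gamma_estE n w : Gamma_est S X (2 * q) n w =
  n%:R^-1 * \sum_(k < n) (e k w - pe k w) ^+ (2 * q).
Proof.
rewrite /Gamma_est big_mkord; congr (_ * _); apply: eq_bigr => k _.
by rewrite (prediction_residual X_ar S_posdef).
Qed.

Lemma Delta_estE n w : Delta_est eps (2 * q) n w =
  n%:R^-1 * \sum_(k < n) e k w ^+ (2 * q).
Proof. by rewrite /Delta_est big_add1 /= big_mkord. Qed.

Lemma Gamma_est_cvg : {ae P, forall w,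
  (fun n : nat => Gamma_est S X (2 * q) n w) @ \oo --> sigma2q}.
Proof.
move: pred_error_control noise_rate; apply: filterS2 => w [h1 h2 h3] h4.
under eq_fun do rewrite Gamma_estE.
exact (residual_moment_cvg (e := e ^~ w) (pe := pe ^~ w) q_gt0 tq1 h1 h2 h3 h4).
Qed.

Lemma Gamma_Delta_bigO : {ae P, forall w,
  (fun n : nat => (Gamma_est S X (2 * q) n w - Delta_est eps (2 * q) n w) ^+ 2)
    =O_\oo (fun n : nat => ln n%:R / n%:R)}.
Proof.
move: pred_error_control noise_rate; apply: filterS2 => w [h1 h2 h3] h4.
have -> : (fun n : nat => (Gamma_est S X (2 * q) n w - Delta_est eps (2 * q) n w) ^+ 2) =
    (fun n : nat => (n%:R^-1 * \sum_(k < n)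
      ((e k w - pe k w) ^+ (2 * q) - e k w ^+ (2 * q))) ^+ 2).
  by apply/funext => n; rewrite Gamma_estE Delta_estE -mulrBr sumrB.
exact (residual_moment_bigO (e := e ^~ w) (pe := pe ^~ w) q_gt0 tq1 h1 h2 h3 h4).
Qed.

Lemma lse_power_cvg : {ae P, forall w,
  (fun n : nat => (ln n%:R)^-1 * \sum_(1 <= k < n.+1) k%:R ^+ (p - 1) *
    quad_form (limit_cov (companion theta) sigma) (lse S X k w - theta) ^+ p)
  @ \oo --> ell d.+1 sigma p}.
Proof.
(* For sigma = 0 both the matrix and [ell] vanish, since p > 0, and the sequence is identically
   0. *)
have [s0|s0] := eqVneq sigma 0.
  apply: aeW => w.
  have L0 : limit_cov (companion theta) sigma = 0.
    apply/matrixP => i j; rewrite !mxE.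
    have -> : noise_cov sigma = 0 :> 'M[R]_d.+1.
      by apply/matrixP => k l; rewrite !mxE s0 expr0n /=; case: ifP.
    under eq_fun do under eq_bigr do rewrite mulmx0 mul0mx mxE.
    under eq_fun do rewrite big1//.
    exact: lim_cst.
  have -> : ell d.+1 sigma p = 0.
    by rewrite /ell s0 expr0n muln_eq0 /= -leqn0 leqNgt p_gt0 mulr0 mul0r.
  under eq_fun do under eq_bigr do
    rewrite L0 /quad_form mulmx0 mul0mx mxE expr0n -leqn0 leqNgt p_gt0 mulr0.
  under eq_fun do rewrite big1// mulr0.
  exact: cvg_cst.
have reg := autoregression_regular F_filtration eps_md a2 eps_moment eps_var
  X_ar C_decaying S_posdef s0.
have st := autoregression_stage F_filtration eps_md a2 eps_moment eps_var
  X_ar C_decaying S_posdef s0 p_gt0 a_gt (m := p) (leqnn p).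
move: reg st; apply: filterS2 => w [rp close] [/(_ p_gt0)mV _ _ /(_ p_gt0)st].
rewrite stage_limit_ell// in st.
have [m pE] : exists m, p = m.+1 by exists p.-1; rewrite prednK.
have mV' := mild_V' rp mV.
have dU : decay (fun k => s k * quad_form (limit_cov (companion theta) sigma)
    (lse S X k w - theta) -
    quad_form (invmx (limit_cov (companion theta) sigma))
      (score S theta (Phi ^~ w) (e ^~ w) k) / s k).
  have : decay (fun n => s n `^ (- gram_exponent a) * energy S theta (Phi ^~ w) (e ^~ w) n).
    apply: decay_mild mV; exists (gram_exponent a); split; first exact: rp_eta rp.
    exact: polyO_powR.
  move=> [e1 [e10 hh]]; exists e1; split => //.
  apply: (bigO_trans _ close hh) => n; rewrite mulr_ge0 ?powR_ge0//.
  exact: energy_ge0.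
apply: (sum_power_close (y := fun k => k%:R ^+ (p - 1) *
    quad_form (limit_cov (companion theta) sigma) (lse S X k w - theta) ^+ p)).
rewrite pE in st *; rewrite subSS subn0.
exact (scaled_power_asymp (rp_Q1 rp) (rp_QS rp) mV' dU st).
Qed.

End consistency.

Theorem corollary3p4 (R : realType) (disp : measure_display)
    (T : measurableType disp) (P : probability T R)
    (d : nat) (d_ge1 : (1 <= d)%N)
    (F : nat -> set (set T)) (F_filtration : filtration F)
    (eps : nat -> T -> R) (eps_md : martingale_difference P F eps)
    (sigma : R)
    (eps_var : forall n : nat,
      is_cond_expectation P (F n) (fun w => (eps n.+1 w ^+ 2)%:E)
        (cst (sigma ^+ 2)%:E))
    (p : nat) (p_ge1 : (1 <= p)%N) (a : R) (a_gt : (2 * p)%:R < a)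
    (eps_moment : exists M : nat -> T -> \bar R,
      (forall n : nat,
        is_cond_expectation P (F n) (fun w => (`|eps n.+1 w| `^ a)%:E) (M n)) /\
      {ae P, forall w, (ereal_sup (range (fun n : nat => M n w)) < +oo)%E})
    (theta : 'cV[R]_d) (X : int -> T -> R)
    (X_ar : autoregressive F theta eps X)
    (stable : spectral_radius (companion theta) < 1)
    (S : 'M[R]_d) (S_posdef : sym_posdef S)
    (q : nat) (q_ge1 : (1 <= q)%N) (q_le_p : (q <= p)%N) (sigma2q : R)
    (eps_2q : forall n : nat,
      is_cond_expectation P (F n) (fun w => (eps n.+1 w ^+ (2 * q))%:E)
        (cst sigma2q%:E)) :
  [/\ {ae P, forall w,
        (fun n : nat => Gamma_est S X (2 * q) n w) @ \oo --> sigma2q},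
      {ae P, forall w,
        (fun n : nat =>
           (Gamma_est S X (2 * q) n w - Delta_est eps (2 * q) n w) ^+ 2)
        =O_\oo (fun n : nat => ln n%:R / n%:R)} &
      {ae P, forall w,
        (fun n : nat =>
           (ln n%:R)^-1 * \sum_(1 <= k < n.+1)
             k%:R ^+ (p - 1) *
             quad_form (limit_cov (companion theta) sigma)
               (lse S X k w - theta) ^+ p) @ \oo
        --> ell d sigma p}].
Proof.
case: d d_ge1 theta X_ar stable S S_posdef => // d' _ theta' ar sr S' S'_posdef.
have dC := spectral_radius_decay sr.
split.
- exact: (Gamma_est_cvg F_filtration eps_md eps_var p_ge1 a_gt eps_moment
    ar dC S'_posdef q_ge1 q_le_p eps_2q).
- exact: (Gamma_Delta_bigO F_filtration eps_md eps_var p_ge1 a_gt eps_moment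
    ar dC S'_posdef q_ge1 q_le_p eps_2q).
- exact: (lse_power_cvg F_filtration eps_md eps_var p_ge1 a_gt eps_moment
    ar dC S'_posdef).
Qed.
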